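(* Let $R:V^{\otimes 2}\to V^{\otimes 2}$, $\dim V=N$, be the BMW symmetry coming from a quantum group $U_q(\mathfrak{g})$ with $\mathfrak{g}$ of orthogonal type ($B_n$ or $D_n$) or of symplectic type ($C_n$), with $q$ generic. Let $\Psi$ be the skew-inverse of $R$ and $B_i^j=\Psi_{ki}^{kj}$. Let $\mathcal{P}^{q},\mathcal{P}^{-q^{-1}},\mathcal{P}^{\mu}$ be the spectral idempotents of $R$. (Orthogonal series.) The permutation relations $$x^aR_{ai}^{bj}x_b=q^{-1}x_ix^j+\delta_i^j\qquad\Longleftrightarrow\qquad x^lx_k=q^{-1}x_ix^j\,\Psi_{jk}^{il}+B_k^l$$ are compatible with the defining relations of the algebras $\mathrm{Sym}_R(V)=T(V)/\langle\mathrm{Im}\,\mathcal{P}^{-q^{-1}}\rangle$ and $\mathrm{Sym}_R(V^* )=T(V^* )/\langle\mathrm{Im}\,\mathcal{P}^{-q^{-1}}\rangle$. (Symplectic series.) The permutation relations $$x^aR_{ai}^{bj}x_b=-q\,x_ix^j+\delta_i^j\qquad\Longleftrightarrow\qquad x^lx_k=-q\,x_ix^j\,\Psi_{jk}^{il}+B_k^l$$ are compatible with the defining relations of the algebras $\Lambda_R(V)=T(V)/\langle\mathrm{Im}\,\mathcal{P}^{q}\rangle$ and $\Lambda_R(V^* )=T(V^* )/\langle\mathrm{Im}\,\mathcal{P}^{q}\rangle$.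
   Context: Summation over repeated indices is understood; algebras are associative unital over $\mathbb{C}$. $V$ has basis $\{x_i\}_{1\le i\le N}$, $V^*$ has the right dual basis $\{x^i\}$ ($\langle x_i,x^j\rangle_r=\delta_i^j$), and $R(x_i\otimes x_j)=R_{ij}^{kl}x_k\otimes x_l$. **BMW symmetry.** $R$ is the composition of the usual flip $P$ with the image in $V^{\otimes 2}$ of the universal $R$-matrix of $U_q(\mathfrak{g})$, where $V$ is the first fundamental (vector) representation, with the Faddeev–Reshetikhin–Takhtajan normalization. Explicitly, $R=P\,\mathsf{R}$ with $$\mathsf{R}=q\sum_{i\ne i'}e_{ii}\otimes e_{ii}+\epsilon_0\,e_{mm}\otimes e_{mm}+\sum_{i\neq j,j'}e_{ii}\otimes e_{jj}+q^{-1}\sum_{i\ne i'}e_{i'i'}\otimes e_{ii}+(q-q^{-1})\sum_{i>j}e_{ij}\otimes e_{ji}-(q-q^{-1})\sum_{i>j}q^{\rho_i-\rho_j}\varepsilon_i\varepsilon_j\,e_{ij}\otimes e_{i'j'},$$ where $i'=N+1-i$; the term with $\epsilon_0=1$, $m=(N+1)/2$ is present only for $B_n$ ($\epsilon_0=0$ otherwise). For $B_n$: $N=2n+1$, $\rho=(n-\tfrac12,\dots,\tfrac12,0,-\tfrac12,\dots,-n+\tfrac12)$. For $C_n$: $N=2n$, $\rho=(n,\dots,1,-1,\dots,-n)$. For $D_n$: $N=2n$, $\rho=(n-1,\dots,1,0,0,-1,\dots,-n+1)$. All $\varepsilon_i=1$ for $B_n,D_n$; for $C_n$, $\varepsilon_i=1$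 if $i\le n$ and $\varepsilon_i=-1$ if $i>n$. In the sum $\sum_{i\ne j,j'}$ the indices are such that $i\ne j$ and $i\ne j'$. **Properties of $R$.** $R$ satisfies the braid relation $R_{12}R_{23}R_{12}=R_{23}R_{12}R_{23}$. It is skew-invertible: there is $\Psi$ with $R_{ij}^{kl}\Psi_{lm}^{jn}=\delta_m^k\delta_i^n$. It also satisfies $$(R-qI)(R+q^{-1}I)(R-\mu I)=0,$$ with $\mu=q^{1-N}$ in the orthogonal case and $\mu=-q^{-1-N}$ in the symplectic case. **Idempotents.** $q\in\mathbb{C}\setminus\{0,\pm1\}$ is generic, so that $q,-q^{-1},\mu$ are pairwise distinct. $\mathcal{P}^{q},\mathcal{P}^{-q^{-1}},\mathcal{P}^{\mu}$ are the complementary idempotents (polynomials in $R$) with $R=q\mathcal{P}^q-q^{-1}\mathcal{P}^{-q^{-1}}+\mu\mathcal{P}^\mu$. For example, $\mathcal{P}^{-q^{-1}}=\frac{(R-qI)(R-\mu I)}{(q+q^{-1})(q^{-1}+\mu)}$ and $\mathcal{P}^{q}=\frac{(R+q^{-1}I)(R-\mu I)}{(q+q^{-1})(q-\mu)}$. On $(V^* )^{\otimes 2}$ they are given by the same polynomials in the operator $R(x^k\otimes x^l)=R_{ji}^{lk}\,x^i\otimes x^j$. **Algebras.** $T(\cdot)$ is the tensor algebra and $\langle J\rangle$ the two-sided ideal generated by $J$. **Compatibility.** Let $A$ be the quotient of $T(V^* )$ and $B$ the quotient of $T(V)$ in question. The permutation relations define $\sigma$ on generators by replacing $x^l\otimes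 x_k$ with the right-hand side of the second form of the relation (written in $T(V)\otimes T(V^* )$). It extends uniquely to a linear map $\sigma:T(V^* )\otimes T(V)\to T(V)\otimes T(V^* )$ satisfying - $\sigma\circ(\mu_A\otimes\mathrm{id})=(\mathrm{id}\otimes\mu_A)\circ\sigma_{12}\sigma_{23}$, - $\sigma\circ(\mathrm{id}\otimes\mu_B)=(\mu_B\otimes\mathrm{id})\circ\sigma_{23}\sigma_{12}$, - $\sigma(1\otimes b)=b\otimes1$ and $\sigma(a\otimes1)=1\otimes a$, where $\mu_A,\mu_B$ are the multiplications (of $T(V^* )$ and $T(V)$). Compatibility means that the permutation map preserves the defining relations, i.e. $\sigma$ descends to a well-defined linear map $A\otimes B\to B\otimes A$ (which then satisfies the same three conditions). *)

(* Defs.v *)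
From HB Require Import structures.
From mathcomp Require Import all_boot all_order all_algebra finmap.
From mathcomp Require Import ring_quotient boolp reals complex monalg.

Set Implicit Arguments.
Unset Strict Implicit.
Unset Printing Implicit Defensive.

Import GRing.Theory Num.Theory.
Local Open Scope ring_scope.
Local Open Scope quotient_scope.

Section LinearQuotient.
Context {K : fieldType} {M : lmodType K}.
Implicit Type S : M -> Prop.

Definition lin_span S : pred M := fun u =>
  `[< exists n (c : 'I_n -> K) (v : 'I_n -> M),
        (forall i, S (v i)) /\ u = \sum_i c i *: v i >].

Lemma lin_span_zmod_closed S : zmod_closed (lin_span S).
Proof.
split=> [|u v /asboolP[n [c [x [Sx ->]]]] /asboolP[m [d [y [Sy ->]]]]].
  by apply/asboolP; exists 0%N, (fun=> 0), (fun=> 0); split=> [[]|] //; rewrite big_ord0.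
apply/asboolP; exists (n + m)%N,
  (fun i => match split i with inl j => c j | inr j => - d j end),
  (fun i => match split i with inl j => x j | inr j => y j end).
split=> [i|]; first by case: (split i).
rewrite big_split_ord /= -sumrN; congr (_ + _); apply: eq_bigr => i _.
  by rewrite (unsplitK (inl i)).
by rewrite (unsplitK (inr i)) scaleNr.
Qed.

Lemma lin_spanZ S a u : u \in lin_span S -> a *: u \in lin_span S.
Proof.
move=> /asboolP[n [c [x [Sx ->]]]]; apply/asboolP; exists n, (fun i => a * c i), x.
by split=> //; rewrite scaler_sumr; apply: eq_bigr => i _; rewrite scalerA.
Qed.

HB.instance Definition _ S := GRing.isZmodClosed.Build M (lin_span S) (lin_span_zmod_closed S).

Definition lquot S := Quotient.quot (GRing.ZmodClosed.clone M (lin_span S) _).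

HB.instance Definition _ S := GRing.Zmodule.on (lquot S).

Definition lproj S (u : M) : lquot S := \pi_(lquot S) u.

Lemma lprojP S u v : lproj S u = lproj S v <-> (u - v) \in lin_span S.
Proof.
rewrite /lproj; split=> [/eqP|h]; last apply/eqP; by rewrite piE Quotient.equivE.
Qed.

Lemma lproj_repr S (t : lquot S) : lproj S (repr t) = t.
Proof. exact: reprK. Qed.

Lemma lprojD S : {morph lproj S : u v / u + v}.
Proof. by move=> u v; rewrite /lproj piE. Qed.

Definition lquot_scale S a (t : lquot S) : lquot S := lproj S (a *: repr t).

Lemma lquot_scaleE S a u : lquot_scale a (lproj S u) = lproj S (a *: u).
Proof. by apply/lprojP; rewrite -scalerBr lin_spanZ //; apply/lprojP/lproj_repr. Qed.

Let scaleA S a b (t : lquot S) :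
  lquot_scale a (lquot_scale b t) = lquot_scale (a * b) t.
Proof. by rewrite -(lproj_repr t) !lquot_scaleE scalerA. Qed.
Let scale1 S : left_id 1 (@lquot_scale S).
Proof. by move=> t; rewrite -(lproj_repr t) !lquot_scaleE scale1r. Qed.
Let scaleDr S : right_distributive (@lquot_scale S) +%R.
Proof.
move=> a t u; rewrite -(lproj_repr t) -(lproj_repr u) -lprojD !lquot_scaleE.
by rewrite -lprojD scalerDr.
Qed.
Let scaleDl S (t : lquot S) : {morph (@lquot_scale S)^~ t : a b / a + b}.
Proof.
by move=> a b; rewrite -(lproj_repr t) !lquot_scaleE -lprojD scalerDl.
Qed.

HB.instance Definition _ S := GRing.Zmodule_isLmodule.Build K (lquot S)
  (@scaleA S) (@scale1 S) (@scaleDr S) (@scaleDl S).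

Lemma lproj_linear S : linear (lproj S).
Proof. by move=> a u v; rewrite lprojD -lquot_scaleE. Qed.

HB.instance Definition _ S :=
  GRing.isLinear.Build K M (lquot S) _ (lproj S) (lproj_linear S).

End LinearQuotient.

Section Tensor.
Context {K : fieldType}.

Section Def.
Variables U V : lmodType K.

Inductive bilin_rel : {malg K[(U * V)%type]} -> Prop :=
| BilinL a u u' v : bilin_rel
    (<< (a *: u + u', v) >> - (a *: << (u, v) >> + << (u', v) >>))
| BilinR a u v v' : bilin_rel
    (<< (u, a *: v + v') >> - (a *: << (u, v) >> + << (u, v') >>)).

Definition tensor := lquot bilin_rel.
HB.instance Definition _ := GRing.Lmodule.on tensor.

Definition tens (u : U) (v : V) : tensor := lproj bilin_rel << (u, v) >>.

(* The linear map U (x) V -> X attached to f; only meaningful for bilinear f,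
   for which it does not depend on the representative (see tlift_tens). *)
Definition tlift (X : lmodType K) (f : U -> V -> X) (t : tensor) : X :=
  \sum_(p <- msupp (repr t)) (repr t)@_p *: f p.1 p.2.

End Def.

Section Universal.
Variables (U V X : lmodType K) (f : U -> V -> X).
Hypothesis f_linl : forall v, linear (f ^~ v).
Hypothesis f_linr : forall u, linear (f u).

Let ext (g : {malg K[(U * V)%type]}) : X := \sum_(p <- msupp g) g@_p *: f p.1 p.2.

Let extEw (D : {fset (U * V)%type}) g : (msupp g `<=` D)%fset ->
  ext g = \sum_(p <- D) g@_p *: f p.1 p.2.
Proof.
move=> sD; rewrite /ext (big_fset_incl _ sD) // => p _ pNg.
by rewrite mcoeff_outdom ?scale0r.
Qed.

Let ext_linear : linear ext.
Proof.
move=> a g h; pose D := (msupp g `|` msupp h `|` msupp (a *: g + h))%fset.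
rewrite !(@extEw D) ?fsubsetUr //; last 2 first.
- by rewrite /D fsubsetU // fsubsetUr.
- by rewrite /D fsubsetU // fsubsetUl.
rewrite scaler_sumr -big_split /=; apply: eq_bigr => p _.
by rewrite mcoeffD mcoeffZ scalerDl scalerA.
Qed.

Let extU u v : ext << (u, v) >> = f u v.
Proof. by rewrite /ext msuppU oner_eq0 /= big_seq_fset1 mcoeffUU scale1r. Qed.

Let extP : {e : {linear {malg K[(U * V)%type]} -> X} | e =1 ext}.
Proof.
by exists (HB.pack_for {linear {malg K[(U * V)%type]} -> X} ext
  (GRing.isLinear.Build _ _ _ _ ext ext_linear)).
Qed.

Let ext_span g : g \in lin_span (@bilin_rel U V) -> ext g = 0.
Proof.
case: extP => e eE /asboolP[n [c [x [Rx ->]]]]; rewrite -eE linear_sum.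
apply: big1 => i _; rewrite linearZ /=; case: (Rx i) => [a u u' v|a u v v'].
  by rewrite linearB linearP /= !eE !extU f_linl subrr scaler0.
by rewrite linearB linearP /= !eE !extU f_linr subrr scaler0.
Qed.

Let tlift_proj g : tlift f (lproj _ g) = ext g.
Proof.
case: extP => e eE; rewrite /tlift -[LHS]/(ext _); apply/eqP.
by rewrite -subr_eq0 -!eE -linearB eE; apply/eqP/ext_span/lprojP/lproj_repr.
Qed.

Lemma tlift_tens u v : tlift f (tens u v) = f u v.
Proof. by rewrite tlift_proj extU. Qed.

Lemma tlift_linear : linear (tlift f).
Proof.
move=> a t t'; rewrite -(lproj_repr t) -(lproj_repr t') -linearP.
by rewrite !tlift_proj ext_linear.
Qed.

End Universal.

Definition tmap (U V U' V' : lmodType K) (f : U -> U') (g : V -> V') :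
    tensor U V -> tensor U' V' :=
  tlift (fun u v => tens (f u) (g v)).

Definition tassoc (U V W : lmodType K) :
    tensor (tensor U V) W -> tensor U (tensor V W) :=
  tlift (fun t w => tlift (fun u v => tens u (tens v w)) t).

Definition tassocV (U V W : lmodType K) :
    tensor U (tensor V W) -> tensor (tensor U V) W :=
  tlift (fun u t => tlift (fun v w => tens (tens u v) w) t).

Definition tmul (A : lalgType K) : tensor A A -> A := tlift *%R.

End Tensor.

Notation "u \ox v" := (tens u v) (at level 40, left associativity).

Variant bcd_series := SeriesB | SeriesC | SeriesD.

Definition orthogonal_series (g : bcd_series) : bool :=
  if g is SeriesC then false else true.

Definition dimV (g : bcd_series) (n : nat) : nat :=
  if g is SeriesB then n.*2.+1 else n.*2.

(* Twice the entries of rho, with indices counted from 0. *)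
Definition rho2 (g : bcd_series) (n i : nat) : int :=
  match g with
  | SeriesB => if (i < n)%N then (n%:Z - i%:Z) * 2 - 1
               else if i == n then 0 else (n%:Z - i%:Z) * 2 + 1
  | SeriesC => if (i < n)%N then (n%:Z - i%:Z) * 2 else (n%:Z - i%:Z - 1) * 2
  | SeriesD => if (i < n)%N then (n%:Z - i%:Z - 1) * 2 else (n%:Z - i%:Z) * 2
  end.

Definition veps (K : fieldType) (g : bcd_series) (n i : nat) : K :=
  if g is SeriesC then if (i < n)%N then 1 else -1 else 1.

(* The coefficients c i j k l of an operator X on V (x) V:
   X (x_i (x) x_j) = \sum_(k, l) c i j k l (x_k (x) x_l). *)
Definition coef4 (K : fieldType) (N : nat) := 'I_N -> 'I_N -> 'I_N -> 'I_N -> K.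

Section BMW.
Context {K : fieldType}.

(* The matrix of e_ij (x) e_pr; e_ij maps x_j to x_i. *)
Definition ee (N : nat) (i j p r : 'I_N) : coef4 K N :=
  fun a b k l => [&& k == i, a == j, l == p & b == r]%:R.

(* rev_ord i is i'. As rho has half-integral entries for B_n, the powers of q
   are taken with respect to a fixed square root s of q. The second sum is the
   e_mm (x) e_mm term: i = i' only holds for the middle index of odd N. *)
Definition frtR (g : bcd_series) (n : nat) (q s : K) : coef4 K (dimV g n) :=
  fun a b k l =>
    let I := 'I_(dimV g n) in
    let E i j p r := ee i j p r a b k l in
    let h (i : I) := rho2 g n i in
    let e (i : I) := veps K g n i in
      q * (\sum_(i | i != rev_ord i) E i i i i)
    + \sum_(i | i == rev_ord i) E i i i i
    + \sum_i \sum_(j | (i != j) && (i != rev_ord j)) E i i j j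
    + q^-1 * (\sum_(i | i != rev_ord i) E (rev_ord i) (rev_ord i) i i)
    + (q - q^-1) * (\sum_(i : I) \sum_(j : I | (j < i)%N) E i j j i)
    - (q - q^-1) * (\sum_(i : I) \sum_(j : I | (j < i)%N)
        s ^ (h i - h j) * e i * e j * E i j (rev_ord i) (rev_ord j)).

Definition bmwR (g : bcd_series) (n : nat) (q s : K) : coef4 K (dimV g n) :=
  fun i j k l => frtR q s i j l k.

Definition bmw_mu (g : bcd_series) (n : nat) (q : K) : K :=
  if orthogonal_series g then q ^ (1 - (dimV g n)%:Z)
  else - q ^ (- 1 - (dimV g n)%:Z).

(* The three eigenvalues of R are pairwise distinct. *)
Definition generic (q mu : K) : Prop :=
  [/\ q != 0, q != 1, q != - 1 & uniq [:: q; - q^-1; mu]].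

Section Operators.
Context {N : nat}.
Implicit Types (c R Psi : coef4 K N) (u : 'M[K]_N).

Definition skew_inverse R Psi : Prop := forall i k m n,
  \sum_j \sum_l R i j k l * Psi l m j n = ((m == k) && (i == n))%:R.

Definition Bmat Psi (i j : 'I_N) : K := \sum_k Psi k i k j.

(* Operators on V (x) V, where u : 'M_N stands for \sum u i j (x_i (x) x_j). *)
Definition op2 c u : 'M[K]_N := \matrix_(k, l) \sum_i \sum_j u i j * c i j k l.

(* The operator R on V^* (x) V^*: x^k (x) x^l |-> R_{ji}^{lk} x^i (x) x^j. *)
Definition dual_coef R : coef4 K N := fun k l i j => R j i l k.

Definition shift_op c (a : K) u : 'M[K]_N := op2 c u - a *: u.

Definition Pminus (q mu : K) c u : 'M[K]_N :=
  ((q + q^-1) * (q^-1 + mu))^-1 *: shift_op c q (shift_op c mu u).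

Definition Pplus (q mu : K) c u : 'M[K]_N :=
  ((q + q^-1) * (q - mu))^-1 *: shift_op c (- q^-1) (shift_op c mu u).

End Operators.

(* The tensor algebra of a space with a basis indexed by 'I_N, used for both
   T(V) (generators x_i) and T(V^* ) (generators x^i). *)
Definition Talg (N : nat) := {malg K[{fmonom 'I_N}]}.
HB.instance Definition _ N := GRing.Lalgebra.on (Talg N).

Definition Tgen (N : nat) (i : 'I_N) : Talg N := << fmu i >>.

(* The elements a j b with j in J; their linear span is the two-sided ideal
   generated by J. *)
Definition ideal_gen (A : lalgType K) (J : A -> Prop) (t : A) : Prop :=
  exists a b j, J j /\ t = a * j * b.

Definition im2 (N : nat) (P : 'M[K]_N -> 'M[K]_N) (t : Talg N) : Prop :=
  exists u, t = \sum_i \sum_j P u i j *: (Tgen i * Tgen j).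

Definition quad_alg (N : nat) (P : 'M[K]_N -> 'M[K]_N) :=
  lquot (ideal_gen (im2 P)).
HB.instance Definition _ N P := GRing.Lmodule.on (@quad_alg N P).

Definition quad_proj (N : nat) (P : 'M[K]_N -> 'M[K]_N) (t : Talg N) :
  quad_alg P := lproj _ t.

Section Permutation.
Context {N : nat}.
Variables (R Psi : coef4 K N) (c : K).

(* In both relations y i stands for x^i. *)
Definition perm_rel1 (A : algType K) (x y : 'I_N -> A) : Prop := forall i j,
  \sum_a \sum_b R a i b j *: (y a * x b) = c *: (x i * y j) + (i == j)%:R.

Definition perm_rel2 (A : algType K) (x y : 'I_N -> A) : Prop := forall k l,
  y l * x k =
    \sum_i \sum_j (c * Psi j k i l) *: (x i * y j) + (Bmat Psi k l)%:A.

Definition perm_rel_equiv : Prop :=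
  forall (A : algType K) (x y : 'I_N -> A), perm_rel1 x y <-> perm_rel2 x y.

Local Notation T := (Talg N).

(* Here sigma : T(V^* ) (x) T(V) -> T(V) (x) T(V^* ). Triple tensor products are
   bracketed to the left; sigma12 and sigma23 act on adjacent factors of them. *)
Record permutation_map (sigma : tensor T T -> tensor T T) : Prop := {
  perm_linear : linear sigma;
  perm_gen : forall k l,
    sigma (Tgen l \ox Tgen k) =
      \sum_i \sum_j (c * Psi j k i l) *: (Tgen i \ox Tgen j)
      + Bmat Psi k l *: (1 \ox 1);
  perm_mull :
    let sigma12 := tmap sigma id in
    let sigma23 := @tassocV K T T T \o tmap id sigma \o @tassoc K T T T in
    sigma \o tmap (@tmul K T) id
      =1 tmap id (@tmul K T) \o @tassoc K T T T \o sigma12 \o sigma23;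
  perm_mulr :
    let sigma12 := tmap sigma id in
    let sigma23 := @tassocV K T T T \o tmap id sigma \o @tassoc K T T T in
    sigma \o tmap id (@tmul K T) \o @tassoc K T T T
      =1 tmap (@tmul K T) id \o sigma23 \o sigma12;
  perm_1l : forall b : T, sigma (1 \ox b) = b \ox 1;
  perm_1r : forall a : T, sigma (a \ox 1) = 1 \ox a
}.

(* A = T(V^* ) / <Im PA> and B = T(V) / <Im PB>; sbar : A (x) B -> B (x) A is the
   map induced by sigma. *)
Definition descends (PA PB : 'M[K]_N -> 'M[K]_N)
    (sigma : tensor T T -> tensor T T) : Prop :=
  exists sbar : {linear tensor (quad_alg PA) (quad_alg PB) ->
                        tensor (quad_alg PB) (quad_alg PA)},
  sbar \o tmap (@quad_proj N PA) (@quad_proj N PB)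
    =1 tmap (@quad_proj N PB) (@quad_proj N PA) \o sigma.

Definition compatible (PA PB : 'M[K]_N -> 'M[K]_N) : Prop :=
  exists sigma, [/\ permutation_map sigma,
    forall sigma', permutation_map sigma' -> sigma' =1 sigma &
    descends PA PB sigma].

End Permutation.
End BMW.

(* Main.v *)
Require Import Defs.
From HB Require Import structures.
From mathcomp Require Import all_boot all_order all_algebra finmap.
From mathcomp Require Import boolp reals complex monalg.
From mathcomp Require Import ring zify.

(** Write y^l for the generators of T(V^* ). Read from left to right, the second
    form of the permutation relation,
    y^l x_k = c Psi_jk^il x_i y^j + B_k^l, moves y^l across one letter x_k, so that
    iterating it defines operators [gen_pass l] on T(V) (x) T(V^* ), extended
    multiplicatively to [pass a] for a in T(V^* ), and
    sigma (a (x) b) = [pass a (b \ot 1)]. The two multiplicativity conditions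
    hold because [pass a] commutes with right multiplication by T(V^* )
    ([pass_rmul]) and is compatible with the product that sigma defines on
    T(V) (x) T(V^* ) ([pass_act]); conversely they force the value of sigma on
    words, letter by letter ([tau_sigma]). All this holds for arbitrary Psi and c,
    since both tensor algebras are free.

    The map descends to the quotients as soon as moving a generator across a
    quadratic relation only produces relations. Let u be a tensor in V (x) V, seen
    as a quadratic element. Then y^l u is c^2 times a sum of terms u_n y^n, plus an
    element of V ([gen_pass_qelt]). The tensors u_n are the components of
    M2 M1 (e_l (x) u), where M, built from Psi, is the inverse of an operator L built
    from R. The braid relation for R says that R, acting on both vector indices,
    commutes with L1 L2 ([Rt_L], an RTT relation), hence with M2 M1 ([Rt_M]): if u
    lies in an eigenspace of R, then so do all the u_n. The element of V is
    c tr_2(M2 M1 f) + tr_1(M1 f), where f = e_l (x) u and tr_k contracts the auxiliary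
    index with the k-th vector index. Skew invertibility gives tr_2(R M2 g) = tr_1 g
    ([Rt_trace]); for g = M1 f the left-hand side is tr_2(M2 M1 R f), which is
    -c tr_2(M2 M1 f) when u has eigenvalue -c, and the element of V vanishes
    ([eigenB]). The same computation with the roles of the two factors exchanged
    treats the relations of T(V^* ) ([eigenA]).

    So the relations are compatible when the quadratic relations form the eigenspace
    of R for the eigenvalue -c. For c = q^-1 this is the image of the idempotent for
    -q^-1, and for c = - q the image of the one for q: by the cubic relation the
    images consist of eigenvectors, and by genericity the normalizing constants are
    nonzero, so that each eigenvector is in the image ([Pminus_eigen], [Pminus_id]
    and their analogues).

    What remains is to prove the braid relation and the cubic relation for the
    explicit matrix. Let i' = [rev_ord i], lam = q - q^-1 and w_i = q^rho_i eps_i.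
    Then R acts on functions of two indices as a flip with coefficients q, q^-1 or 1,
    plus lam times the identity on increasing pairs, minus lam times a cup term
    supported on the pairs (a, a') ([bmwR_actR]). Of rho only two facts are used:
    w_i w_i' is a constant sign, and the tail sums of the w_i^2 have a closed form
    ([wt_tail], a telescoping sum). On the pairs (a, a') these give
    R^2 = 1 + lam R - lam mu K and K R = mu K, with K of rank one ([actR_conj_square],
    [actR_cup]), hence the cubic relation. The braid relation is checked at each triple
    (a, b, c) by comparing coefficients, separately when a and b are conjugate, when
    a and c are, and when no two are; the symmetry (a, b, c) -> (c', b', a') takes
    care of the case where b and c are ([braidE]).

    Finally, the two forms of the permutation relation are exchanged by contraction
    with Psi and with R, since the skew inverse is a two-sided one in finite
    dimension ([skewC], [perm_rel_equivP]). *)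

Set Implicit Arguments.
Unset Strict Implicit.
Unset Printing Implicit Defensive.

Import GRing.Theory Num.Theory.
Local Open Scope ring_scope.

(** * Linear maps and tensor products *)
Section LinearMaps.
Variables (K : fieldType).
Implicit Types U V X : lmodType K.

(** The maps below are bare functions with a proof of linearity, as in the
    definition of a permutation map. *)
Definition lin_pack U V (f : U -> V) (h : linear f) : {linear U -> V} :=
  HB.pack_for {linear U -> V} f (GRing.isLinear.Build _ _ _ _ f h).

Lemma lin0 U V (f : U -> V) : linear f -> f 0 = 0.
Proof. by move=> h; exact: (linear0 (lin_pack h)). Qed.
Lemma linD U V (f : U -> V) : linear f -> {morph f : u v / u + v}.
Proof. by move=> h; exact: (linearD (lin_pack h)). Qed.
Lemma linZ U V (f : U -> V) : linear f -> forall a, {morph f : u / a *: u}.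
Proof. by move=> h; exact: (linearZ_LR (lin_pack h)). Qed.
Lemma lin_sum U V (f : U -> V) (J : Type) (r : seq J) (F : J -> U) :
  linear f -> f (\sum_(i <- r) F i) = \sum_(i <- r) f (F i).
Proof. by move=> h; exact: (linear_sum (lin_pack h)). Qed.

Lemma lin_comp U V X (f : V -> X) (g : U -> V) : linear f -> linear g -> linear (f \o g).
Proof. by move=> hf hg a u v /=; rewrite hg hf. Qed.
Lemma lin_comb U V (a : K) (f g : U -> V) :
  linear f -> linear g -> linear (fun u => a *: f u + g u).
Proof.
by move=> hf hg b u v; rewrite hf hg !scalerDr !scalerA (mulrC a) addrACA.
Qed.
Lemma lin_id U : linear (@id U). Proof. by []. Qed.

Lemma lin_span_gen (M : lmodType K) (S : M -> Prop) u : S u -> u \in lin_span S.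
Proof.
move=> Su; apply/asboolP; exists 1%N, (fun=> 1), (fun=> u); split=> //.
by rewrite big_ord1 scale1r.
Qed.

Lemma lin_span_lin (M V : lmodType K) (S : M -> Prop) (f : M -> V) (P : V -> Prop) u :
  linear f -> (forall v, S v -> f v \in lin_span P) -> u \in lin_span S -> f u \in lin_span P.
Proof.
move=> hf h /asboolP[n [a [v [Sv ->]]]]; rewrite lin_sum //.
by apply: rpred_sum => i _; rewrite linZ // lin_spanZ // h.
Qed.

Lemma lin_span0 (M V : lmodType K) (S : M -> Prop) (f : M -> V) u :
  linear f -> (forall v, S v -> f v = 0) -> u \in lin_span S -> f u = 0.
Proof.
move=> hf h /asboolP[n [a [v [Sv ->]]]]; rewrite lin_sum //.
by apply: big1 => i _; rewrite linZ // h // scaler0.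
Qed.

Section Tens.
Variables U V X : lmodType K.

Lemma tens_linl (v : V) : linear (fun u : U => tens u v).
Proof.
move=> a u u'; rewrite /tens -linearP; apply/lprojP/lin_span_gen; exact: BilinL.
Qed.
Lemma tens_linr (u : U) : linear (tens u : V -> _).
Proof.
move=> a v v'; rewrite /tens -linearP; apply/lprojP/lin_span_gen; exact: BilinR.
Qed.

Lemma tens_ext (f g : tensor U V -> X) : linear f -> linear g ->
  (forall u v, f (u \ox v) = g (u \ox v)) -> f =1 g.
Proof.
move=> hf hg h t; rewrite -(lproj_repr t) [repr t]monalgE !linear_sum !lin_sum //.
apply: eq_bigr => -[u v] _; have -> : << (repr t)@_(u, v) *g (u, v) >> =
   (repr t)@_(u, v) *: (<< (u, v) >> : {malg K[(U * V)%type]}).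
  by apply/malgP => k; rewrite mcoeffZ !mcoeffU mulrnAr mulr1.
by rewrite linearZ !linZ // -/(tens u v) h.
Qed.

End Tens.

Section Tmap.
Variables U V U' V' : lmodType K.
Variables (f : U -> U') (g : V -> V').
Hypotheses (hf : linear f) (hg : linear g).
Let h1 (v : V) : linear (fun u => f u \ox g v).
Proof. exact: lin_comp (tens_linl _) hf. Qed.
Let h2 (u : U) : linear (fun v => f u \ox g v).
Proof. exact: lin_comp (tens_linr _) hg. Qed.
Lemma tmapE u v : tmap f g (u \ox v) = f u \ox g v.
Proof. exact: tlift_tens. Qed.
Lemma tmap_lin : linear (tmap f g).
Proof. exact: tlift_linear. Qed.
End Tmap.

(** [tassoc] and [tassocV] are lifts of a bilinear map whose values are themselves
    lifts; this gives linearity in the parameter of the inner one. *)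
Section TliftParam.
Variables U V W X : lmodType K.
Variable F : W -> U -> V -> X.
Hypothesis F_linl : forall w v, linear (F w ^~ v).
Hypothesis F_linr : forall w u, linear (F w u).
Hypothesis F_lin : forall u v, linear (fun w => F w u v).
Lemma tlift_param_lin t : linear (fun w => tlift (F w) t).
Proof.
have hw w : linear (tlift (F w)) := tlift_linear (F_linl w) (F_linr w).
move=> a w w'.
have hg : linear (fun t => a *: tlift (F w) t + tlift (F w') t).
  by apply: lin_comb; apply: hw.
apply: (@tens_ext _ _ _ _ (fun t => a *: tlift (F w) t + tlift (F w') t) (hw _) hg) => u v.
rewrite (tlift_tens (F_linl _) (F_linr _) u v).
rewrite (tlift_tens (F_linl w) (F_linr w) u v) (tlift_tens (F_linl w') (F_linr w') u v).
exact: F_lin.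
Qed.
End TliftParam.

Section Tassoc.
Variables U V W : lmodType K.
Let F (w : W) (u : U) (v : V) := u \ox (v \ox w).
Let h1 (w : W) (v : V) : linear (F w ^~ v).
Proof. exact: tens_linl. Qed.
Let h2 (w : W) (u : U) : linear (F w u).
Proof. exact: lin_comp (tens_linr _) (tens_linl _). Qed.
Let h3 (u : U) (v : V) : linear (fun w => F w u v).
Proof. exact: lin_comp (tens_linr _) (tens_linr _). Qed.
Let h4 (w : W) : linear (tlift (F w)).
Proof. exact: tlift_linear. Qed.
Let h5 (t : tensor U V) : linear (fun w => tlift (F w) t).
Proof. exact: tlift_param_lin. Qed.
Lemma tassocE (u : U) (v : V) (w : W) : tassoc ((u \ox v) \ox w) = u \ox (v \ox w).
Proof.
have -> : tassoc ((u \ox v) \ox w) = tlift (F w) (u \ox v) by exact: (tlift_tens h4 h5).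
exact: (tlift_tens (h1 w) (h2 w)).
Qed.
Lemma tassoc_lin : linear (@tassoc K U V W).
Proof. exact: (tlift_linear h4 h5). Qed.
End Tassoc.

Section TassocV.
Variables U V W : lmodType K.
Let F (u : U) (v : V) (w : W) := (u \ox v) \ox w.
Let h1 (u : U) (w : W) : linear (F u ^~ w).
Proof. exact: lin_comp (tens_linl _) (tens_linr _). Qed.
Let h2 (u : U) (v : V) : linear (F u v).
Proof. exact: tens_linr. Qed.
Let h3 (v : V) (w : W) : linear (fun u => F u v w).
Proof. exact: lin_comp (tens_linl _) (tens_linl _). Qed.
Let h4 (u : U) : linear (tlift (F u)).
Proof. exact: tlift_linear. Qed.
Let h5 (t : tensor V W) : linear (fun u => tlift (F u) t).
Proof. exact: tlift_param_lin. Qed.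
Lemma tassocVE (u : U) (v : V) (w : W) : tassocV (u \ox (v \ox w)) = (u \ox v) \ox w.
Proof.
have -> : tassocV (u \ox (v \ox w)) = tlift (F u) (v \ox w) by exact: (tlift_tens h5 h4).
exact: (tlift_tens (h1 u) (h2 u)).
Qed.
Lemma tassocV_lin : linear (@tassocV K U V W).
Proof. exact: (tlift_linear h5 h4). Qed.
End TassocV.

End LinearMaps.

(** * The RTT relations *)
Section Sums.
Variables (I : finType) (V : zmodType).
Lemma exchange_last3 (F : I -> I -> I -> V) :
  \sum_a \sum_b \sum_x F a b x = \sum_x \sum_a \sum_b F a b x.
Proof. by under eq_bigr do rewrite exchange_big /=; rewrite exchange_big. Qed.
Lemma exchange_last4 (F : I -> I -> I -> I -> V) :
  \sum_a \sum_b \sum_i \sum_x F a b i x = \sum_x \sum_a \sum_b \sum_i F a b i x.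
Proof. by under eq_bigr do rewrite exchange_last3 /=; rewrite exchange_big. Qed.
Lemma exchange_last5 (F : I -> I -> I -> I -> I -> V) :
  \sum_a \sum_b \sum_i \sum_j \sum_x F a b i j x
  = \sum_x \sum_a \sum_b \sum_i \sum_j F a b i j x.
Proof. by under eq_bigr do rewrite exchange_last4 /=; rewrite exchange_big. Qed.
Lemma exchange_last6 (F : I -> I -> I -> I -> I -> I -> V) :
  \sum_a \sum_b \sum_i \sum_j \sum_k \sum_x F a b i j k x
  = \sum_x \sum_a \sum_b \sum_i \sum_j \sum_k F a b i j k x.
Proof. by under eq_bigr do rewrite exchange_last5 /=; rewrite exchange_big. Qed.
End Sums.

Lemma sum_delta (K : fieldType) (I : finType) (a : I) (F : I -> K) : \sum_i (i == a)%:R * F i = F a.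
Proof.
rewrite (bigD1 a) //= eqxx mul1r big1 ?addr0 // => i /negPf ->.
by rewrite mul0r.
Qed.

(** The kernels are square matrices, for which AB = 1 implies BA = 1. *)
Lemma kernel_inverseC (K : fieldType) (X : finType) (A B : X -> X -> K) :
  (forall x y, \sum_z A x z * B z y = (x == y)%:R) ->
  forall x y, \sum_z B x z * A z y = (x == y)%:R.
Proof.
move=> AB x y.
pose mx (F : X -> X -> K) : 'M_#|X| := \matrix_(i, j) F (enum_val i) (enum_val j).
have mxM F G i j : (mx F *m mx G) i j = \sum_z F (enum_val i) z * G z (enum_val j).
  rewrite mxE [RHS](reindex (@enum_val X predT)); last exact: onW_bij (@enum_val_bij X).
  by apply: eq_bigr => k _; rewrite !mxE.
have /mulmx1C h : mx A *m mx B = 1%:M.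
  by apply/matrixP => i j; rewrite mxM AB !mxE (inj_eq enum_val_inj).
have := congr1 (fun M : 'M_#|X| => M (enum_rank x) (enum_rank y)) h.
by rewrite mxM !enum_rankK mxE (inj_eq enum_rank_inj).
Qed.

Section RTT.
Variables (K : fieldType) (N : nat) (R Psi : coef4 K N).
Local Notation I := 'I_N.

(** R_12 R_23 R_12 = R_23 R_12 R_23, in coefficients. *)
Definition braided := forall a b c k l m,
  \sum_i \sum_j \sum_p R a b i j * R j c p m * R i p k l
  = \sum_i \sum_j \sum_p R b c i j * R a i k p * R p j l m.

Hypothesis skew : skew_inverse R Psi.

(** With R i j k l as the entry in row (i, k) and column (j, l), skew
    invertibility is a one-sided inverse of matrices. *)
Lemma skewC n k p b : \sum_i \sum_j Psi n i p j * R j k i b = ((n == b) && (p == k))%:R.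
Proof.
pose A (x y : I * I) := R x.1 y.1 x.2 y.2.
pose B (x y : I * I) := Psi x.2 y.2 x.1 y.1.
have AB x y : \sum_z A x z * B z y = (x == y)%:R.
  rewrite -(pair_bigA _ (fun i j => A x (i, j) * B (i, j) y)) /= skew.
  by case: x y => [x1 x2] [y1 y2]; rewrite xpair_eqE andbC (eq_sym y2).
have := kernel_inverseC AB (p, n) (k, b).
rewrite -(pair_bigA _ (fun j i => B (p, n) (j, i) * A (j, i) (k, b))) /= exchange_big xpair_eqE.
by rewrite andbC.
Qed.

(** R and Psi as operators on functions of an auxiliary index, which is that of a
    generator of T(V^* ), and a vector index. Moving a generator across a letter is
    [Mop]; the inverse [Lop] satisfies relations that come directly from the braid
    relation. *)
Definition Lop (f : I -> I -> K) a b := \sum_i \sum_j R a i b j * f j i.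
Definition Mop (f : I -> I -> K) n p := \sum_k \sum_l Psi n k p l * f l k.

Lemma LopK f : Lop (Mop f) =2 f.
Proof.
move=> a b; rewrite /Lop /Mop.
under eq_bigr => i _.
  under eq_bigr => j _.
    rewrite mulr_sumr; under eq_bigr => k _.
      rewrite mulr_sumr; under eq_bigr => l _ do rewrite mulrA.
      over.
    over.
  over.
rewrite exchange_last4 (bigD1 a) //= [X in _ + X]big1 => [|l nl].
  rewrite exchange_last3 (bigD1 b) //= [X in _ + X + _]big1 => [|k nk].
    under eq_bigr => i _ do rewrite -mulr_suml.
    by rewrite -mulr_suml skew !eqxx mul1r !addr0.
  under eq_bigr => i _ do rewrite -mulr_suml.
  by rewrite -mulr_suml skew (negPf nk) mul0r.
rewrite exchange_last3; apply: big1 => k _.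
under eq_bigr => i _ do rewrite -mulr_suml.
by rewrite -mulr_suml skew (eq_sym a) (negPf nl) andbF mul0r.
Qed.

Lemma MopK f : Mop (Lop f) =2 f.
Proof.
move=> n p; rewrite /Lop /Mop.
under eq_bigr => k _.
  under eq_bigr => l _.
    rewrite mulr_sumr; under eq_bigr => i _.
      rewrite mulr_sumr; under eq_bigr => j _ do rewrite mulrA.
      over.
    over.
  over.
rewrite exchange_last4 (bigD1 n) //= [X in _ + X]big1 => [|j nj].
  rewrite exchange_last3 (bigD1 p) //= [X in _ + X + _]big1 => [|i ni].
    under eq_bigr => k _ do rewrite -mulr_suml.
    by rewrite -mulr_suml skewC !eqxx mul1r !addr0.
  under eq_bigr => k _ do rewrite -mulr_suml.
  by rewrite -mulr_suml skewC (eq_sym p) (negPf ni) andbF mul0r.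
rewrite exchange_last3; apply: big1 => i _.
under eq_bigr => k _ do rewrite -mulr_suml.
by rewrite -mulr_suml skewC (eq_sym n) (negPf nj) mul0r.
Qed.

(** In functions of three indices the first one is auxiliary; the operators indexed
    by 1 and 2 act on it and on the first or second vector index, and [Rt] acts on
    the two vector indices. *)
Definition L1 (f : I -> I -> I -> K) a b d := Lop (fun j i => f j i d) a b.
Definition L2 (f : I -> I -> I -> K) a b d := Lop (fun j i => f j b i) a d.
Definition M1 (f : I -> I -> I -> K) a b d := Mop (fun j i => f j i d) a b.
Definition M2 (f : I -> I -> I -> K) a b d := Mop (fun j i => f j b i) a d.
Definition Rt (f : I -> I -> I -> K) a k l := \sum_b \sum_d f a b d * R b d k l.

Hypothesis braid : braided.

(** Both sides contract f with one side of the braid relation: [L1] and [L2] carry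
    the auxiliary index through two copies of R, and [Rt] is the third one. *)
Lemma Rt_L f a k l : Rt (L1 (L2 f)) a k l = L1 (L2 (Rt f)) a k l.
Proof.
rewrite /Rt /L1 /L2 /Lop.
transitivity (\sum_m \sum_c \sum_i
   (\sum_b \sum_j \sum_d R a i b j * R j c d m * R b d k l) * f m i c).
  under eq_bigr => b _.
    under eq_bigr => d _.
      rewrite mulr_suml; under eq_bigr => i _.
        rewrite mulr_suml; under eq_bigr => j _.
          rewrite mulr_sumr mulr_suml; under eq_bigr => c _.
            rewrite mulr_sumr mulr_suml.
            over.
          over.
        over.
      over.
    over.
  rewrite exchange_last6; apply: eq_bigr => m _; rewrite exchange_last5; apply: eq_bigr => c _.
  rewrite exchange_last3; apply: eq_bigr => i _; rewrite mulr_suml; apply: eq_bigr => b _.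
  rewrite exchange_big mulr_suml; apply: eq_bigr => j _; rewrite mulr_suml.
  by apply: eq_bigr => d _; ring.
under eq_bigr => m _ do under eq_bigr => c _ do under eq_bigr => i _ do rewrite braid.
under [RHS]eq_bigr => i' _.
  under eq_bigr => j _.
    rewrite mulr_sumr; under eq_bigr => c' _.
      rewrite mulr_sumr; under eq_bigr => m _.
        rewrite !mulr_sumr; under eq_bigr => i _.
          rewrite !mulr_sumr.
          over.
        over.
      over.
    over.
  over.
rewrite -exchange_last3 [RHS]exchange_last6; apply: eq_bigr => c _; rewrite [RHS]exchange_last5;
  apply: eq_bigr => i _.
rewrite [RHS]exchange_last4; apply: eq_bigr => m _; rewrite mulr_suml; apply: eq_bigr => i' _.
rewrite [RHS]exchange_big mulr_suml; apply: eq_bigr => c' _; rewrite mulr_suml.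
by apply: eq_bigr => j _; ring.
Qed.

Lemma LopE f : Lop (Mop f) = f.
Proof. by apply/funext => a; apply/funext => b; rewrite LopK. Qed.
Lemma MopE f : Mop (Lop f) = f.
Proof. by apply/funext => a; apply/funext => b; rewrite MopK. Qed.

Lemma M1K f : M1 (L1 f) = f.
Proof.
apply/funext => a; apply/funext => b; apply/funext => d.
by rewrite /M1 (_ : (fun j i => L1 f j i d) = Lop (fun j i => f j i d)) // MopE.
Qed.
Lemma L1K f : L1 (M1 f) = f.
Proof.
apply/funext => a; apply/funext => b; apply/funext => d.
by rewrite /L1 (_ : (fun j i => M1 f j i d) = Mop (fun j i => f j i d)) // LopE.
Qed.
Lemma M2K f : M2 (L2 f) = f.
Proof.
apply/funext => a; apply/funext => b; apply/funext => d.
by rewrite /M2 (_ : (fun j i => L2 f j b i) = Lop (fun j i => f j b i)) // MopE.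
Qed.
Lemma L2K f : L2 (M2 f) = f.
Proof.
apply/funext => a; apply/funext => b; apply/funext => d.
by rewrite /L2 (_ : (fun j i => M2 f j b i) = Mop (fun j i => f j b i)) // LopE.
Qed.

Lemma Rt_M f : Rt (M2 (M1 f)) = M2 (M1 (Rt f)).
Proof.
have h g : Rt (L1 (L2 g)) = L1 (L2 (Rt g)).
  by apply/funext => a; apply/funext => k; apply/funext => l; exact: Rt_L.
by rewrite -[LHS]M2K -[L2 _]M1K -h L2K L1K.
Qed.

(** Contracting the auxiliary index with the last vector index joins R and Psi in
    the sum that defines the skew inverse. *)
Lemma Rt_trace g i : \sum_p Rt (M2 g) p i p = \sum_k g k k i.
Proof.
rewrite /Rt /M2 /Mop.
under eq_bigr => p _.
  under eq_bigr => b _.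
    under eq_bigr => d _.
      rewrite mulr_suml; under eq_bigr => k _.
        rewrite mulr_suml.
        over.
      over.
    over.
  over.
rewrite exchange_big; apply: eq_bigr => b _.
rewrite exchange_last4 (bigD1 b) //= [X in _ + X]big1 => [|l nl].
  rewrite exchange_last3 (bigD1 i) //= [X in _ + X + _]big1 => [|k nk].
    rewrite !addr0 exchange_big /=.
    under eq_bigr => d _ do under eq_bigr => p _ do rewrite mulrAC (mulrC (Psi _ _ _ _)).
    under eq_bigr => d _ do rewrite -mulr_suml.
    by rewrite -mulr_suml skew !eqxx mul1r.
  rewrite exchange_big /=.
  under eq_bigr => d _ do under eq_bigr => p _ do rewrite mulrAC (mulrC (Psi _ _ _ _)).
  under eq_bigr => d _ do rewrite -mulr_suml.
  by rewrite -mulr_suml skew (negPf nk) mul0r.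
rewrite exchange_last3; apply: big1 => k _; rewrite exchange_big /=.
under eq_bigr => d _ do under eq_bigr => p _ do rewrite mulrAC (mulrC (Psi _ _ _ _)).
under eq_bigr => d _ do rewrite -mulr_suml.
by rewrite -mulr_suml skew (eq_sym b) (negPf nl) andbF mul0r.
Qed.

(** The mirror image, for the relations of T(V^* ): two auxiliary indices and one
    vector index, with R acting on the auxiliary ones as on the tensor square of
    the dual. *)
Definition Q1 (f : I -> I -> I -> K) k l b := Lop (fun p i => f p l i) k b.
Definition Q2 (f : I -> I -> I -> K) k l b := Lop (fun p i => f k p i) l b.
Definition N1 (f : I -> I -> I -> K) k l b := Mop (fun p i => f p l i) k b.
Definition N2 (f : I -> I -> I -> K) k l b := Mop (fun p i => f k p i) l b.
Definition Rd (f : I -> I -> I -> K) i j b := \sum_k \sum_l f k l b * R j i l k.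

Lemma Rd_Q f i' j' b : Rd (Q2 (Q1 f)) i' j' b = Q2 (Q1 (Rd f)) i' j' b.
Proof.
rewrite /Rd /Q2 /Q1 /Lop.
transitivity (\sum_p \sum_m \sum_j
   (\sum_l \sum_k \sum_i R j' i' l k * R k m i p * R l i b j) * f p j m).
  under eq_bigr => k _.
    under eq_bigr => l _.
      rewrite mulr_suml; under eq_bigr => i _.
        rewrite mulr_suml; under eq_bigr => j _.
          rewrite mulr_sumr mulr_suml; under eq_bigr => m _.
            rewrite mulr_sumr mulr_suml.
            over.
          over.
        over.
      over.
    over.
  rewrite exchange_last6; apply: eq_bigr => p _; rewrite exchange_last5; apply: eq_bigr => m _.
  rewrite exchange_last4; apply: eq_bigr => j _; rewrite exchange_big mulr_suml; apply: eq_bigr => l _.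
  rewrite mulr_suml; apply: eq_bigr => k _; rewrite mulr_suml.
  by apply: eq_bigr => i _; ring.
under eq_bigr => p _ do under eq_bigr => m _ do under eq_bigr => j _ do rewrite braid.
under [RHS]eq_bigr => i _.
  under eq_bigr => y _.
    rewrite mulr_sumr; under eq_bigr => m _.
      rewrite mulr_sumr; under eq_bigr => x _.
        rewrite !mulr_sumr; under eq_bigr => p _.
          rewrite !mulr_sumr.
          over.
        over.
      over.
    over.
  over.
rewrite exchange_last3 [RHS]exchange_last6; apply: eq_bigr => j _; rewrite [RHS]exchange_last5;
  apply: eq_bigr => p _.
rewrite [RHS]exchange_last3; apply: eq_bigr => m _; rewrite mulr_suml; apply: eq_bigr => i _.
rewrite [RHS]exchange_big mulr_suml; apply: eq_bigr => x _; rewrite mulr_suml.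
by apply: eq_bigr => y _; ring.
Qed.

Lemma N1K f : N1 (Q1 f) = f.
Proof.
apply/funext => a; apply/funext => b; apply/funext => d.
by rewrite /N1 (_ : (fun j i => Q1 f j b i) = Lop (fun j i => f j b i)) // MopE.
Qed.
Lemma Q1K f : Q1 (N1 f) = f.
Proof.
apply/funext => a; apply/funext => b; apply/funext => d.
by rewrite /Q1 (_ : (fun j i => N1 f j b i) = Mop (fun j i => f j b i)) // LopE.
Qed.
Lemma N2K f : N2 (Q2 f) = f.
Proof.
apply/funext => a; apply/funext => b; apply/funext => d.
by rewrite /N2 (_ : (fun j i => Q2 f a j i) = Lop (fun j i => f a j i)) // MopE.
Qed.
Lemma Q2K f : Q2 (N2 f) = f.
Proof.
apply/funext => a; apply/funext => b; apply/funext => d.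
by rewrite /Q2 (_ : (fun j i => N2 f a j i) = Mop (fun j i => f a j i)) // LopE.
Qed.

Lemma Rd_N f : Rd (N1 (N2 f)) = N1 (N2 (Rd f)).
Proof.
have h g : Rd (Q2 (Q1 g)) = Q2 (Q1 (Rd g)).
  by apply/funext => a; apply/funext => k; apply/funext => l; exact: Rd_Q.
by rewrite -[LHS]N1K -[Q1 _]N2K -h Q1K Q2K.
Qed.

Lemma Rd_trace g j : \sum_p Rd (N1 g) p j p = \sum_l g j l l.
Proof.
rewrite /Rd /N1 /Mop.
under eq_bigr => p _.
  under eq_bigr => k _.
    under eq_bigr => l _.
      rewrite mulr_suml; under eq_bigr => a _.
        rewrite mulr_suml.
        over.
      over.
    over.
  over.
rewrite exchange_last3; apply: eq_bigr => l _.
rewrite exchange_last4 (bigD1 j) //= [X in _ + X]big1 => [|b nb].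
  rewrite exchange_last3 (bigD1 l) //= [X in _ + X + _]big1 => [|a na].
    under eq_bigr => p _ do under eq_bigr => k _ do rewrite mulrAC (mulrC (Psi _ _ _ _)).
    under eq_bigr => p _ do rewrite -mulr_suml.
    by rewrite -mulr_suml skew !eqxx mul1r !addr0.
  under eq_bigr => p _ do under eq_bigr => k _ do rewrite mulrAC (mulrC (Psi _ _ _ _)).
  under eq_bigr => p _ do rewrite -mulr_suml.
  by rewrite -mulr_suml skew (negPf na) mul0r.
rewrite exchange_last3; apply: big1 => a _.
under eq_bigr => p _ do under eq_bigr => k _ do rewrite mulrAC (mulrC (Psi _ _ _ _)).
under eq_bigr => p _ do rewrite -mulr_suml.
by rewrite -mulr_suml skew (eq_sym j) (negPf nb) andbF mul0r.
Qed.

End RTT.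

(** * The permutation map of a free algebra *)
(** The permutation map is constructed on any space with the universal property of
    the tensor product. *)
Definition tensor_of (K : fieldType) (U V Y : lmodType K) (tn : U -> V -> Y) : Prop :=
  [/\ forall v, linear (tn ^~ v), forall u, linear (tn u)
    & forall (X : lmodType K) (f : U -> V -> X),
        (forall v, linear (f ^~ v)) -> (forall u, linear (f u)) ->
      exists2 g : Y -> X, linear g & (forall u v, g (tn u v) = f u v)
        /\ forall g' : Y -> X, linear g' -> (forall u v, g' (tn u v) = f u v) -> g' =1 g].

Lemma eq_addr (V : zmodType) (a b c d : V) : a = b -> c = d -> a + c = b + d.
Proof. by move=> -> ->. Qed.

Section FreeAlgebra.
Variables (K : fieldType) (N : nat) (T : lalgType K) (gen : 'I_N -> T).

Definition word (s : seq 'I_N) : T := foldr (fun i t => gen i * t) 1 s.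

(** The words form a basis; as a universal property. *)
Definition free_on : Prop := forall (X : lmodType K) (F : seq 'I_N -> X),
  exists2 f : T -> X, linear f & (forall s, f (word s) = F s)
    /\ forall g : T -> X, linear g -> (forall s, g (word s) = F s) -> g =1 f.

Lemma word_cons i s : gen i * word s = word (i :: s).
Proof. by []. Qed.

Hypothesis free : free_on.

Definition wlift (X : lmodType K) (F : seq 'I_N -> X) : T -> X :=
  sval (cid2 (free F)).

Lemma wlift_lin X F : linear (@wlift X F).
Proof. by rewrite /wlift; case: cid2. Qed.

Lemma wliftE X F s : @wlift X F (word s) = F s.
Proof. by rewrite /wlift; case: cid2 => f /= _ []. Qed.

Lemma word_ext (X : lmodType K) (f g : T -> X) : linear f -> linear g ->
  (forall s, f (word s) = g (word s)) -> f =1 g.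
Proof.
move=> hf hg h; have [k _ [_ ku]] := free (fun s => g (word s)).
by move=> t; rewrite (ku f) // (ku g).
Qed.

Lemma wlift_comb (X : lmodType K) (F G H : seq 'I_N -> X) a :
  (forall s, F s = a *: G s + H s) -> forall t, wlift F t = a *: wlift G t + wlift H t.
Proof.
move=> h; apply: word_ext; first exact: wlift_lin.
  by apply: lin_comb; exact: wlift_lin.
by move=> s; rewrite !wliftE.
Qed.

Hypothesis scaleAr : forall a (x y : T), x * (a *: y) = a *: (x * y).

Lemma mull_lin (b : T) : linear (fun t : T => b * t).
Proof. by move=> a u v; rewrite mulrDr scaleAr. Qed.
Lemma mulr_lin (b : T) : linear (fun t : T => t * b).
Proof. by move=> a u v; rewrite mulrDl scalerAl. Qed.

Variables (Y : lmodType K) (tn : T -> T -> Y).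
Local Notation "x \ot y" := (tn x y) (at level 40, left associativity).
Hypothesis tnP : tensor_of tn.

Lemma tn_linl v : linear (fun u => u \ot v).
Proof. by case: tnP. Qed.
Lemma tn_linr u : linear (tn u).
Proof. by case: tnP. Qed.

Section Ylift.
Variables (X : lmodType K) (f : T -> T -> X).
Hypotheses (fl : forall v, linear (f ^~ v)) (fr : forall u, linear (f u)).
Lemma ylift_sub : exists2 g : Y -> X, linear g & forall u v, g (u \ot v) = f u v.
Proof. by case: tnP => _ _ h; have [g hg [hE _]] := h X f fl fr; exists g. Qed.
Definition ylift : Y -> X := sval (cid2 ylift_sub).
Lemma ylift_lin : linear ylift.
Proof. by rewrite /ylift; case: cid2. Qed.
Lemma yliftE u v : ylift (u \ot v) = f u v.
Proof. by rewrite /ylift; case: cid2. Qed.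
End Ylift.

Lemma tn_ext (X : lmodType K) (f g : Y -> X) : linear f -> linear g ->
  (forall u v, f (u \ot v) = g (u \ot v)) -> f =1 g.
Proof.
move=> hf hg fg; case: tnP => _ _ h.
have [||k _ [_ ku]] := h X (fun u v => g (u \ot v)).
- by move=> v; exact: lin_comp hg (tn_linl v).
- by move=> u; exact: lin_comp hg (tn_linr u).
by move=> t; rewrite (ku f) // (ku g).
Qed.

Definition lmul (b : T) : Y -> Y :=
  ylift (f := fun x y => (b * x) \ot y) (fun v => lin_comp (tn_linl v) (mull_lin b))
        (fun u => tn_linr (b * u)).
Definition rmul (a : T) : Y -> Y :=
  ylift (f := fun x y => x \ot (y * a)) (fun v => tn_linl (v * a))
        (fun u => lin_comp (tn_linr u) (mulr_lin a)).

Lemma lmulE b x y : lmul b (x \ot y) = (b * x) \ot y.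
Proof. exact: yliftE. Qed.
Lemma lmul_lin b : linear (lmul b).
Proof. exact: ylift_lin. Qed.
Lemma rmulE a x y : rmul a (x \ot y) = x \ot (y * a).
Proof. exact: yliftE. Qed.
Lemma rmul_lin a : linear (rmul a).
Proof. exact: ylift_lin. Qed.

Lemma lmul_linl t : linear (fun b => lmul b t).
Proof.
move=> a b b'.
apply: (@tn_ext _ _ (fun t => a *: lmul b t + lmul b' t) (lmul_lin _)).
  by apply: lin_comb; apply: lmul_lin.
by move=> x y; rewrite !lmulE mulr_lin tn_linl.
Qed.
Lemma lmul1 t : lmul 1 t = t.
Proof.
apply: (@tn_ext _ (lmul 1) id (lmul_lin 1) (@lin_id _ _)) => x y.
by rewrite lmulE mul1r.
Qed.
Lemma lmulM b b' t : lmul (b * b') t = lmul b (lmul b' t).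
Proof.
apply: (@tn_ext _ (lmul (b * b')) (lmul b \o lmul b')) => [||x y /=].
- exact: lmul_lin.
- by apply: lin_comp; apply: lmul_lin.
- by rewrite !lmulE mulrA.
Qed.
Lemma lmul_rmul a b t : lmul b (rmul a t) = rmul a (lmul b t).
Proof.
apply: (@tn_ext _ (lmul b \o rmul a) (rmul a \o lmul b)) => [||x y /=].
- by apply: lin_comp; [apply: lmul_lin|apply: rmul_lin].
- by apply: lin_comp; [apply: rmul_lin|apply: lmul_lin].
- by rewrite !(lmulE, rmulE).
Qed.

Lemma tn_word_ext (X : lmodType K) (f g : Y -> X) : linear f -> linear g ->
  (forall s y, f (word s \ot y) = g (word s \ot y)) -> f =1 g.
Proof.
move=> hf hg h; apply: tn_ext => // x y.
apply: (word_ext (f := fun x => f (x \ot y)) (g := fun x => g (x \ot y))).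
- exact: lin_comp hf (tn_linl _).
- exact: lin_comp hg (tn_linl _).
- by move=> s; exact: h.
Qed.

Section Permutation.
Variables (Psi : coef4 K N) (c : K).
Local Notation B := (Bmat Psi).

(** The generator of index l of T(V^* ) moved across the word s and multiplied with
    a: at each letter it is either exchanged, by the term with Psi, or absorbed,
    by the term with B. *)
Fixpoint gen_pass_word (s : seq 'I_N) (l : 'I_N) (a : T) : Y :=
  if s is k :: s' then
    \sum_i \sum_j (c * Psi j k i l) *: lmul (gen i) (gen_pass_word s' j a) + B k l *: (word s' \ot a)
  else 1 \ot (gen l * a).

Lemma gen_pass_word_cons k s l a : gen_pass_word (k :: s) l a =
  \sum_i \sum_j (c * Psi j k i l) *: lmul (gen i) (gen_pass_word s j a) + B k l *: (word s \ot a).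
Proof. by []. Qed.

Lemma gen_pass_word_lin s l : linear (gen_pass_word s l).
Proof.
elim: s l => [|k s IH] l.
  exact: lin_comp (tn_linr _) (mull_lin _).
move=> a x y; rewrite !gen_pass_word_cons (tn_linr (word s)) scalerDr !scalerA (mulrC (B k l)) -scalerA.
rewrite scalerDr addrACA; apply: eq_addr; last by [].
rewrite scaler_sumr -big_split.
apply: eq_bigr => i _ /=; rewrite scaler_sumr -big_split; apply: eq_bigr => j _ /=.
by rewrite IH lmul_lin scalerDr !scalerA mulrC.
Qed.

Lemma gen_pass_bil l a : linear (fun b => wlift (fun s => gen_pass_word s l a) b).
Proof. exact: wlift_lin. Qed.
Lemma gen_pass_bir l b : linear (fun a => wlift (fun s => gen_pass_word s l a) b).
Proof. by move=> z x y; apply: wlift_comb => s; exact: gen_pass_word_lin. Qed.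

Definition gen_pass (l : 'I_N) : Y -> Y := ylift (gen_pass_bil l) (gen_pass_bir l).

Lemma gen_pass_lin l : linear (gen_pass l).
Proof. exact: ylift_lin. Qed.

Lemma gen_pass_wordE l s a : gen_pass l (word s \ot a) = gen_pass_word s l a.
Proof. by rewrite /gen_pass yliftE wliftE. Qed.

Lemma gen_pass1 l a : gen_pass l (1 \ot a) = 1 \ot (gen l * a).
Proof. exact: (gen_pass_wordE l [::] a). Qed.

Definition pass_rhs l k (t : Y) : Y :=
  \sum_i \sum_j (c * Psi j k i l) *: lmul (gen i) (gen_pass j t) + B k l *: t.

Lemma pass_rhs_lin l k : linear (pass_rhs l k).
Proof.
move=> a x y; rewrite /pass_rhs scalerDr !scalerA (mulrC (B k l)) -scalerA.
rewrite scalerDr addrACA; apply: eq_addr; last by [].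
rewrite scaler_sumr -big_split.
apply: eq_bigr => i _ /=; rewrite scaler_sumr -big_split; apply: eq_bigr => j _ /=.
by rewrite gen_pass_lin lmul_lin scalerDr !scalerA mulrC.
Qed.

(** The recursion of [gen_pass_word], freed from words. *)
Lemma gen_pass_lmul l k t : gen_pass l (lmul (gen k) t) = pass_rhs l k t.
Proof.
apply: (tn_word_ext (f := gen_pass l \o lmul (gen k)) (g := pass_rhs l k)).
- by apply: lin_comp; [apply: gen_pass_lin|apply: lmul_lin].
- exact: pass_rhs_lin.
move=> s y; rewrite /=; rewrite lmulE; rewrite word_cons; rewrite gen_pass_wordE.
rewrite gen_pass_word_cons; rewrite /pass_rhs; apply: eq_addr; last by [].
by apply: eq_bigr => i _; apply: eq_bigr => j _; rewrite gen_pass_wordE.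
Qed.

(** The generators act on the left of T(V^* ), and nothing else touches that
    factor. *)
Lemma gen_pass_rmul l a t : gen_pass l (rmul a t) = rmul a (gen_pass l t).
Proof.
move: t; apply: (tn_word_ext (f := gen_pass l \o rmul a) (g := rmul a \o gen_pass l)).
- by apply: lin_comp; [apply: gen_pass_lin|apply: rmul_lin].
- by apply: lin_comp; [apply: rmul_lin|apply: gen_pass_lin].
move=> s; elim: s l => [|k s IH] l y /=.
  by rewrite rmulE !gen_pass1 rmulE mulrA.
rewrite rmulE -(lmulE (gen k) (word s) (y * a)) -(lmulE (gen k) (word s) y).
rewrite (gen_pass_lmul l k (word s \ot (y * a))) (gen_pass_lmul l k (word s \ot y)) /pass_rhs.
rewrite (linD (rmul_lin a)) (linZ (rmul_lin a)) (rmulE a (word s) y).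
rewrite (lin_sum _ _ (rmul_lin a)).
apply: eq_addr; last by [].
apply: eq_bigr => i _.
rewrite (lin_sum _ _ (rmul_lin a)); apply: eq_bigr => j _.
by rewrite (linZ (rmul_lin a)) -lmul_rmul; have /= <- := IH j y; rewrite rmulE.
Qed.

Definition pass (a : T) (t : Y) : Y := wlift (fun s => foldr gen_pass t s) a.

Lemma pass_linl t : linear (pass ^~ t).
Proof. exact: wlift_lin. Qed.

Lemma pass_word s t : pass (word s) t = foldr gen_pass t s.
Proof. by rewrite /pass wliftE. Qed.

Lemma pass_linr a : linear (pass a).
Proof.
move=> z x y; apply: wlift_comb; elim=> [|l s IH] //=.
by rewrite IH gen_pass_lin.
Qed.

Lemma pass1 t : pass 1 t = t.
Proof. exact: (pass_word [::]). Qed.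

Lemma pass_genE l t : pass (gen l) t = gen_pass l t.
Proof. by rewrite -[gen l]mulr1 (word_cons l [::]) pass_word. Qed.

Lemma passM a a' t : pass (a * a') t = pass a (pass a' t).
Proof.
move: a; apply: (word_ext (f := fun a => pass (a * a') t) (g := fun a => pass a (pass a' t))).
- exact: lin_comp (pass_linl t) (mulr_lin a').
- exact: pass_linl.
move=> s; rewrite pass_word; elim: s => [|l s IH] /=; first by rewrite mul1r.
rewrite -IH -mulrA; move: (word s * a') => x {IH}; move: x.
apply: (word_ext (f := fun x => pass (gen l * x) t) (g := fun x => gen_pass l (pass x t))).
- exact: lin_comp (pass_linl t) (mull_lin _).
- exact: lin_comp (gen_pass_lin l) (pass_linl t).
by move=> s'; rewrite word_cons !pass_word.
Qed.

(** This is what makes sigma multiplicative in its first argument. *)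
Lemma pass_rmul a x t : pass a (rmul x t) = rmul x (pass a t).
Proof.
move: a; apply: (word_ext (f := fun a => pass a (rmul x t)) (g := fun a => rmul x (pass a t))).
- exact: pass_linl.
- exact: lin_comp (rmul_lin x) (pass_linl t).
by move=> s; rewrite !pass_word; elim: s => [|l s IH] //=; rewrite IH gen_pass_rmul.
Qed.

Lemma pass11 a x : pass a (1 \ot x) = 1 \ot (a * x).
Proof.
move: a; apply: (word_ext (f := fun a => pass a (1 \ot x)) (g := fun a => 1 \ot (a * x))).
- exact: pass_linl.
- exact: lin_comp (tn_linr 1) (mulr_lin x).
move=> s; rewrite pass_word; elim: s => [|l s IH] /=; first by rewrite mul1r.
by rewrite IH gen_pass1 mulrA.
Qed.

Lemma sigma_l b : linear (fun a => pass a (b \ot 1)).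
Proof. exact: pass_linl. Qed.
Lemma sigma_r a : linear (fun b => pass a (b \ot 1)).
Proof. exact: lin_comp (pass_linr a) (tn_linl 1). Qed.

Definition sigma : Y -> Y := ylift sigma_l sigma_r.

Lemma sigma_lin : linear sigma.
Proof. exact: ylift_lin. Qed.
Lemma sigmaE a b : sigma (a \ot b) = pass a (b \ot 1).
Proof. exact: yliftE. Qed.

Lemma act_l t a : linear (fun b => lmul b (pass a t)).
Proof. exact: lmul_linl. Qed.
Lemma act_r t b : linear (fun a => lmul b (pass a t)).
Proof. exact: lin_comp (lmul_lin b) (pass_linl t). Qed.

(** The product of T(V) (x) T(V^* ) twisted by sigma:
    (b (x) a) t = b . pass a t. *)
Definition act (s t : Y) : Y := ylift (act_l t) (act_r t) s.

Lemma act_linl t : linear (act ^~ t).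
Proof. exact: ylift_lin. Qed.
Lemma actE b a t : act (b \ot a) t = lmul b (pass a t).
Proof. exact: yliftE. Qed.

Lemma act_lmul x s t : act (lmul x s) t = lmul x (act s t).
Proof.
move: s; apply: (tn_ext (f := (act ^~ t) \o lmul x) (g := lmul x \o (act ^~ t))).
- exact: lin_comp (act_linl t) (lmul_lin x).
- exact: lin_comp (lmul_lin x) (act_linl t).
by move=> b a; rewrite /= lmulE !actE lmulM.
Qed.

Lemma gen_pass_act l s t : gen_pass l (act s t) = act (gen_pass l s) t.
Proof.
move: s; apply: (tn_word_ext (f := gen_pass l \o (act ^~ t)) (g := (act ^~ t) \o gen_pass l)).
- exact: lin_comp (gen_pass_lin l) (act_linl t).
- exact: lin_comp (act_linl t) (gen_pass_lin l).
move=> w; elim: w l => [|k w IH] l y /=.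
  by rewrite actE lmul1 gen_pass1 actE lmul1 passM pass_genE.
rewrite -(lmulE (gen k)) act_lmul !gen_pass_lmul /pass_rhs (linD (act_linl t)) (linZ (act_linl t)).
apply: eq_addr; last by [].
rewrite (lin_sum _ _ (act_linl t)); apply: eq_bigr => i _.
rewrite (lin_sum _ _ (act_linl t)); apply: eq_bigr => j _.
by rewrite (linZ (act_linl t)) act_lmul; have /= -> := IH j y.
Qed.

(** Associativity of the twisted product; it makes sigma multiplicative in its
    second argument. *)
Lemma pass_act a s t : pass a (act s t) = act (pass a s) t.
Proof.
move: a; apply: (word_ext (f := fun a => pass a (act s t)) (g := fun a => act (pass a s) t)).
- exact: pass_linl.
- exact: lin_comp (act_linl t) (pass_linl s).
by move=> w; rewrite !pass_word; elim: w => [|l w IH] //=; rewrite IH gen_pass_act.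
Qed.

Lemma pass_lmul a b t : pass a (lmul b t) = act (sigma (a \ot b)) t.
Proof. by rewrite sigmaE -pass_act actE pass1. Qed.

Lemma sigma_1l b : sigma (1 \ot b) = b \ot 1.
Proof. by rewrite sigmaE pass1. Qed.

Lemma sigma_1r a : sigma (a \ot 1) = 1 \ot a.
Proof. by rewrite sigmaE pass11 mulr1. Qed.

Lemma sigma_gen k l : sigma (gen l \ot gen k) =
  \sum_i \sum_j (c * Psi j k i l) *: (gen i \ot gen j) + B k l *: (1 \ot 1).
Proof.
rewrite sigmaE pass_genE -{1}[gen k]mulr1 -lmulE gen_pass_lmul /pass_rhs; congr (_ + _).
by apply: eq_bigr => i _; apply: eq_bigr => j _; rewrite gen_pass1 lmulE !mulr1.
Qed.

(** The map h stands for the composite that the multiplicativity condition applies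
    to sigma (a' (x) b); being linear, it is determined by its values on pure
    tensors. *)
Lemma sigma_mull a a' b (h : Y -> Y) : linear h ->
  (forall b a'', h (b \ot a'') = rmul a'' (sigma (a \ot b))) ->
  sigma ((a * a') \ot b) = h (sigma (a' \ot b)).
Proof.
move=> hl hE; rewrite !sigmaE passM; move: (pass a' _).
apply: (tn_ext (pass_linr a) hl) => x y.
by rewrite hE sigmaE -pass_rmul rmulE mul1r.
Qed.

Lemma sigma_mulr a b b' (h : Y -> Y) : linear h ->
  (forall b a, h (b \ot a) = lmul b (sigma (a \ot b'))) ->
  sigma (a \ot (b * b')) = h (sigma (a \ot b)).
Proof.
move=> hl hE; rewrite [LHS]sigmaE -lmulE pass_lmul; move: (sigma _).
apply: (tn_ext (act_linl _) hl) => x y.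
by rewrite hE sigmaE actE.
Qed.

Section Uniqueness.
Variable tau : Y -> Y.
Hypotheses (tau_lin : linear tau)
  (tau_gen : forall k l, tau (gen l \ot gen k) =
    \sum_i \sum_j (c * Psi j k i l) *: (gen i \ot gen j) + B k l *: (1 \ot 1))
  (tau_1l : forall b, tau (1 \ot b) = b \ot 1)
  (tau_1r : forall a, tau (a \ot 1) = 1 \ot a)
  (tau_mull : forall a, exists h : Y -> Y, [/\ linear h,
     forall b a'', h (b \ot a'') = rmul a'' (tau (a \ot b))
     & forall a' b, tau ((a * a') \ot b) = h (tau (a' \ot b))])
  (tau_mulr : forall b', exists h : Y -> Y, [/\ linear h,
     forall b a, h (b \ot a) = lmul b (tau (a \ot b'))
     & forall a b, tau (a \ot (b * b')) = h (tau (a \ot b))]).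

(** Induction on the letters of b, by multiplicativity in the second argument. *)
Lemma tau_gen_pass l b : tau (gen l \ot b) = gen_pass l (b \ot 1).
Proof.
move: b; apply: (word_ext (f := fun b => tau (gen l \ot b)) (g := fun b => gen_pass l (b \ot 1))).
- exact: lin_comp tau_lin (tn_linr _).
- exact: lin_comp (gen_pass_lin l) (tn_linl _).
move=> s; elim: s l => [|k s IH] l /=; first by rewrite tau_1r gen_pass1 mulr1.
have [h [hl hE ->]] := tau_mulr (word s).
rewrite tau_gen -lmulE gen_pass_lmul /pass_rhs linD // linZ // hE lmul1 tau_1l.
congr (_ + _); rewrite lin_sum //; apply: eq_bigr => i _.
by rewrite lin_sum //; apply: eq_bigr => j _; rewrite linZ // hE IH.
Qed.

(** Induction on the letters of the first argument. *)
Lemma tau_sigma : tau =1 sigma.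
Proof.
apply: (tn_word_ext tau_lin sigma_lin) => s b; rewrite sigmaE pass_word.
elim: s => [|l s IH] /=; first by rewrite tau_1l.
have [h [hl hE ->]] := tau_mull (gen l); rewrite IH; move: (foldr _ _ _).
apply: (tn_ext hl (gen_pass_lin l)) => x y.
by rewrite hE tau_gen_pass -gen_pass_rmul rmulE mul1r.
Qed.

End Uniqueness.

Definition qelt (u : 'M[K]_N) : T := \sum_i \sum_j u i j *: (gen i * gen j).

Lemma lmul_qelt u t : lmul (qelt u) t =
  \sum_i \sum_j u i j *: lmul (gen i) (lmul (gen j) t).
Proof.
have hl := lmul_linl t; rewrite /qelt (lin_sum _ _ hl); apply: eq_bigr => i _.
by rewrite (lin_sum _ _ hl); apply: eq_bigr => j _; rewrite (linZ hl) lmulM.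
Qed.

Lemma pass_qelt u t : pass (qelt u) t =
  \sum_i \sum_j u i j *: gen_pass i (gen_pass j t).
Proof.
have hl := pass_linl t; rewrite /qelt (lin_sum _ _ hl); apply: eq_bigr => i _.
by rewrite (lin_sum _ _ hl); apply: eq_bigr => j _; rewrite (linZ hl) passM !pass_genE.
Qed.

(** The tensors u_n of the crossing of u by the generator l, and the coordinates of
    the element of V that it leaves. *)
Definition sliceB l n (u : 'M[K]_N) : 'M[K]_N :=
  \matrix_(i, p) \sum_k \sum_m \sum_j (u k m * Psi j k i l * Psi n m p j).
Definition linB l (u : 'M[K]_N) i : K :=
  c * (\sum_k \sum_m \sum_j u k m * Psi j k i l * B m j) + \sum_k B k l * u k i.

(** The generator survives both letters of u, giving [sliceB], or is absorbed by one
    of them, giving the two terms of [linB]. *)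
Lemma gen_pass_qelt l u t : gen_pass l (lmul (qelt u) t) =
  c ^+ 2 *: (\sum_n lmul (qelt (sliceB l n u)) (gen_pass n t))
  + \sum_i linB l u i *: lmul (gen i) t.
Proof.
have E k m : gen_pass l (lmul (gen k) (lmul (gen m) t)) =
   (\sum_i \sum_j \sum_p \sum_n (c ^+ 2 * (Psi j k i l * Psi n m p j)) *: lmul (gen i) (lmul (gen
     p) (gen_pass n t))
   + \sum_i \sum_j (c * Psi j k i l * B m j) *: lmul (gen i) t)
   + B k l *: lmul (gen m) t.
  rewrite gen_pass_lmul {1}/pass_rhs; congr (_ + _).
  rewrite -big_split; apply: eq_bigr => i _; rewrite -big_split; apply: eq_bigr => j _ /=.
  rewrite gen_pass_lmul /pass_rhs (linD (lmul_lin _)) (linZ (lmul_lin _)) scalerDr scalerA.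
  congr (_ + _); rewrite (lin_sum _ _ (lmul_lin _)) scaler_sumr; apply: eq_bigr => p _.
  rewrite (lin_sum _ _ (lmul_lin _)) scaler_sumr; apply: eq_bigr => n _.
  by rewrite (linZ (lmul_lin _)) scalerA expr2; congr (_ *: _); rewrite mulrACA.
rewrite lmul_qelt (lin_sum _ _ (gen_pass_lin l)).
under eq_bigr => k _.
  rewrite (lin_sum _ _ (gen_pass_lin l)); under eq_bigr => m _.
    rewrite (linZ (gen_pass_lin l)) E !scalerDr.
    over.
  rewrite !big_split /=; over.
rewrite !big_split /= -addrA; congr (_ + _).
  rewrite scaler_sumr; under eq_bigr => k _.
    under eq_bigr => m _.
      rewrite scaler_sumr; under eq_bigr => i _.
        rewrite scaler_sumr; under eq_bigr => j _.
          rewrite scaler_sumr; under eq_bigr => p _.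
            rewrite scaler_sumr; under eq_bigr => n _ do rewrite scalerA.
            over.
          over.
        over.
      over.
    over.
  rewrite exchange_last6; apply: eq_bigr => n _.
  rewrite exchange_last5 lmul_qelt [in RHS]exchange_big scaler_sumr; apply: eq_bigr => p _.
  rewrite exchange_last3 scaler_sumr; apply: eq_bigr => i _.
  rewrite mxE scalerA mulr_sumr scaler_suml; apply: eq_bigr => k _.
  rewrite mulr_sumr scaler_suml; apply: eq_bigr => m _.
  rewrite mulr_sumr scaler_suml; apply: eq_bigr => j _.
  by congr (_ *: _); ring.
under [RHS]eq_bigr => i _ do rewrite /linB scalerDl.
rewrite big_split /=; congr (_ + _).
  under eq_bigr => k _.
    under eq_bigr => m _.
      rewrite scaler_sumr; under eq_bigr => i _.
        rewrite scaler_sumr; under eq_bigr => j _ do rewrite scalerA.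
        over.
      over.
    over.
  rewrite exchange_last3; apply: eq_bigr => i _.
  rewrite mulr_sumr scaler_suml; apply: eq_bigr => k _.
  rewrite mulr_sumr scaler_suml; apply: eq_bigr => m _.
  rewrite mulr_sumr scaler_suml; apply: eq_bigr => j _.
  by congr (_ *: _); ring.
rewrite exchange_big; apply: eq_bigr => m _; rewrite scaler_suml; apply: eq_bigr => k _.
by rewrite scalerA mulrC.
Qed.

(** The same for a quadratic element of T(V^* ) crossing the letter m. *)
Definition sliceA m n (u : 'M[K]_N) : 'M[K]_N :=
  \matrix_(p, j) \sum_k \sum_l \sum_i (u k l * Psi j m i l * Psi p i n k).
Definition linA m (u : 'M[K]_N) j : K :=
  c * (\sum_k \sum_l \sum_i u k l * Psi j m i l * B i k) + \sum_l B m l * u j l.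

Lemma pass_qelt_lmul m u t : pass (qelt u) (lmul (gen m) t) =
  c ^+ 2 *: (\sum_n lmul (gen n) (pass (qelt (sliceA m n u)) t))
  + \sum_j linA m u j *: gen_pass j t.
Proof.
have E k l : gen_pass k (gen_pass l (lmul (gen m) t)) =
   (\sum_i \sum_j \sum_n \sum_p (c ^+ 2 * (Psi j m i l * Psi p i n k)) *: lmul (gen n) (gen_pass p
     (gen_pass j t))
   + \sum_i \sum_j (c * Psi j m i l * B i k) *: gen_pass j t)
   + B m l *: gen_pass k t.
  rewrite gen_pass_lmul {1}/pass_rhs (linD (gen_pass_lin k)) (linZ (gen_pass_lin k)); congr (_ + _).
  rewrite (lin_sum _ _ (gen_pass_lin k)) -big_split; apply: eq_bigr => i _.
  rewrite (lin_sum _ _ (gen_pass_lin k)) -big_split; apply: eq_bigr => j _ /=.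
  rewrite (linZ (gen_pass_lin k)) gen_pass_lmul /pass_rhs scalerDr scalerA.
  congr (_ + _); rewrite scaler_sumr; apply: eq_bigr => n _.
  rewrite scaler_sumr; apply: eq_bigr => p _.
  by rewrite scalerA; congr (_ *: _); ring.
rewrite pass_qelt.
under eq_bigr => k _.
  under eq_bigr => l _.
    rewrite E !scalerDr.
    over.
  rewrite !big_split /=; over.
rewrite !big_split /= -addrA; congr (_ + _).
  under eq_bigr => k _.
    under eq_bigr => l _.
      rewrite scaler_sumr; under eq_bigr => i _.
        rewrite scaler_sumr; under eq_bigr => j _.
          rewrite scaler_sumr; under eq_bigr => n _.
            rewrite scaler_sumr; under eq_bigr => p _ do rewrite scalerA.
            over.
          over.
        over.
      over.
    over.
  rewrite exchange_last6 scaler_sumr.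
  under [RHS]eq_bigr => n _.
    rewrite pass_qelt (lin_sum _ _ (lmul_lin _)) scaler_sumr.
    over.
  rewrite [in RHS]exchange_big; apply: eq_bigr => p _.
  rewrite exchange_last5; apply: eq_bigr => n _.
  rewrite exchange_last4 (lin_sum _ _ (lmul_lin _)) scaler_sumr; apply: eq_bigr => j _.
  rewrite (linZ (lmul_lin _)) mxE scalerA mulr_sumr scaler_suml; apply: eq_bigr => k _.
  rewrite mulr_sumr scaler_suml; apply: eq_bigr => l _.
  rewrite mulr_sumr scaler_suml; apply: eq_bigr => i _.
  by congr (_ *: _); ring.
under [RHS]eq_bigr => j _ do rewrite /linA scalerDl.
rewrite big_split /=; congr (_ + _).
  under eq_bigr => k _.
    under eq_bigr => l _.
      rewrite scaler_sumr; under eq_bigr => i _.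
        rewrite scaler_sumr; under eq_bigr => j _ do rewrite scalerA.
        over.
      over.
    over.
  rewrite exchange_last4; apply: eq_bigr => j _.
  rewrite mulr_sumr scaler_suml; apply: eq_bigr => k _.
  rewrite mulr_sumr scaler_suml; apply: eq_bigr => l _.
  rewrite mulr_sumr scaler_suml; apply: eq_bigr => i _.
  by congr (_ *: _); ring.
apply: eq_bigr => k _; rewrite scaler_suml; apply: eq_bigr => l _.
by rewrite scalerA mulrC.
Qed.

Lemma lproj_eq0 (M : lmodType K) (S : M -> Prop) u : lproj S u = 0 -> u \in lin_span S.
Proof. by rewrite -(linear0 (lproj S)) => /lprojP; rewrite subr0. Qed.

Lemma lproj_span0 (M : lmodType K) (S : M -> Prop) u : u \in lin_span S -> lproj S u = 0.
Proof. by move=> h; rewrite -(linear0 (lproj S)); apply/lprojP; rewrite subr0. Qed.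

Lemma lproj_lin (M : lmodType K) (S : M -> Prop) : linear (lproj S).
Proof. exact: lproj_linear. Qed.

Lemma zero_lin (U V : lmodType K) : linear (fun _ : U => 0 : V).
Proof. by move=> a u v; rewrite scaler0 addr0. Qed.

Lemma tn_span (X : lmodType K) (f : Y -> X) (P : X -> Prop) : linear f ->
  (forall s v, f (word s \ot v) \in lin_span P) -> forall t, f t \in lin_span P.
Proof.
move=> hf h t; apply: lproj_eq0; move: t.
apply: (tn_word_ext (f := fun t => lproj P (f t)) (g := fun _ => 0)).
- exact: lin_comp (@lproj_lin _ P) hf.
- exact: zero_lin.
by move=> s v; apply: lproj_span0.
Qed.

Lemma word_span (X : lmodType K) (f : T -> X) (P : X -> Prop) : linear f ->
  (forall s, f (word s) \in lin_span P) -> forall t, f t \in lin_span P.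
Proof.
move=> hf h t; apply: lproj_eq0; move: t.
apply: (word_ext (f := fun t => lproj P (f t)) (g := fun _ => 0)).
- exact: lin_comp (@lproj_lin _ P) hf.
- exact: zero_lin.
by move=> s; apply: lproj_span0.
Qed.

(** If moving generators across quadratic relations gives relations again, then
    sigma preserves the two ideals. *)
Section Descent.
Variables PA PB : 'M[K]_N -> 'M[K]_N.
Definition qrel (P : 'M[K]_N -> 'M[K]_N) (t : T) : Prop := exists u, t = qelt (P u).
Hypothesis sliceB_im : forall u l n, exists v, sliceB l n (PB u) = PB v.
Hypothesis linB0 : forall u l i, linB l (PB u) i = 0.
Hypothesis sliceA_im : forall u m n, exists v, sliceA m n (PA u) = PA v.
Hypothesis linA0 : forall u m j, linA m (PA u) j = 0.

Definition inB (y : Y) : Prop := exists b a, ideal_gen (qrel PB) b /\ y = b \ot a.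
Definition inA (y : Y) : Prop := exists b a, ideal_gen (qrel PA) a /\ y = b \ot a.

Lemma lmul_inB b t : t \in lin_span inB -> lmul b t \in lin_span inB.
Proof.
apply: lin_span_lin (lmul_lin b) _ => _ [x [a [[p [r [j [Jj ->]]]] ->]]].
rewrite lmulE; apply: lin_span_gen; exists (b * (p * j * r)), a; split=> //.
by exists (b * p), r, j; split=> //; rewrite !mulrA.
Qed.

Lemma lmul_relB u t : lmul (qelt (PB u)) t \in lin_span inB.
Proof.
move: t; apply: tn_span; first exact: lmul_lin.
move=> s a; rewrite lmulE; apply: lin_span_gen; exists (qelt (PB u) * word s), a; split=> //.
by exists 1, (word s), (qelt (PB u)); split; [exists u|rewrite mul1r].
Qed.

(** Induction on the letters to the left of the relation; when none is left,
    [gen_pass_qelt] and the hypotheses on PB apply. *)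
Lemma gen_pass_inB l t : t \in lin_span inB -> gen_pass l t \in lin_span inB.
Proof.
apply: lin_span_lin (gen_pass_lin l) _ => _ [_ [a [[p [r [_ [[u ->] ->]]]] ->]]].
rewrite -mulrA -!lmulE; move: (r \ot a) => z; move: p l.
suff H s l : gen_pass l (lmul (word s) (lmul (qelt (PB u)) z)) \in lin_span inB.
  move=> p l; move: p; apply: word_span => //.
  exact: lin_comp (gen_pass_lin l) (lmul_linl _).
elim: s l => [|k s IH] l.
  rewrite lmul1 gen_pass_qelt; apply: rpredD; [apply: lin_spanZ|];
    apply: rpred_sum => n _; last by rewrite linB0 scale0r rpred0.
  by have [v ->] := sliceB_im u l n; exact: lmul_relB.
rewrite -word_cons lmulM gen_pass_lmul /pass_rhs; apply: rpredD.
  apply: rpred_sum => i _; apply: rpred_sum => j _; apply: lin_spanZ.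
  by apply: lmul_inB.
by apply: lin_spanZ; apply: lmul_inB; exact: lmul_relB.
Qed.

Lemma sigma_idealB a b : ideal_gen (qrel PB) b -> sigma (a \ot b) \in lin_span inB.
Proof.
move=> hb; rewrite sigmaE; move: a; apply: word_span; first exact: pass_linl.
elim=> [|l s IH]; first by rewrite pass1; apply: lin_span_gen; exists b, 1.
by rewrite -word_cons passM pass_genE gen_pass_inB.
Qed.

Lemma lmul_inA b t : t \in lin_span inA -> lmul b t \in lin_span inA.
Proof.
apply: lin_span_lin (lmul_lin b) _ => _ [x [a [ha ->]]].
by rewrite lmulE; apply: lin_span_gen; exists (b * x), a.
Qed.

Lemma gen_pass_inA l t : t \in lin_span inA -> gen_pass l t \in lin_span inA.
Proof.
apply: lin_span_lin (gen_pass_lin l) _ => _ [b [a [ha ->]]]; move: b l.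
suff H s l : gen_pass l (word s \ot a) \in lin_span inA.
  move=> b l; move: b; apply: word_span => //.
  exact: lin_comp (gen_pass_lin l) (tn_linl a).
elim: s l => [|k s IH] l.
  rewrite gen_pass1; case: ha => p [r [j [Jj ->]]].
  apply: lin_span_gen; exists 1, (gen l * (p * j * r)); split=> //.
  by exists (gen l * p), r, j; split=> //; rewrite !mulrA.
rewrite -word_cons -lmulE gen_pass_lmul /pass_rhs; apply: rpredD.
  apply: rpred_sum => i _; apply: rpred_sum => j _; apply: lin_spanZ.
  by apply: lmul_inA.
by apply: lin_spanZ; apply: lin_span_gen; exists (word s), a.
Qed.

(** Induction on the letters of the first factor. Crossing a letter changes the
    relation u into its slices, so u has to vary in the induction. *)
Lemma pass_relA u t : pass (qelt (PA u)) t \in lin_span inA.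
Proof.
move: t; apply: tn_span; first exact: pass_linr.
move=> s y; elim: s u => [|k s IH] u.
  rewrite pass11; apply: lin_span_gen; exists 1, (qelt (PA u) * y); split=> //.
  by exists 1, y, (qelt (PA u)); split; [exists u|rewrite mul1r].
rewrite -word_cons -lmulE pass_qelt_lmul; apply: rpredD; [apply: lin_spanZ|];
  apply: rpred_sum => n _; last by rewrite linA0 scale0r rpred0.
by have [v ->] := sliceA_im u k n; apply: lmul_inA.
Qed.

Lemma sigma_idealA a b : ideal_gen (qrel PA) a -> sigma (a \ot b) \in lin_span inA.
Proof.
move=> [p [r [_ [[u ->] ->]]]]; rewrite sigmaE !passM.
have := pass_relA u (pass r (b \ot 1)); move: (pass _ _) => t ht.
move: p; apply: word_span; first exact: pass_linl.
elim=> [|l s IH]; first by rewrite pass1.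
by rewrite -word_cons passM pass_genE gen_pass_inA.
Qed.

End Descent.

End Permutation.
End FreeAlgebra.

(** * Freeness of the tensor algebra *)
Lemma tens_tensor_of (K : fieldType) (U V : lmodType K) : tensor_of (@tens K U V).
Proof.
split=> [v|u|X f fl fr]; [exact: tens_linl|exact: tens_linr|].
exists (tlift f); first exact: tlift_linear fl fr.
split=> [u v|g hg gE]; first exact: tlift_tens fl fr u v.
by apply: tens_ext hg (tlift_linear fl fr) _ => u v; rewrite gE (tlift_tens fl fr).
Qed.

Section Talg.
Variables (K : fieldType) (N : nat).
Local Notation T := (@Talg K N).
Local Notation M := {fmonom 'I_N}.

Lemma malg_scaleAr (a : K) (x y : {malg K[M]}) : x * (a *: y) = a *: (x * y).
Proof.
apply/malgP => k; rewrite mcoeffZ (mcoeffMlw k (fsubset_refl _) (msuppZ_le a y)) mcoeffMl.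
rewrite mulr_sumr; apply: eq_bigr => i _; rewrite mulr_sumr; apply: eq_bigr => j _.
by rewrite mcoeffZ mulrCA mulrnAr.
Qed.

Lemma Talg_scaleAr (a : K) (x y : T) : x * (a *: y) = a *: (x * y).
Proof. exact: malg_scaleAr. Qed.

Lemma Talg_word (s : seq 'I_N) : word (@Tgen K N) s = << FMonom s >> :> {malg K[M]}.
Proof.
elim: s => [|i s IH] /=; first by rewrite -fmoneE.
rewrite [LHS](_ : _ = (<< fmu i >> : {malg K[M]}) * << FMonom s >>); last by rewrite -IH.
by rewrite [LHS]fgmulUU mulr1 /mmul /= fmmulE fmuE.
Qed.

Lemma malg_basis_ext (X : lmodType K) (f g : {malg K[M]} -> X) : linear f -> linear g ->
  (forall m, f << m >> = g << m >>) -> f =1 g.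
Proof.
move=> hf hg h t; rewrite [t]monalgE !lin_sum //; apply: eq_bigr => m _.
have -> : << t@_m *g m >> = t@_m *: (<< m >> : {malg K[M]}).
  by apply/malgP => k; rewrite mcoeffZ !mcoeffU mulrnAr mulr1.
by rewrite !linZ // h.
Qed.

Lemma malg_basis_lift (X : lmodType K) (F : M -> X) :
  exists2 f : {malg K[M]} -> X, linear f & forall m, f << m >> = F m.
Proof.
pose ext (g : {malg K[M]}) : X := \sum_(p <- msupp g) g@_p *: F p.
have extEw (D : {fset M}) g : (msupp g `<=` D)%fset -> ext g = \sum_(p <- D) g@_p *: F p.
  move=> sD; rewrite /ext (big_fset_incl _ sD) // => p _ pNg.
  by rewrite mcoeff_outdom ?scale0r.
exists ext => [a g h|m]; last by rewrite /ext msuppU oner_eq0 /= big_seq_fset1 mcoeffUU scale1r.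
pose D := (msupp g `|` msupp h `|` msupp (a *: g + h))%fset.
rewrite !(@extEw D) ?fsubsetUr //; last 2 first.
- by rewrite /D fsubsetU // fsubsetUr.
- by rewrite /D fsubsetU // fsubsetUl.
rewrite scaler_sumr -big_split /=; apply: eq_bigr => p _.
by rewrite mcoeffD mcoeffZ scalerDl scalerA.
Qed.

(** The noncommutative monomials are the words in the generators. *)
Lemma Talg_free : free_on (@Tgen K N).
Proof.
move=> X F; have [f hf fE] := malg_basis_lift (fun m : M => F m).
have fw s : f (word (@Tgen K N) s) = F s by rewrite Talg_word fE.
exists f => //; split=> // g hg gE; apply: malg_basis_ext => // m.
by have := gE m; rewrite Talg_word fmK => ->; rewrite fE.
Qed.

End Talg.

(** * The conditions on the permutation map *)
Section TensorAlgebra.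
Variables (K : fieldType) (T : lalgType K).
Hypothesis scaleAr : forall a (x y : T), x * (a *: y) = a *: (x * y).
Local Notation Y := (tensor T T).
Local Notation tnP := (@tens_tensor_of K T T).
Local Notation lmulY := (lmul scaleAr tnP).
Local Notation rmulY := (rmul tnP).

Lemma tmul_bil : (forall b : T, linear (fun x : T => x * b)) /\ (forall x : T, linear ( *%R x)).
Proof. by split=> b; [exact: mulr_lin|exact: (mull_lin scaleAr)]. Qed.

Lemma tmul_lin : linear (@tmul K T).
Proof. exact: tlift_linear (proj1 tmul_bil) (proj2 tmul_bil). Qed.
Lemma tmulE (x y : T) : tmul (x \ox y) = x * y.
Proof. exact: tlift_tens (proj1 tmul_bil) (proj2 tmul_bil) x y. Qed.

Section Sides.
Variable tau : Y -> Y.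
Hypothesis tau_lin : linear tau.

(** The composites of the multiplicativity conditions, with one argument fixed: on a
    pure tensor b (x) x, [onL a] gives sigma (a (x) b) multiplied by x on the right,
    and [onR] is its mirror image. *)
Definition onL (a : T) : Y -> Y :=
  tmap id (@tmul K T) \o (@tassoc K T T T \o (tmap tau id \o (@tassocV K T T T \o tens a))).
Definition onR (b : T) : Y -> Y :=
  tmap (@tmul K T) id \o (@tassocV K T T T \o (tmap id tau \o (@tassoc K T T T \o (fun s => s \ox b)))).

Lemma onL_def a s : onL a s =
  tmap id (@tmul K T) (@tassoc K T T T (tmap tau id (@tassocV K T T T (a \ox s)))).
Proof. by []. Qed.
Lemma onR_def b s : onR b s =
  tmap (@tmul K T) id (@tassocV K T T T (tmap id tau (@tassoc K T T T (s \ox b)))).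
Proof. by []. Qed.

Lemma tauid_lin : linear (tmap tau (@id T)).
Proof. exact: tmap_lin tau_lin (@lin_id K T). Qed.
Lemma idtau_lin : linear (tmap (@id T) tau).
Proof. exact: tmap_lin (@lin_id K T) tau_lin. Qed.
Lemma idmul_lin : linear (tmap (@id T) (@tmul K T)).
Proof. exact: tmap_lin (@lin_id K T) tmul_lin. Qed.
Lemma mulid_lin : linear (tmap (@tmul K T) (@id T)).
Proof. exact: tmap_lin tmul_lin (@lin_id K T). Qed.

Lemma onL_lin a : linear (onL a).
Proof.
rewrite /onL; apply: lin_comp idmul_lin _; apply: lin_comp (@tassoc_lin K T T T) _.
apply: lin_comp tauid_lin _; apply: lin_comp (@tassocV_lin K T T T) _.
exact: tens_linr.
Qed.
Lemma onR_lin b : linear (onR b).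
Proof.
rewrite /onR; apply: lin_comp mulid_lin _; apply: lin_comp (@tassocV_lin K T T T) _.
apply: lin_comp idtau_lin _; apply: lin_comp (@tassoc_lin K T T T) _.
exact: tens_linl.
Qed.

Lemma idmul_assoc (x : T) (z : Y) :
  tmap id (@tmul K T) (@tassoc K T T T (z \ox x)) = rmulY x z.
Proof.
move: z; apply: (tens_ext
  (lin_comp idmul_lin (lin_comp (@tassoc_lin K T T T) (tens_linl x))) (rmul_lin tnP x)).
move=> u v /=; rewrite (tassocE u v x) (tmapE (@lin_id K T) tmul_lin u (v \ox x)) (tmulE v x).
by rewrite (rmulE tnP x u v).
Qed.

Lemma mulid_assoc (x : T) (z : Y) :
  tmap (@tmul K T) id (@tassocV K T T T (x \ox z)) = lmulY x z.
Proof.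
move: z; apply: (tens_ext
  (lin_comp mulid_lin (lin_comp (@tassocV_lin K T T T) (tens_linr x))) (lmul_lin scaleAr tnP x)).
move=> u v /=; rewrite (tassocVE x u v) (tmapE tmul_lin (@lin_id K T) (x \ox u) v) (tmulE x u).
by rewrite (lmulE scaleAr tnP x u v).
Qed.

Lemma onLE a b x : onL a (b \ox x) = rmulY x (tau (a \ox b)).
Proof.
rewrite onL_def (tassocVE a b x) (tmapE tau_lin (@lin_id K T) (a \ox b) x).
exact: idmul_assoc.
Qed.

Lemma onRE b x a : onR b (x \ox a) = lmulY x (tau (a \ox b)).
Proof.
rewrite onR_def (tassocE x a b) (tmapE (@lin_id K T) tau_lin x (a \ox b)).
exact: mulid_assoc.
Qed.

Lemma tens3_ext (X : lmodType K) (f g : tensor (tensor T T) T -> X) : linear f -> linear g ->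
  (forall u v w, f ((u \ox v) \ox w) = g ((u \ox v) \ox w)) -> f =1 g.
Proof.
move=> hf hg h; apply: (tens_ext hf hg) => s w; move: s.
apply: (tens_ext (lin_comp hf (tens_linl w)) (lin_comp hg (tens_linl w))) => u v.
exact: h.
Qed.

(** Both sides are linear on the triple tensor product, so that the condition is one
    on pure tensors. *)
Lemma perm_mull_iff : (tau \o tmap (@tmul K T) id
      =1 tmap id (@tmul K T) \o @tassoc K T T T \o tmap tau id
           \o (@tassocV K T T T \o tmap id tau \o @tassoc K T T T))
  <-> forall a a' b, tau ((a * a') \ox b) = onL a (tau (a' \ox b)).
Proof.
have E1 a a' b : tau (tmap (@tmul K T) id ((a \ox a') \ox b)) = tau ((a * a') \ox b).
  by rewrite (tmapE tmul_lin (@lin_id K T) (a \ox a') b) (tmulE a a').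
have E2 a a' b : tmap (@id T) tau (@tassoc K T T T ((a \ox a') \ox b)) = a \ox (tau (a' \ox b)).
  by rewrite (tassocE a a' b) (tmapE (@lin_id K T) tau_lin a (a' \ox b)).
split=> [h a a' b|h].
  by rewrite -(E1 a a' b) onL_def -(E2 a a' b); exact: h.
apply: tens3_ext => [||a a' b].
- exact (lin_comp tau_lin mulid_lin).
- exact (lin_comp (lin_comp (lin_comp idmul_lin (@tassoc_lin K T T T)) tauid_lin)
   (lin_comp (lin_comp (@tassocV_lin K T T T) idtau_lin) (@tassoc_lin K T T T))).
- apply: (eq_trans (E1 a a' b)); apply: (eq_trans (h a a' b)).
  by rewrite onL_def -(E2 a a' b).
Qed.

Lemma perm_mulr_iff : (tau \o tmap id (@tmul K T) \o @tassoc K T T T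
      =1 tmap (@tmul K T) id \o (@tassocV K T T T \o tmap id tau \o @tassoc K T T T)
           \o tmap tau id)
  <-> forall a b b', tau (a \ox (b * b')) = onR b' (tau (a \ox b)).
Proof.
have E1 a b b' : tau (tmap id (@tmul K T) (@tassoc K T T T ((a \ox b) \ox b'))) = tau (a \ox (b * b')).
  by rewrite (tassocE a b b') (tmapE (@lin_id K T) tmul_lin a (b \ox b')) (tmulE b b').
have E2 a b b' : tmap tau (@id T) ((a \ox b) \ox b') = (tau (a \ox b)) \ox b'.
  exact: (tmapE tau_lin (@lin_id K T) (a \ox b) b').
split=> [h a b b'|h].
  by rewrite -(E1 a b b') onR_def -(E2 a b b'); exact: h.
apply: tens3_ext => [||a b b'].
- exact (lin_comp (lin_comp tau_lin idmul_lin) (@tassoc_lin K T T T)).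
- exact (lin_comp (lin_comp mulid_lin
   (lin_comp (lin_comp (@tassocV_lin K T T T) idtau_lin) (@tassoc_lin K T T T))) tauid_lin).
- apply: (eq_trans (E1 a b b')); apply: (eq_trans (h a b b')).
  by rewrite onR_def -(E2 a b b').
Qed.

End Sides.

End TensorAlgebra.

Section GenericCompatibility.
Variables (K : fieldType) (N : nat) (T : lalgType K) (gen : 'I_N -> T).
Hypothesis free : free_on gen.
Hypothesis scaleAr : forall a (x y : T), x * (a *: y) = a *: (x * y).
Variables (Psi : coef4 K N) (c : K).
Local Notation Y := (tensor T T).
Local Notation tnP := (@tens_tensor_of K T T).
Local Notation sig := (sigma free scaleAr tnP Psi c).

(** [permutation_map] for any algebra with generators in place of the tensor
    algebra. *)
Definition perm_spec (tau : Y -> Y) : Prop :=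
  [/\ linear tau,
    forall k l, tau (gen l \ox gen k) =
      \sum_i \sum_j (c * Psi j k i l) *: (gen i \ox gen j) + Bmat Psi k l *: (1 \ox 1),
    tau \o tmap (@tmul K T) id
      =1 tmap id (@tmul K T) \o @tassoc K T T T \o tmap tau id
           \o (@tassocV K T T T \o tmap id tau \o @tassoc K T T T),
    tau \o tmap id (@tmul K T) \o @tassoc K T T T
      =1 tmap (@tmul K T) id \o (@tassocV K T T T \o tmap id tau \o @tassoc K T T T)
           \o tmap tau id
    & (forall b : T, tau (1 \ox b) = b \ox 1) /\ (forall a : T, tau (a \ox 1) = 1 \ox a)].

Lemma sig_linear : linear sig.
Proof. exact: sigma_lin. Qed.

Lemma sigma_perm_spec : perm_spec sig.
Proof.
split; last split.
- exact: sig_linear.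
- move=> k l; exact: (sigma_gen free scaleAr tnP Psi c k l).
- apply/(perm_mull_iff scaleAr sig_linear) => a a' b.
  exact: (sigma_mull a' b (onL_lin scaleAr sig_linear a) (onLE scaleAr sig_linear a)).
- apply/(perm_mulr_iff scaleAr sig_linear) => a b b'.
  exact: (sigma_mulr a b (onR_lin scaleAr sig_linear b') (onRE scaleAr sig_linear b')).
- move=> b; exact: (sigma_1l free scaleAr tnP Psi c b).
- move=> a; exact: (sigma_1r free scaleAr tnP Psi c a).
Qed.

Lemma perm_spec_unique tau : perm_spec tau -> tau =1 sig.
Proof.
move=> [hl hg hml hmr [h1l h1r]].
apply: tau_sigma => //.
- move=> a; exists (onL tau a); split; [exact: onL_lin|exact: onLE|].
  by move=> a' b; apply: (proj1 (perm_mull_iff scaleAr hl) hml).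
- move=> b'; exists (onR tau b'); split; [exact: onR_lin|exact: onRE|].
  by move=> a b; apply: (proj1 (perm_mulr_iff scaleAr hl) hmr).
Qed.

Variables JA JB : T -> Prop.

Local Notation quot J := (lquot (ideal_gen J)).
Definition qproj (J : T -> Prop) (t : T) : quot J := lproj _ t.
Local Notation ppi := (tmap (qproj JB) (qproj JA)).

Lemma qproj_lin J : linear (qproj J).
Proof. exact: lproj_linear. Qed.

Lemma ppi_lin : linear ppi.
Proof. exact: tmap_lin (qproj_lin JB) (qproj_lin JA). Qed.

Lemma ppiE u v : ppi (u \ox v) = qproj JB u \ox qproj JA v.
Proof. exact: (tmapE (qproj_lin JB) (qproj_lin JA)). Qed.

Lemma qproj0 J t : ideal_gen J t -> qproj J t = 0.
Proof. by move=> h; apply: lproj_span0; apply: lin_span_gen. Qed.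

Lemma lin_diff (U V : lmodType K) (f : U -> V) u v : linear f -> f (u - v) = 0 -> f u = f v.
Proof. by move=> hf h; rewrite -[u](subrK v) (linD hf) h add0r. Qed.

Lemma qproj_repr J (t : quot J) : qproj J (repr t) = t.
Proof. exact: lproj_repr. Qed.

Lemma qproj_kernel (X : lmodType K) J (f : T -> X) u v : linear f ->
  (forall t, ideal_gen J t -> f t = 0) -> qproj J u = qproj J v -> f u = f v.
Proof. by move=> hf h0 /lprojP h; apply: (lin_diff hf); exact: lin_span0 hf h0 h. Qed.

Lemma qproj_repr_lin J z (a a' : quot J) :
  qproj J (repr (z *: a + a')) = qproj J (z *: repr a + repr a').
Proof. by rewrite qproj_repr (qproj_lin J z (repr a) (repr a')) !qproj_repr. Qed.

(** The induced map is defined through representatives; it does not depend on them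
    because the composite of sigma with the projections kills both ideals. *)
Lemma sigma_descends :
  (forall a b, ideal_gen JB b -> ppi (sig (a \ox b)) = 0) ->
  (forall a b, ideal_gen JA a -> ppi (sig (a \ox b)) = 0) ->
  exists sbar : {linear tensor (quot JA) (quot JB) -> tensor (quot JB) (quot JA)},
    sbar \o tmap (qproj JA) (qproj JB) =1 ppi \o sig.
Proof.
move=> hB hA.
pose F (a : quot JA) (b : quot JB) := ppi (sig (repr a \ox repr b)).
have lin_a b : linear (fun a : T => ppi (sig (a \ox b))).
  exact (lin_comp ppi_lin (lin_comp sig_linear (tens_linl b))).
have lin_b a : linear (fun b : T => ppi (sig (a \ox b))).
  exact (lin_comp ppi_lin (lin_comp sig_linear (tens_linr a))).
have kerA a a' b : qproj JA a = qproj JA a' -> ppi (sig (a \ox b)) = ppi (sig (a' \ox b)).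
  by apply: (qproj_kernel (lin_a b)) => t ht; apply: hA.
have kerB a b b' : qproj JB b = qproj JB b' -> ppi (sig (a \ox b)) = ppi (sig (a \ox b')).
  by apply: (qproj_kernel (lin_b a)) => t ht; apply: hB.
have FE a b : F (qproj JA a) (qproj JB b) = ppi (sig (a \ox b)).
  exact: (eq_trans (kerA _ a _ (qproj_repr _)) (kerB _ _ b (qproj_repr _))).
have Fl b : linear (F ^~ b).
  move=> z a a'; apply: (eq_trans (kerA _ _ _ (qproj_repr_lin z a a'))).
  exact: (lin_a (repr b) z (repr a) (repr a')).
have Fr a : linear (F a).
  move=> z b b'; apply: (eq_trans (kerB _ _ _ (qproj_repr_lin z b b'))).
  exact: (lin_b (repr a) z (repr b) (repr b')).
exists (lin_pack (tlift_linear Fl Fr)).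
apply: tens_ext => [||a b].
- exact (lin_comp (tlift_linear Fl Fr) (tmap_lin (qproj_lin JA) (qproj_lin JB))).
- exact (lin_comp ppi_lin sig_linear).
- apply: (eq_trans (congr1 (tlift F) (tmapE (qproj_lin JA) (qproj_lin JB) a b))).
  exact: (eq_trans (tlift_tens Fl Fr _ _) (FE a b)).
Qed.

Variables PA PB : 'M[K]_N -> 'M[K]_N.
Hypotheses (JA_def : JA = qrel gen PA) (JB_def : JB = qrel gen PB).
Hypothesis sliceB_im : forall u l n, exists v, sliceB Psi l n (PB u) = PB v.
Hypothesis linB0 : forall u l i, linB Psi c l (PB u) i = 0.
Hypothesis sliceA_im : forall u m n, exists v, sliceA Psi m n (PA u) = PA v.
Hypothesis linA0 : forall u m j, linA Psi c m (PA u) j = 0.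

Lemma tens0 (U V : lmodType K) (u : U) (v : V) : (0 : U) \ox v = 0 /\ u \ox (0 : V) = 0.
Proof. by split; [exact: (lin0 (tens_linl v))|exact: (lin0 (tens_linr u))]. Qed.

Theorem compatible_of_slices : exists tau, [/\ perm_spec tau,
    forall tau', perm_spec tau' -> tau' =1 tau &
    exists sbar : {linear tensor (quot JA) (quot JB) -> tensor (quot JB) (quot JA)},
      sbar \o tmap (qproj JA) (qproj JB) =1 ppi \o tau].
Proof.
exists sig; split; [exact: sigma_perm_spec|exact: perm_spec_unique|].
apply: sigma_descends => a b h; [rewrite JB_def in h|rewrite JA_def in h].
- apply: (lin_span0 ppi_lin _ (sigma_idealB free scaleAr tnP sliceB_im linB0 a h)).
  move=> _ [x [y [hx ->]]]; rewrite -JB_def in hx; rewrite ppiE (qproj0 hx).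
  exact: (proj1 (tens0 0 _)).
- apply: (lin_span0 ppi_lin _ (sigma_idealA free scaleAr tnP sliceA_im linA0 b h)).
  move=> _ [x [y [hy ->]]]; rewrite -JA_def in hy; rewrite ppiE (qproj0 hy).
  exact: (proj2 (tens0 _ 0)).
Qed.

End GenericCompatibility.

Section TensorAlgebraCompatibility.
Variables (K : fieldType) (N : nat) (Psi : coef4 K N) (c : K).
Variables PA PB : 'M[K]_N -> 'M[K]_N.
Hypothesis sliceB_im : forall u l n, exists v, sliceB Psi l n (PB u) = PB v.
Hypothesis linB0 : forall u l i, linB Psi c l (PB u) i = 0.
Hypothesis sliceA_im : forall u m n, exists v, sliceA Psi m n (PA u) = PA v.
Hypothesis linA0 : forall u m j, linA Psi c m (PA u) j = 0.

Theorem compatible_of_stable : compatible Psi c PA PB.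
Proof.
have [tau [[h1 h2 h3 h4 [h5 h6]] hu hd]] := compatible_of_slices (@Talg_free K N) (@Talg_scaleAr K N)
  (erefl (im2 PA)) (erefl (im2 PB)) sliceB_im linB0 sliceA_im linA0.
exists tau; split.
- split.
  exact h1.
  exact h2.
  3: exact h5.
  3: exact h6.
  exact h3.
  exact h4.
- intros tau' [k1 k2 k3 k4 k5 k6]; exact (hu tau' (And5 k1 k2 k3 k4 (conj k5 k6))).
- exact hd.
Qed.
End TensorAlgebraCompatibility.

(** * Eigenspaces of R and the permutation relation *)
Section Eigen.
Variables (K : fieldType) (N : nat) (R Psi : coef4 K N) (c : K).
Local Notation I := 'I_N.
Hypothesis skew : skew_inverse R Psi.
Hypothesis braid : braided R.

Lemma MopZ (a : K) f : Mop Psi (fun x y => a * f x y) = fun x y => a * Mop Psi f x y.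
Proof.
apply/funext => n; apply/funext => p; rewrite /Mop mulr_sumr; apply: eq_bigr => k _.
by rewrite mulr_sumr; apply: eq_bigr => l _; rewrite mulrCA.
Qed.

(** The slices of u are the components of M2 M1 applied to e_l (x) u. *)
Lemma sliceB_M (u : 'M[K]_N) l n i p :
  sliceB Psi l n u i p = M2 Psi (M1 Psi (fun a k m => (a == l)%:R * u k m)) n i p.
Proof.
rewrite mxE /M2 /M1 /Mop exchange_big; apply: eq_bigr => m _.
rewrite exchange_big; apply: eq_bigr => j _; rewrite mulr_sumr; apply: eq_bigr => k _.
rewrite (_ : \sum_a _ = \sum_a (a == l)%:R * (Psi j k i a * u k m)); last first.
  by apply: eq_bigr => a _; rewrite mulrCA.
by rewrite sum_delta; ring.
Qed.

(** M2 M1 commutes with R, so the slices stay in the eigenspace. The linear part is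
    c tr_2(M2 M1 f) + tr_1(M1 f) with f = e_l (x) u, where tr_k contracts the auxiliary
    index with the k-th vector index. Here tr_1(M1 f) = tr_2(R M2 M1 f) by [Rt_trace],
    which is -c tr_2(M2 M1 f) by the first part. *)
Lemma eigenB u l : op2 R u = - c *: u ->
  (forall n, op2 R (sliceB Psi l n u) = - c *: sliceB Psi l n u)
  /\ (forall i, linB Psi c l u i = 0).
Proof.
move=> Ru; pose f a k m := (a == l)%:R * u k m.
have Rf : Rt R f = fun a k m => - c * f a k m.
  apply/funext => a; apply/funext => k; apply/funext => m; rewrite /Rt /f.
  have /matrixP /(_ k m) := Ru; rewrite !mxE => E.
  rewrite mulrCA -E mulr_sumr; apply: eq_bigr => b _; rewrite mulr_sumr.
  by apply: eq_bigr => d _; rewrite mulrA.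
have MM : Rt R (M2 Psi (M1 Psi f)) = fun a k m => - c * M2 Psi (M1 Psi f) a k m.
  rewrite (Rt_M skew braid) Rf; apply/funext => a; apply/funext => k; apply/funext => m.
  rewrite /M2 (_ : (fun j i => M1 Psi _ j k i) = fun j i => - c * M1 Psi f j k i).
    by rewrite MopZ.
  apply/funext => j; apply/funext => i; rewrite /M1.
  by rewrite (MopZ _ (fun j i0 => f j i0 i)).
split=> [n|i].
  apply/matrixP => k m; rewrite [LHS]mxE [RHS]mxE (sliceB_M u l n k m).
  have := congr1 (fun F => F n k m) MM => <-; rewrite /Rt.
  by apply: eq_bigr => b _; apply: eq_bigr => d _; rewrite sliceB_M.
have E1 : \sum_k Bmat Psi k l * u k i = \sum_p M1 Psi f p p i.
  rewrite /M1 /Mop /Bmat exchange_big; apply: eq_bigr => k _; rewrite mulr_suml.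
  apply: eq_bigr => p _.
  rewrite (_ : \sum_a _ = \sum_a (a == l)%:R * (Psi p k p a * u k i)); last first.
    by apply: eq_bigr => a _; rewrite mulrCA.
  by rewrite sum_delta.
have E2 : \sum_k \sum_m \sum_j u k m * Psi j k i l * Bmat Psi m j =
    \sum_p M2 Psi (M1 Psi f) p i p.
  under [RHS]eq_bigr do rewrite -sliceB_M mxE.
  rewrite -exchange_last4; apply: eq_bigr => k _; apply: eq_bigr => m _; apply: eq_bigr => j _.
  by rewrite /Bmat mulr_sumr.
have E3 : \sum_p Rt R (M2 Psi (M1 Psi f)) p i p = - c * \sum_p M2 Psi (M1 Psi f) p i p.
  by rewrite MM mulr_sumr.
rewrite /linB E1 E2 -(Rt_trace skew (M1 Psi f) i) E3; ring.
Qed.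

Lemma sliceA_N (u : 'M[K]_N) m n p j :
  sliceA Psi m n u p j = N1 Psi (N2 Psi (fun k l b => (b == m)%:R * u k l)) p j n.
Proof.
rewrite mxE /N1 /N2 /Mop [RHS]exchange_big; apply: eq_bigr => k _.
rewrite exchange_big; apply: eq_bigr => i _.
rewrite exchange_big mulr_sumr; apply: eq_bigr => l _.
rewrite (_ : \sum_b _ = \sum_b (b == m)%:R * (Psi j b i l * u k l)); last first.
  by apply: eq_bigr => b _; rewrite mulrCA.
by rewrite sum_delta; ring.
Qed.

Lemma eigenA u m : op2 (dual_coef R) u = - c *: u ->
  (forall n, op2 (dual_coef R) (sliceA Psi m n u) = - c *: sliceA Psi m n u)
  /\ (forall j, linA Psi c m u j = 0).
Proof.
move=> Ru; pose f k l b := (b == m)%:R * u k l.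
have Rf : Rd R f = fun k l b => - c * f k l b.
  apply/funext => i; apply/funext => j; apply/funext => b; rewrite /Rd /f.
  have /matrixP /(_ i j) := Ru; rewrite !mxE => E.
  rewrite mulrCA -E mulr_sumr; apply: eq_bigr => k _; rewrite mulr_sumr.
  by apply: eq_bigr => l _; rewrite mulrA.
have NN : Rd R (N1 Psi (N2 Psi f)) = fun k l b => - c * N1 Psi (N2 Psi f) k l b.
  rewrite (Rd_N skew braid) Rf; apply/funext => k; apply/funext => l; apply/funext => b.
  rewrite /N1 (_ : (fun j i => N2 Psi _ j l i) = fun j i => - c * N2 Psi f j l i).
    by rewrite MopZ.
  apply/funext => j; apply/funext => i; rewrite /N2.
  by rewrite (MopZ _ (fun l b => f j l b)).
split=> [n|j].
  apply/matrixP => p j; rewrite [LHS]mxE [RHS]mxE (sliceA_N u m n p j).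
  have := congr1 (fun F => F p j n) NN => <-; rewrite /Rd.
  by apply: eq_bigr => k _; apply: eq_bigr => l _; rewrite sliceA_N.
have E1 : \sum_l Bmat Psi m l * u j l = \sum_p N2 Psi f j p p.
  rewrite /N2 /Mop /Bmat; under [RHS]eq_bigr do rewrite exchange_big /=.
  rewrite [RHS]exchange_big; apply: eq_bigr => l _; rewrite mulr_suml.
  apply: eq_bigr => p _.
  rewrite (_ : \sum_a _ = \sum_a (a == m)%:R * (Psi p a p l * u j l)); last first.
    by apply: eq_bigr => a _; rewrite mulrCA.
  by rewrite sum_delta.
have E2 : \sum_k \sum_l \sum_i u k l * Psi j m i l * Bmat Psi i k =
    \sum_p N1 Psi (N2 Psi f) p j p.
  under [RHS]eq_bigr do rewrite -sliceA_N mxE.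
  rewrite -exchange_last4; apply: eq_bigr => k _; apply: eq_bigr => l _; apply: eq_bigr => i _.
  by rewrite /Bmat mulr_sumr.
have E3 : \sum_p Rd R (N1 Psi (N2 Psi f)) p j p = - c * \sum_p N1 Psi (N2 Psi f) p j p.
  by rewrite NN mulr_sumr.
rewrite /linA E1 E2 -(Rd_trace skew (N2 Psi f) j) E3; ring.
Qed.

(** From the first form to the second one contracts with Psi and uses [skew]; back,
    one contracts with R and uses [skewC]. *)
Lemma perm_rel_equivP : perm_rel_equiv R Psi c.
Proof.
move=> A x y.
have dl i (a : I -> K) : \sum_j a j *: ((i == j)%:R : A) = (a i)%:A.
  rewrite (bigD1 i) //= eqxx big1 ?addr0 // => j nj.
  by rewrite eq_sym (negPf nj) scaler0.
split=> [h k l|h i j].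
  transitivity (\sum_i \sum_j Psi j k i l *: (\sum_a \sum_b R a i b j *: (y a * x b))).
    under eq_bigr => i _.
      under eq_bigr => j _.
        rewrite scaler_sumr; under eq_bigr => a _.
          rewrite scaler_sumr; under eq_bigr => b _ do rewrite scalerA mulrC.
          over.
        over.
      over.
    rewrite exchange_last4 (bigD1 k) //= [X in _ + X]big1 => [|b nb].
      rewrite exchange_last3 (bigD1 l) //= [X in _ + X + _]big1 => [|a na].
        under eq_bigr => i _ do rewrite -scaler_suml.
        by rewrite -scaler_suml skew !eqxx scale1r !addr0.
      under eq_bigr => i _ do rewrite -scaler_suml.
      by rewrite -scaler_suml skew (negPf na) andbF scale0r.
    rewrite exchange_last3; apply: big1 => a _.
    under eq_bigr => i _ do rewrite -scaler_suml.
    by rewrite -scaler_suml skew (eq_sym k) (negPf nb) scale0r.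
  under eq_bigr => i _.
    under eq_bigr => j _ do rewrite h scalerDr scalerA (mulrC (Psi j k i l)).
    rewrite big_split /= dl; over.
  by rewrite big_split /= /Bmat scaler_suml.
under eq_bigr => a _.
  under eq_bigr => b _.
    rewrite h scalerDr scaler_sumr scalerA; under eq_bigr => p _.
      rewrite scaler_sumr; under eq_bigr => r _ do rewrite scalerA mulrCA (mulrC (R _ _ _ _)) -scalerA.
      over.
    over.
  rewrite big_split /=; over.
rewrite big_split /=; congr (_ + _).
  rewrite exchange_last4 (bigD1 j) //= [X in _ + X]big1 => [|r nr].
    rewrite exchange_last3 (bigD1 i) //= [X in _ + X + _]big1 => [|p np].
      rewrite exchange_big /=; under eq_bigr => b _ do rewrite -scaler_sumr -scaler_suml.
      by rewrite -scaler_sumr -scaler_suml (skewC skew) !eqxx scale1r !addr0.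
    rewrite exchange_big /=; under eq_bigr => b _ do rewrite -scaler_sumr -scaler_suml.
    by rewrite -scaler_sumr -scaler_suml (skewC skew) (negPf np) andbF scale0r scaler0.
  rewrite exchange_last3; apply: big1 => p _.
  rewrite exchange_big /=; under eq_bigr => b _ do rewrite -scaler_sumr -scaler_suml.
  by rewrite -scaler_sumr -scaler_suml (skewC skew) (negPf nr) scale0r scaler0.
transitivity ((\sum_k \sum_b \sum_a Psi k b k a * R a i b j)%:A : A).
  rewrite -exchange_last3 exchange_big /= scaler_suml; apply: eq_bigr => a _.
  rewrite scaler_suml; apply: eq_bigr => b _; congr (_ *: _).
  by rewrite /Bmat mulr_sumr; apply: eq_bigr => k _; rewrite mulrC.
under eq_bigr => k _ do rewrite (skewC skew).
rewrite (bigD1 i) //= big1 => [|k nk]; last by rewrite (negPf nk) andbF.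
by rewrite eqxx andbT addr0 scaler_nat.
Qed.

End Eigen.

(** * The orthosymplectic braiding *)
Section OrthosymplecticBraiding.
Variables (K : fieldType) (N : nat) (q mu e : K) (w : 'I_N -> K).
Local Notation I := 'I_N.
Local Notation rv := (@rev_ord N).
Local Notation lam := (q - q^-1).

(** The coefficient of the flip: q^(delta_ab - delta_ab'). *)
Definition flipc (a b : I) : K :=
  if a == b then (if a == (rv b) then 1 else q) else if a == (rv b) then q^-1 else 1.

(** R on functions of two indices, for the weights w. *)
Definition actR (phi : I -> I -> K) (a b : I) : K :=
  flipc a b * phi b a + lam * (a < b)%:R * phi a b
  - lam * (b == (rv a))%:R * \sum_(i : I) (a < i)%:R * (w i / w a) * phi (rv i) i.

Definition actR12 (phi : I -> I -> I -> K) a b c := actR (fun x y => phi x y c) a b.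
Definition actR23 (phi : I -> I -> I -> K) a b c := actR (phi a) b c.

(** The values of [actR phi] at the pairs (a, a') depend only on those of phi at such
    pairs; this is the coefficient of phi (i', i). *)
Definition conjc (a i : I) : K :=
  flipc a (rv a) * (i == a)%:R + lam * (a < (rv a))%:R * (i == (rv a))%:R
  - lam * (a < i)%:R * (w i / w a).

Hypothesis q0 : q != 0.
Hypothesis w0 : forall i, w i != 0.
Hypothesis wrev : forall i, w i * w (rv i) = e.
Hypothesis e2 : e * e = 1.
(* The relation between the weights and mu on which both relations for R depend. *)
Hypothesis weight_tail : forall b : I,
  lam * \sum_(i : I) (b < i)%:R * w i ^+ 2
    = flipc b (rv b) * w b ^+ 2 - e * (mu - lam * (b < (rv b))%:R).

Lemma actR_conj phi a : actR phi a (rv a) = \sum_i conjc a i * phi (rv i) i.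
Proof.
rewrite /actR eqxx mulr1.
under [RHS]eq_bigr => i _.
  have -> : conjc a i * phi (rv i) i = (i == a)%:R * (flipc a (rv a) * phi (rv i) i)
     + (i == (rv a))%:R * (lam * (a < (rv a))%:R * phi (rv i) i)
     - lam * ((a < i)%:R * (w i / w a) * phi (rv i) i).
    by rewrite /conjc; ring.
  over.
by rewrite /= sumrB big_split /= !sum_delta -mulr_sumr rev_ordK.
Qed.

Lemma actR_nconj phi a b : b != (rv a) ->
  actR phi a b = flipc a b * phi b a + lam * (a < b)%:R * phi a b.
Proof. by move=> /negPf; rewrite /actR => ->; rewrite mulr0 mul0r subr0. Qed.

Lemma flipc_nconj a b : b != (rv a) -> flipc a b = if a == b then q else 1.
Proof.
move=> nab; rewrite /flipc; have -> : (a == (rv b)) = false; last by [].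
by apply: contraNF nab => /eqP ->; rewrite rev_ordK.
Qed.

Lemma flipcC a b : flipc a b = flipc b a.
Proof.
rewrite /flipc (eq_sym b a); have -> // : (b == (rv a)) = (a == (rv b)).
by rewrite -(can_eq (@rev_ordK N) a) rev_ordK eq_sym.
Qed.

Lemma flipc_rev a b : flipc (rv a) (rv b) = flipc a b.
Proof. by rewrite /flipc !(can_eq (@rev_ordK N)). Qed.

Lemma flipc_mul a b : flipc a b * flipc (rv a) b = 1.
Proof.
have h : ((rv a) == b) = (a == (rv b)) by rewrite -(can_eq (@rev_ordK N) (rv a)) rev_ordK.
rewrite /flipc !h (can_eq (@rev_ordK N)).
by case: ifP => _; case: ifP => _; rewrite ?mulr1 // ?mulfV // mulVf.
Qed.

(** Partial sums of the product of the row vector w with the matrix [conjc]. The full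
    sum shows that w is an eigenvector for mu. *)
Definition cup_tail (c j : I) := \sum_(i : I) (c <= i)%:R * (w i * conjc (rv i) j).

Lemma flipc_diag a : flipc a a = (if a == (rv a) then 1 else q).
Proof. by rewrite /flipc eqxx. Qed.

Lemma flipc_conj a : flipc a (rv a) = (if a == (rv a) then 1 else q^-1).
Proof. by rewrite /flipc rev_ordK eqxx; case: eqP. Qed.

Lemma wV i : (w (rv i))^-1 = e * w i.
Proof. by apply: (mulIf (w0 (rv i))); rewrite mulVf // -mulrA wrev e2. Qed.

Lemma cup_tail_expand (c j : I) : cup_tail c j =
  (c <= (rv j))%:R * w (rv j) * flipc j (rv j) + lam * (c <= j)%:R * ((rv j) < j)%:R * w j
  - e * w j * (lam * \sum_(i : I) ((c <= i)%N && ((rv j) < i)%N)%:R * w i ^+ 2).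
Proof.
rewrite /cup_tail.
under eq_bigr => i _.
  have -> : (c <= i)%:R * (w i * conjc (rv i) j) =
     (i == (rv j))%:R * ((c <= i)%:R * w i * flipc i (rv i))
     + (i == j)%:R * (lam * ((rv i) < i)%:R * (c <= i)%:R * w i)
     - e * w j * (lam * (((c <= i)%N && ((rv j) < i)%N)%:R * w i ^+ 2)).
    rewrite /conjc rev_ordK wV (flipcC (rv i) i).
    have -> : (j == (rv i)) = (i == (rv j)) by rewrite -(can_eq (@rev_ordK N) j) rev_ordK eq_sym.
    rewrite (eq_sym j i).
    have -> : ((rv i) < j)%N = ((rv j) < i)%N.
      by rewrite /=; have := ltn_ord i; have := ltn_ord j; lia.
    by case: (c <= i)%N; case: ((rv j) < i)%N => /=; ring.
  over.
rewrite /= sumrB big_split /= !sum_delta rev_ordK -!mulr_sumr.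
by rewrite (flipcC (rv j)); ring.
Qed.

(** In [cup_tail_expand] the index i satisfies both c <= i and j' < i; according to
    which bound is the larger, [weight_tail] applies at c or at j'. *)
Lemma cup_tailE (c j : I) : cup_tail c j =
  mu * w j + ((rv c) < j)%:R * w j *
    (lam * (((rv c) < c)%N && (c <= j)%N)%:R - flipc c c * (w c / w (rv c))).
Proof.
have := ltn_ord c; have := ltn_ord j => hj hc.
rewrite cup_tail_expand.
case: (ltnP (rv c) j) => h.
  have -> : (c <= (rv j))%N = false by move: h => /=; lia.
  have -> : \sum_(i < N) ((c <= i)%N && ((rv j) < i)%N)%:R * w i ^+ 2 =
      \sum_(i : I) (c < i)%:R * w i ^+ 2 + w c ^+ 2.
    rewrite -[X in _ + X](sum_delta c (fun i => w i ^+ 2)) -big_split /=.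
    apply: eq_bigr => i _; rewrite -mulrDl; congr (_ * _).
    have -> : ((c <= i) && (N - j.+1 < i))%N = (c <= i)%N.
      by move: h => /=; lia.
    by rewrite leq_eqVlt -(inj_eq val_inj) eq_sym /=; case: ltngtP => //= _; ring.
  rewrite mulrDr weight_tail (flipc_conj c) flipc_diag wV.
  have [E|nE] := eqVneq c (rv c).
    have Ev : (c : nat) = (N - c.+1)%N := congr1 val E.
    have -> : (c < rv c)%N = false by rewrite /=; lia.
    have -> : (rv c < c <= j)%N = false by rewrite /=; lia.
    have -> : (c <= j)%N by move: h => /=; lia.
    have -> : (rv j < j)%N by move: h => /=; lia.
    have wc : e * w c ^+ 2 = 1 by rewrite expr2 {2}E wrev e2.
    rewrite (_ : e * w j * _ =
      w j * (e * w c ^+ 2 * (1 + lam)) - w j * (e * e) * mu); last by rewrite /=; ring.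
    rewrite (_ : w c * (e * w c) = e * w c ^+ 2); last by ring.
    by rewrite e2 wc /=; ring.
  have nE' : (c : nat) != (rv c : nat) by [].
  have -> : lam * (c <= j)%:R * (rv j < j)%:R = lam * (c <= j)%:R.
    case: (leqP c j) => cj; rewrite ?mulr0 ?mul0r //; have -> : (rv j < j)%N by move: h => /=; lia.
    by rewrite !mulr1.
  have -> : (c < rv c)%N = ~~ (rv c < c)%N by move: nE'; case: ltngtP.
  rewrite (_ : e * w j * _ = w j * (e * w c ^+ 2 * (q^-1 + lam)
     - (e * e) * (mu - lam * (~~ (rv c < c)%N)%:R))); last by ring.
  rewrite e2; case: (leqP c j) => cj; case: (ltnP (rv c) c) => cl; rewrite /=; try by ring.
  by exfalso; move: h cj cl => /=; lia.
have -> : (c <= (rv j))%N by move: h => /=; lia.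
have -> : \sum_(i < N) ((c <= i)%N && ((rv j) < i)%N)%:R * w i ^+ 2 =
      \sum_(i : I) ((rv j) < i)%:R * w i ^+ 2.
  apply: eq_bigr => i _; congr ((_)%:R * _); move: h => /=; lia.
rewrite weight_tail rev_ordK (flipcC (rv j)) -[w (rv j)]invrK wV invfM.
have eV : e^-1 = e by apply: (mulfI (_ : e != 0)); rewrite ?mulfV ?e2 //;
  apply/eqP => h0; move: e2; rewrite h0 mul0r => /eqP; rewrite eq_sym oner_eq0.
rewrite eV; have := w0 j; move: (w j) => y y0.
rewrite (_ : e * y * _ = e * e * (e * y * y^-1 ^+ 2 * flipc j (rv j) - y * (mu - lam * ((rv j) <
  j)%:R))); last by ring.
rewrite e2; have -> : (lam * (c <= j)%:R * ((rv j) < j)%:R) = lam * ((rv j) < j)%:R.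
  case: (ltnP (rv j) j) => h1; rewrite ?mulr0 //; have -> : (c <= j)%N by move: h h1 => /=; lia.
  by rewrite mulr1.
rewrite (_ : e * y * y^-1 ^+ 2 = e * y^-1); last by field.
by rewrite /=; ring.
Qed.

(** Partial sums of the square of the matrix [conjc]. In R_12 R_23 R_12
    the identity term of R_23, restricted to increasing pairs, cuts the sum off. *)
Definition loop_below (c a j : I) := \sum_(i : I) (i < c)%:R * conjc a i * conjc (rv i) j.

Lemma cup_tailS (c j : I) : \sum_(i : I) (c < i)%:R * (w i * conjc (rv i) j) =
  cup_tail c j - w c * conjc (rv c) j.
Proof.
rewrite /cup_tail -[X in _ - X](sum_delta c (fun i => w i * conjc (rv i) j)) -sumrB.
apply: eq_bigr => i _; rewrite -mulrBl; congr (_ * _).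
by rewrite (leq_eqVlt c) -(inj_eq val_inj) eq_sym /=; case: ltngtP => //= _; ring.
Qed.

Lemma loop_belowE (c a j : I) : loop_below c a j = (a < c)%:R *
  ((flipc a (rv a) + lam) * conjc (rv a) j + lam * (a < rv a < c)%:R * conjc a j
   - lam / w a * (cup_tail a j - cup_tail c j)).
Proof.
have -> : (a < c)%:R * ((flipc a (rv a) + lam) * conjc (rv a) j +
    lam * (a < rv a < c)%:R * conjc a j - lam / w a * (cup_tail a j - cup_tail c j)) =
  (a < c)%:R * (flipc a (rv a) * conjc (rv a) j + lam * (a < rv a < c)%:R * conjc a j
   - lam / w a * ((cup_tail a j - w a * conjc (rv a) j) - cup_tail c j)).
  by field; rewrite ?w0 ?q0.
rewrite -cup_tailS /cup_tail /loop_below -sumrB.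
under eq_bigr => i _.
  have -> : (i < c)%:R * conjc a i * conjc (rv i) j =
     (i == a)%:R * ((a < c)%:R * flipc a (rv a) * conjc (rv i) j)
     + (i == rv a)%:R * ((a < c)%:R * (lam * (a < rv a < c)%:R * conjc (rv i) j))
     - (a < c)%:R * (lam / w a * ((a < i)%:R * (w i * conjc (rv i) j)
           - (c <= i)%:R * (w i * conjc (rv i) j))).
    rewrite {1}/conjc.
    case: (ltnP i c) => ic; case: (ltnP a c) => ac; last by rewrite /=; ring.
    - have [E|nE] := eqVneq i (rv a); last by rewrite /=; ring.
      by rewrite -E ic andbT /=; ring.
    - have -> : (i == a) = false by rewrite -val_eqE /=; lia.
      have -> : (a < i)%N = false by lia.
      have [E|nE] := eqVneq i (rv a); last by rewrite /=; ring.
      have -> : (a < rv a)%N = false by rewrite -E; lia.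
      by rewrite /=; ring.
    - have -> : (i == a) = false by rewrite -val_eqE /=; lia.
      have -> : (a < i)%N by lia.
      have [E|nE] := eqVneq i (rv a); last by rewrite /=; ring.
      by rewrite -E [(i < c)%N]ltnNge ic andbF /=; ring.
  over.
rewrite /= sumrB big_split /= !sum_delta rev_ordK -!mulr_sumr.
by rewrite /=; ring.
Qed.

Lemma loop_total (a j : I) : \sum_(i : I) conjc a i * conjc (rv i) j =
  (flipc a (rv a) + lam) * conjc (rv a) j + lam * (a < rv a)%:R * conjc a j
   - lam / w a * cup_tail a j.
Proof.
have -> : lam / w a * cup_tail a j = lam / w a * (cup_tail a j - w a * conjc (rv a) j) + lam *
  conjc (rv a) j.
  by field; rewrite ?w0 ?q0.
rewrite -cup_tailS.
under eq_bigr => i _.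
  have -> : conjc a i * conjc (rv i) j =
     (i == a)%:R * (flipc a (rv a) * conjc (rv i) j)
     + (i == rv a)%:R * (lam * (a < rv a)%:R * conjc (rv i) j)
     - (lam / w a * ((a < i)%:R * (w i * conjc (rv i) j))).
    by rewrite {1}/conjc; ring.
  over.
rewrite /= sumrB big_split /= !sum_delta rev_ordK -!mulr_sumr.
by ring.
Qed.

(** At (a, a', c) both sides of the braid relation are combinations of the values of
    phi at the triples (c, i', i), (i', c, i) and (i', i, c); this expansion and
    [braid_conj12_right] display the coefficients. *)
Lemma braid_conj12_left (phi : I -> I -> I -> K) a c :
  actR12 (actR23 (actR12 phi)) a (rv a) c = \sum_(i : I) (
    conjc a i * phi c (rv i) i
    + lam * ((rv c < i)%:R * (conjc a i * flipc i c - conjc a (rv c) * (w i / w (rv c)) * flipc c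
      (rv i))) * phi (rv i) c i
    + lam * (- conjc a c * flipc c c * (rv c < i)%:R * (w i / w (rv c)) + loop_below c a i
       + lam * conjc a (rv c) * (rv c < c)%:R * (w c / w (rv c)) * (c < i)%:R * (w i / w c))
      * phi (rv i) i c).
Proof.
rewrite {1}/actR12 actR_conj.
have psi1 i : actR12 phi (rv i) i c = \sum_(j : I) conjc (rv i) j * phi (rv j) j c.
  by rewrite /actR12 -{2}(rev_ordK i) actR_conj.
under eq_bigr => i _.
  have -> : conjc a i * actR23 (actR12 phi) (rv i) i c =
     conjc a i * phi c (rv i) i
     + lam * (rv i < c)%:R * conjc a i * flipc i c * phi (rv i) c i
     + (i == c)%:R * (- lam * conjc a c * flipc c c *
          \sum_(j : I) (rv c < j)%:R * (w j / w (rv c)) * phi (rv j) j c)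
     + lam * \sum_(j : I) (i < c)%:R * conjc a i * conjc (rv i) j * phi (rv j) j c
     + (i == rv c)%:R * (- lam * conjc a (rv c) *
          \sum_(k : I) (rv c < k)%:R * (w k / w (rv c)) * actR12 phi c (rv k) k).
    rewrite /actR23 {1}/actR psi1.
    rewrite {1}/actR12 {1}/actR rev_ordK.
    have -> : (c == rv i) = (i == rv c).
      by rewrite -(can_eq (@rev_ordK N) c) rev_ordK eq_sym.
    have -> : \sum_(j : I) (i < c)%:R * conjc a i * conjc (rv i) j * phi (rv j) j c
      = (i < c)%:R * conjc a i * \sum_(j : I) conjc (rv i) j * phi (rv j) j c.
      by rewrite mulr_sumr; apply: eq_bigr => j _; rewrite !mulrA.
    have h1 := flipc_mul i c.
    have [E|nic] := eqVneq i c; have [E'|nic'] := eqVneq i (rv c).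
    - subst i; rewrite -!E' in h1 *; rewrite /=; ring: h1.
    - subst i; rewrite /=; ring: h1.
    - subst i; rewrite ?rev_ordK in h1 *; rewrite /=; ring: h1.
    - rewrite /=; ring: h1.
  over.
rewrite !big_split /= !sum_delta.
have expl k : actR12 phi c (rv k) k = flipc c (rv k) * phi (rv k) c k
    + lam * (c < rv k)%:R * phi c (rv k) k
    - lam * (k == c)%:R * \sum_(p : I) (c < p)%:R * (w p / w c) * phi (rv p) p k.
  by rewrite /actR12 /actR (can_eq (@rev_ordK N)).
have -> : \sum_(k : I) (rv c < k)%:R * (w k / w (rv c)) * actR12 phi c (rv k) k =
   \sum_(k : I) ((rv c < k)%:R * (w k / w (rv c)) * flipc c (rv k) * phi (rv k) c k)
   - lam * (rv c < c)%:R * (w c / w (rv c)) *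
     \sum_(p : I) (c < p)%:R * (w p / w c) * phi (rv p) p c.
  set S := fun k => \sum_(p : I) (c < p)%:R * (w p / w c) * phi (rv p) p k.
  rewrite -(sum_delta c (fun k => lam * (rv c < k)%:R * (w k / w (rv c)) * S k)) -sumrB.
  apply: eq_bigr => k _; rewrite expl -/(S k).
  case: (ltnP (rv c) k) => h /=; last by ring.
  have -> : (c < N - k.+1)%N = false by move: h => /=; lia.
  by rewrite /=; ring.
have -> : \sum_(i < N) lam * (\sum_(j < N) (i < c)%:R * conjc a i * conjc (rv i) j * phi (rv j) j c)
   = \sum_(j < N) lam * (loop_below c a j) * phi (rv j) j c.
  rewrite -mulr_sumr exchange_big /= mulr_sumr; apply: eq_bigr => j _.
  by rewrite -mulr_suml mulrA.
rewrite [- lam * conjc a (rv c) * (_ - _)]mulrBr !mulr_sumr addrA -!big_split /= -sumrB.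
apply: eq_bigr => i _.
have -> : (N - i.+1 < c)%N = (N - c.+1 < i)%N by have := ltn_ord i; have := ltn_ord c; lia.
by ring.
Qed.

Lemma eq_rev_ordC (a b : I) : (a == rv b) = (b == rv a).
Proof. by rewrite -(can_eq (@rev_ordK N) a) rev_ordK eq_sym. Qed.

(** The matrix [conjc] is upper triangular. *)
Lemma conjc_lt (a j : I) : (j < a)%N -> conjc a j = 0.
Proof.
move=> h; rewrite /conjc; have -> : (a < j)%N = false by rewrite ltnNge ltnW.
have -> : (j == a) = false by apply: contraTF h => /eqP ->; rewrite ltnn.
have [E|_] := eqVneq j (rv a); last by rewrite /=; ring.
have -> : (a < rv a)%N = false by move: h; rewrite E /=; lia.
by rewrite /=; ring.
Qed.

Lemma conjc_before (a c : I) : (rv a < c)%N -> conjc a (rv c) = 0.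
Proof.
move=> h; apply: conjc_lt; have := ltn_ord a; have := ltn_ord c.
by move: h => /=; lia.
Qed.

Lemma braid_conj12_right (phi : I -> I -> I -> K) a c :
  actR23 (actR12 (actR23 phi)) a (rv a) c = \sum_(i : I) (
    conjc a i * phi c (rv i) i
    + lam * (flipc (rv a) c * lam * (a < c < rv a)%:R * (i == rv a)%:R
        - (c == rv a)%:R * flipc (rv a) c * (a < i)%:R * (w i / w a) * flipc i c
        + (rv a < c)%:R * conjc a i * flipc i c
        - lam * (c == a)%:R * (rv a < i)%:R * (w i / w (rv a)) * flipc a (rv i) * (a < i)%:R
        + lam * (c == a)%:R * (rv a < a)%:R * (w a / w (rv a)) * (a < i)%:R * (w i / w a) * flipc i a)
      * phi (rv i) c i
    + lam * (flipc (rv a) c * flipc c (rv a) * (a < c)%:R * (i == rv a)%:R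
        - lam * (c == rv a)%:R * flipc (rv a) c * (a < i)%:R * (i < c)%:R * (w i / w a)
        + lam * (rv a < c)%:R * (i < c)%:R * conjc a i
        - (c == a)%:R * (rv a < i)%:R * (w i / w (rv a)) * flipc a (rv i) * flipc a i)
      * phi (rv i) i c).
Proof.
set psi := actR23 phi.
have psi1 x : psi x a (rv a) = \sum_(i : I) conjc a i * phi x (rv i) i.
  by rewrite /psi /actR23 actR_conj.
rewrite /actR23 {1}/actR.
have -> : actR12 psi a c (rv a) = flipc a c * (\sum_(i : I) conjc a i * phi c (rv i) i)
    + lam * (a < c)%:R * (flipc c (rv a) * phi a (rv a) c + lam * (c < rv a)%:R * phi a c (rv a))
    - lam * (c == rv a)%:R * \sum_(j : I) (a < j)%:R * (w j / w a) *
        (flipc j c * phi (rv j) c j + lam * (j < c)%:R * phi (rv j) j c).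
  rewrite /actR12 /actR psi1; congr (_ + _ - _).
    case: (ltnP a c) => h; last by rewrite !mulr0 !mul0r.
    have nac : (rv a != rv c) by rewrite (can_eq (@rev_ordK N)) -val_eqE /=; lia.
    by rewrite /psi /actR23 actR_nconj // mulr1.
  have [->|_] := eqVneq c (rv a); last by rewrite mulr0 !mul0r.
  congr (_ * _); apply: eq_bigr => j _.
  case: (ltnP a j) => h; last by rewrite !mul0r.
  have nac : (rv a != rv j) by rewrite (can_eq (@rev_ordK N)) -val_eqE /=; lia.
  by rewrite /psi /actR23 actR_nconj.
have -> : lam * (rv a < c)%:R * actR12 psi a (rv a) c =
   lam * (rv a < c)%:R * \sum_(i : I) conjc a i * (flipc i c * phi (rv i) c i + lam * (i < c)%:R *
     phi (rv i) i c).
  rewrite /actR12 actR_conj; case: (ltnP (rv a) c) => h; last by rewrite !mulr0 !mul0r.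
  congr (_ * _); apply: eq_bigr => i _.
  have [E|nE] := eqVneq c (rv i); last by rewrite /psi /actR23 actR_nconj.
  by rewrite -[ i ]rev_ordK -E conjc_before // !mul0r.
rewrite rev_ordK.
have h1 := flipc_mul a c.
have -> : lam * (c == a)%:R * (\sum_(j : I) (rv a < j)%:R * (w j / w (rv a)) * actR12 psi a (rv j) j) =
   lam * (c == a)%:R * (\sum_(j : I) (rv a < j)%:R * (w j / w (rv a)) *
      (flipc a (rv j) * (flipc a j * phi (rv j) j c + lam * (a < j)%:R * phi (rv j) c j))
   - lam * (rv a < a)%:R * (w a / w (rv a)) * \sum_(p : I) (a < p)%:R * (w p / w a) * flipc p a *
     phi (rv p) c p).
  have [->|_] := eqVneq c a; last by rewrite !mulr0 !mul0r.
  congr (_ * _).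
  set S := \sum_(p : I) (a < p)%:R * (w p / w a) * flipc p a * phi (rv p) a p.
  rewrite -(sum_delta a (fun k => lam * (rv a < k)%:R * (w k / w (rv a)) * S)) -sumrB.
  apply: eq_bigr => j _.
  have hj := ltn_ord j; have ha := ltn_ord a.
  case: (ltnP (rv a) j) => h; last by rewrite !mulr0 !mul0r ?mulr0 subrr.
  rewrite /actR12 /actR.
  have -> : (a < rv j)%N = false by move: h => /=; lia.
  have -> : psi (rv j) a j = flipc a j * phi (rv j) j a + lam * (a < j)%:R * phi (rv j) a j.
    have nja : j != rv a by rewrite -val_eqE /=; move: h => /=; lia.
    by rewrite /psi /actR23 actR_nconj.
  rewrite (can_eq (@rev_ordK N)).
  have [Eja|_] := eqVneq j a; last by rewrite /=; ring.
  rewrite Eja.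
  have -> : \sum_(i : I) (a < i)%:R * (w i / w a) * psi (rv i) i a = S.
    apply: eq_bigr => p _; case: (ltnP a p) => hp; last by rewrite !mul0r.
    have hpN := ltn_ord p; move: h; rewrite Eja => h.
    have npa : a != rv p by rewrite -val_eqE /=; move: h => /=; lia.
    rewrite /psi /actR23 actR_nconj //; have -> : (p < a)%N = false by lia.
    by rewrite mulr0 mul0r addr0 mulrA.
  by rewrite /=; ring.
have f1 : phi a (rv a) c = \sum_(i : I) (i == rv a)%:R * phi (rv i) i c.
  by rewrite sum_delta rev_ordK.
have f2 : phi a c (rv a) = \sum_(i : I) (i == rv a)%:R * phi (rv i) c i.
  by rewrite sum_delta rev_ordK.
rewrite f1 f2.
under [RHS]eq_bigr => i _.
  rewrite (_ : _ + _ + _ = conjc a i * phi c (rv i) i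
     + lam * (a < c)%:R * flipc (rv a) c * flipc c (rv a) * ((i == rv a)%:R * phi (rv i) i c)
     + lam * (a < c)%:R * lam * (c < rv a)%:R * flipc (rv a) c * ((i == rv a)%:R * phi (rv i) c i)
     - lam * (c == rv a)%:R * flipc (rv a) c * ((a < i)%:R * (w i / w a) *
         (flipc i c * phi (rv i) c i + lam * (i < c)%:R * phi (rv i) i c))
     + lam * (rv a < c)%:R * (conjc a i * (flipc i c * phi (rv i) c i + lam * (i < c)%:R * phi (rv
       i) i c))
     - lam * (c == a)%:R * ((rv a < i)%:R * (w i / w (rv a)) *
         (flipc a (rv i) * (flipc a i * phi (rv i) i c + lam * (a < i)%:R * phi (rv i) c i)))
     + lam * (c == a)%:R * lam * (rv a < a)%:R * (w a / w (rv a)) *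
        ((a < i)%:R * (w i / w a) * flipc i a * phi (rv i) c i)); last first.
    by case: (ltnP a c) => h2; case: (ltnP c (rv a)) => h3; rewrite /=; ring.
  over.
rewrite !big_split /= !sumrN -!mulr_sumr; ring: h1.
Qed.

Lemma conjc_diag a : conjc a a = flipc a (rv a).
Proof.
rewrite /conjc eqxx ltnn; have [E|_] := eqVneq a (rv a); last by rewrite /=; ring.
by rewrite -E ltnn /=; ring.
Qed.

Lemma conjc_gt (a j : I) : (a < j)%N -> conjc a j = lam * ((j == rv a)%:R - w j / w a).
Proof.
move=> h; rewrite /conjc h.
have -> : (j == a) = false by apply: contraTF h => /eqP ->; rewrite ltnn.
have [<-|_] := eqVneq j (rv a); last by rewrite /=; ring.
by rewrite h /=; ring.
Qed.

Lemma flipc1 a b : a != b -> a != rv b -> flipc a b = 1.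
Proof. by rewrite /flipc => /negPf -> /negPf ->. Qed.

Lemma ord_neq (a b : I) : (a : nat) <> b -> (a == b) = false.
Proof. by move=> h; apply/eqP => E; apply: h; rewrite E. Qed.

Lemma flipc_neq (a b : I) : (a : nat) <> b -> (a + b)%N <> N.-1 -> flipc a b = 1.
Proof.
move=> h h'; rewrite flipc1 // ord_neq //= => E; apply: h'.
by have := ltn_ord b; rewrite E; lia.
Qed.

Lemma rev_ord_val (a : I) : (rv a + a = N.-1)%N /\ (a < N)%N.
Proof. by have := ltn_ord a; rewrite /=; lia. Qed.

Ltac ordlia := clear q0 w0 wrev e2 weight_tail; repeat match goal with
  | H : is_true (negb (eq_op _ _)) |- _ => clear H
  | H : _ = _ -> _ = _ |- _ => clear H
  end; lia.

(** Evaluates the order tests and the coefficients [conjc] and [flipc] that the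
    hypotheses on the positions of the indices decide. *)
Ltac decide_test := match goal with
 | |- context[leq ?x ?y] => have -> : leq x y = true by ordlia
 | |- context[leq ?x ?y] => have -> : leq x y = false by ordlia
 | |- context[leq ?x ?y && leq ?z ?t] => have -> : (leq x y && leq z t) = true by ordlia
 | |- context[leq ?x ?y && leq ?z ?t] => have -> : (leq x y && leq z t) = false by ordlia
 | |- context[?x == ?y] => first [have -> : (x == y) = false by apply: ord_neq; ordlia | rewrite eqxx]
 | |- context[conjc ?x ?x] => rewrite (conjc_diag x)
 | |- context[conjc ?x ?y] => have -> := @conjc_lt x y ltac:(ordlia)
 | |- context[conjc ?x ?y] => have -> := @conjc_gt x y ltac:(ordlia)
 | |- context[flipc ?x ?y] => have -> := @flipc_neq x y ltac:(ordlia) ltac:(ordlia)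
 end.
Ltac subst_index j := repeat match goal with
  | H : nat_of_ord j = nat_of_ord ?b |- _ => have {}H := val_inj H; subst j
  end.

Lemma flipc_conjC a : flipc (rv a) a = (if a == rv a then 1 else q^-1).
Proof. by rewrite flipcC flipc_conj. Qed.

Lemma natr_true : true%:R = 1 :> K. Proof. by []. Qed.
Lemma natr_false : false%:R = 0 :> K. Proof. by []. Qed.
Ltac decide_tests := repeat first
  [ rewrite rev_ordK | rewrite andTb | rewrite andFb | rewrite andbT | rewrite andbF
  | rewrite natr_true | rewrite natr_false
  | rewrite flipc_diag | rewrite flipc_conj | rewrite flipc_conjC | decide_test ].

Ltac field_w := field; rewrite ?q0 ?w0 //.

(** R^2 = 1 + lam R - lam mu K on the pairs (a, a'), where K is the rank one operator
    with entries w_j / w_a. *)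
Lemma conjc_loop (a j : I) : \sum_(i : I) conjc a i * conjc (rv i) j =
  (j == rv a)%:R + lam * conjc a j - lam * mu * (w j / w a).
Proof.
have Ea := rev_ord_val a; have Ej := rev_ord_val j.
rewrite loop_total cup_tailE; have wa := w0 a; have wa' := w0 (rv a).
case: (ltngtP j (rv a)) => [h|h|/val_inj E].
- case: (ltnP a (rv a)) => h2; decide_tests; field_w.
- case: (ltngtP a (rv a)) => [h2|h2|h2].
  + decide_tests; field_w.
  + case: (ltngtP a j) => [h3|h3|/val_inj h3]; [| |subst j]; decide_tests; field_w.
  + have h3 : (a < j)%N by lia.
    rewrite -!(val_inj h2); decide_tests; rewrite -!(val_inj h2); decide_tests; field_w.
- subst j; case: (ltngtP a (rv a)) => [h2|h2|h2].
  + decide_tests; field_w.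
  + decide_tests; field_w.
  + rewrite -!(val_inj h2); decide_tests; rewrite -?(val_inj h2); decide_tests; field_w.
Qed.

Lemma loop_below_after (a c j : I) : (a < c)%N -> (rv a < c)%N ->
  loop_below c a j = (j == rv a)%:R + lam * conjc a j - lam * mu * (w j / w a)
    + lam / w a * cup_tail c j.
Proof.
move=> h h'; rewrite loop_belowE h h' andbT -conjc_loop loop_total mul1r; ring.
Qed.

(** The coefficients of x and y need not agree separately when j = c, as (j', c, j)
    and (j', j, c) are then the same triple. The proof goes through the possible
    positions of j with respect to a, c and their conjugates; in each of them the
    identity is one of rational functions. *)
Lemma braid_conj12_coef (a c j : I) (x y : K) : (j = c -> x = y) ->
  lam * ((rv c < j)%:R * (conjc a j * flipc j c - conjc a (rv c) * (w j / w (rv c)) * flipc c (rv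
    j))) * x
    + lam * (- conjc a c * flipc c c * (rv c < j)%:R * (w j / w (rv c)) + loop_below c a j
       + lam * conjc a (rv c) * (rv c < c)%:R * (w c / w (rv c)) * (c < j)%:R * (w j / w c)) * y
  = lam * (flipc (rv a) c * lam * (a < c < rv a)%:R * (j == rv a)%:R
        - (c == rv a)%:R * flipc (rv a) c * (a < j)%:R * (w j / w a) * flipc j c
        + (rv a < c)%:R * conjc a j * flipc j c
        - lam * (c == a)%:R * (rv a < j)%:R * (w j / w (rv a)) * flipc a (rv j) * (a < j)%:R
        + lam * (c == a)%:R * (rv a < a)%:R * (w a / w (rv a)) * (a < j)%:R * (w j / w a) * flipc j
          a) * x
    + lam * (flipc (rv a) c * flipc c (rv a) * (a < c)%:R * (j == rv a)%:R
        - lam * (c == rv a)%:R * flipc (rv a) c * (a < j)%:R * (j < c)%:R * (w j / w a)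
        + lam * (rv a < c)%:R * (j < c)%:R * conjc a j
        - (c == a)%:R * (rv a < j)%:R * (w j / w (rv a)) * flipc a (rv j) * flipc a j) * y.
Proof.
move=> xy.
have Ea := rev_ord_val a; have Ej := rev_ord_val j; have Ec := rev_ord_val c.
have wa := w0 a; have wa' := w0 (rv a); have wc := w0 c; have wc' := w0 (rv c).
case: (ltngtP (rv a) c) => [hA|hC|hB].
- case: (ltngtP a c) => [h|h|/val_inj h].
  + rewrite loop_below_after // cup_tailE.
    case: (ltngtP j c) => [h2|h2|/val_inj h2]; last 1 first.
      subst j; rewrite xy //; decide_tests; field_w.
      case: (ltngtP j (rv c)) => [h3|h3|/val_inj h3]; [| |subst j]; decide_tests; field_w.
    decide_tests; field_w.
  + rewrite loop_belowE; case: (ltnP (rv c) j) => h2; case: (ltnP j c) => h3; decide_tests; field_w.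
  + subst c; rewrite loop_belowE.
    case: (ltngtP j a) => [h2|h2|/val_inj h2]; [|decide_tests; field_w|subst j; decide_tests; field_w].
    by case: (ltngtP j (rv a)) => [h3|h3|/val_inj h3]; [| |subst j]; decide_tests; field_w.
- case: (ltngtP a c) => [h|h|/val_inj h].
  + rewrite loop_belowE !cup_tailE.
    case: (ltngtP c (rv c)) => [k|k|k]; last 1 first.
      rewrite -!(val_inj k); case: (ltngtP j (rv a)) => h2; case: (ltngtP j c) => h3;
      try (exfalso; ordlia); subst_index j; try rewrite (xy (erefl _)); rewrite -?(val_inj k);
        decide_tests; rewrite -?(val_inj k); field_w.
    + case: (ltngtP j (rv a)) => h2; case: (ltngtP j c) => h3; case: (ltngtP j (rv c)) => h4;
      try (exfalso; ordlia); subst_index j; try rewrite (xy (erefl _)); decide_tests; field_w.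
    + case: (ltngtP j (rv a)) => h2; case: (ltngtP j c) => h3; case: (ltngtP j (rv c)) => h4;
      try (exfalso; ordlia); subst_index j; try rewrite (xy (erefl _)); decide_tests; field_w.
  + rewrite loop_belowE; case: (ltnP (rv c) j) => h2; decide_tests; field_w.
  + subst c; rewrite loop_belowE; case: (ltnP (rv a) j) => h2; decide_tests; field_w.
- have {}hB := val_inj hB; subst c; rewrite loop_belowE !cup_tailE !rev_ordK.
  case: (ltngtP a (rv a)) => [h|h|h]; last 1 first.
  + rewrite -!(val_inj h); case: (ltngtP j a) => h2; subst_index j; decide_tests;
    rewrite -?(val_inj h); decide_tests; field_w.
  + case: (ltngtP j a) => h2; case: (ltngtP j (rv a)) => h3;
    try (exfalso; ordlia); subst_index j; try rewrite (xy (erefl _)); decide_tests; field_w.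
  + case: (ltngtP j a) => h2; case: (ltngtP j (rv a)) => h3;
    try (exfalso; ordlia); subst_index j; try rewrite (xy (erefl _)); decide_tests; field_w.
Qed.

Lemma braid_conj12 phi a c :
  actR12 (actR23 (actR12 phi)) a (rv a) c = actR23 (actR12 (actR23 phi)) a (rv a) c.
Proof.
rewrite braid_conj12_left braid_conj12_right; apply: eq_bigr => i _;
  rewrite -[LHS]addrA -[RHS]addrA; congr (_ + _).
by apply: braid_conj12_coef => ->.
Qed.

(** Reversing the order of the indices and conjugating them exchanges the two copies of
    R, hence the two sides of the braid relation. *)
Definition flip3 (phi : I -> I -> I -> K) a b c := phi (rv c) (rv b) (rv a).

Lemma flip3K phi : flip3 (flip3 phi) = phi.
Proof. by apply/funext=> a; apply/funext=> b; apply/funext=> c; rewrite /flip3 !rev_ordK. Qed.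

Lemma actR12_flip phi : actR12 (flip3 phi) = flip3 (actR23 phi).
Proof.
apply/funext=> a; apply/funext=> b; apply/funext=> c.
rewrite /flip3 /actR12 /actR23 /actR flipc_rev (flipcC b) rev_ordK (eq_sym (rv a)).
have Ea := rev_ord_val a; have Eb := rev_ord_val b.
have -> : (rv b < rv a)%N = (a < b)%N by lia.
have [->|_] := eqVneq b (rv a); last by rewrite !mulr0 !mul0r.
by rewrite rev_ordK; congr (_ - _ * _); apply: eq_bigr => i _; rewrite rev_ordK.
Qed.

Lemma actR23_flip phi : actR23 (flip3 phi) = flip3 (actR12 phi).
Proof. by rewrite -[phi in RHS]flip3K actR12_flip flip3K. Qed.

Lemma braid_conj23 phi a b :
  actR12 (actR23 (actR12 phi)) a b (rv b) = actR23 (actR12 (actR23 phi)) a b (rv b).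
Proof.
rewrite -[phi]flip3K; move: (flip3 phi) => psi.
by rewrite !(actR12_flip, actR23_flip) /flip3 rev_ordK braid_conj12.
Qed.

Lemma braid_conj13_left phi a c : c != a -> c != rv a ->
  actR12 (actR23 (actR12 phi)) a c (rv a) = \sum_(i : I) (
   (conjc a i * flipc c (rv i) + lam * lam * lam * (a < c < rv a)%:R * (i == rv a)%:R) * phi (rv i) c i
   + (lam * (a < c)%:R * conjc a i - lam * conjc a c * (c < i)%:R * (w i / w c)) * phi (rv i) i c
   + (lam * (i < rv c)%:R * conjc a i + lam * lam * (a < c < rv a)%:R * (i == rv a)%:R) * phi c (rv
     i) i).
Proof.
move=> nca nca'.
rewrite {1}/actR12 actR_nconj // flipc_nconj // eq_sym (negPf nca) mul1r.
have -> : actR23 (actR12 phi) c a (rv a) =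
  \sum_(i : I) conjc a i * (flipc c (rv i) * phi (rv i) c i + lam * (c < rv i)%:R * phi c (rv i) i)
  - lam * conjc a c * \sum_(p : I) (c < p)%:R * (w p / w c) * phi (rv p) p c.
  rewrite /actR23 actR_conj.
  set S := fun k => \sum_(p : I) (c < p)%:R * (w p / w c) * phi (rv p) p k.
  rewrite -(sum_delta c (fun k => lam * conjc a k * S k)) -sumrB.
  apply: eq_bigr => i _; rewrite /actR12 /actR (can_eq (@rev_ordK N)) -/(S i).
  by ring.
have -> : actR23 (actR12 phi) a c (rv a) = \sum_(i : I) conjc a i * phi (rv i) i c
  + lam * (c < rv a)%:R * (phi c a (rv a) + lam * (a < c)%:R * phi a c (rv a)).
  rewrite /actR23 actR_nconj; last by rewrite (can_eq (@rev_ordK N)) eq_sym.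
  rewrite flipc_nconj; last by rewrite (can_eq (@rev_ordK N)) eq_sym.
  rewrite (negPf nca') mul1r {1}/actR12 actR_conj; congr (_ + _ * _).
  by rewrite /actR12 actR_nconj // flipc_nconj // eq_sym (negPf nca) mul1r.
have f1 : phi c a (rv a) = \sum_(i : I) (i == rv a)%:R * phi c (rv i) i.
  by rewrite sum_delta rev_ordK.
have f2 : phi a c (rv a) = \sum_(i : I) (i == rv a)%:R * phi (rv i) c i.
  by rewrite sum_delta rev_ordK.
rewrite f1 f2.
under [RHS]eq_bigr => i _.
  rewrite (_ : _ + _ + _ =
     conjc a i * (flipc c (rv i) * phi (rv i) c i + lam * (c < rv i)%:R * phi c (rv i) i)
   - lam * conjc a c * ((c < i)%:R * (w i / w c) * phi (rv i) i c)
   + lam * (a < c)%:R * (conjc a i * phi (rv i) i c)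
   + lam * lam * (a < c)%:R * (c < rv a)%:R * ((i == rv a)%:R * phi c (rv i) i)
   + lam * lam * lam * (a < c)%:R * (c < rv a)%:R * ((i == rv a)%:R * phi (rv i) c i)); last first.
    have -> : (i < rv c)%N = (c < rv i)%N by have := rev_ord_val i; have := rev_ord_val c; lia.
    by case: (ltnP a c) => h2; case: (ltnP c (rv a)) => h3; rewrite ?natr_true ?natr_false; ring.
  over.
rewrite !big_split /= !sumrN -!mulr_sumr.
case: (ltnP a c) => h2; rewrite ?natr_true ?natr_false; ring.
Qed.

(** As in [braid_conj12_coef], the triples can coincide: the first and the second for
    j = c, the first and the third for j = c'. *)
Lemma braid_conj13_coef (a c j : I) (x y z : K) : c != a -> c != rv a ->
  (j = c -> x = y) -> (j = rv c -> x = z) ->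
   (conjc a j * flipc c (rv j) + lam * lam * lam * (a < c < rv a)%:R * (j == rv a)%:R) * x
   + (lam * (a < c)%:R * conjc a j - lam * conjc a c * (c < j)%:R * (w j / w c)) * y
   + (lam * (j < rv c)%:R * conjc a j + lam * lam * (a < c < rv a)%:R * (j == rv a)%:R) * z
  = (conjc a j * flipc (rv c) (rv j) + lam * lam * lam * (a < rv c < rv a)%:R * (j == rv a)%:R) * x
   + (lam * (a < rv c)%:R * conjc a j - lam * conjc a (rv c) * (rv c < j)%:R * (w j / w (rv c))) * z
   + (lam * (j < c)%:R * conjc a j + lam * lam * (a < rv c < rv a)%:R * (j == rv a)%:R) * y.
Proof.
move=> nca nca' xy xz.
have Ea := rev_ord_val a; have Ej := rev_ord_val j; have Ec := rev_ord_val c.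
have wa := w0 a; have wc := w0 c; have wc' := w0 (rv c).
have n1 : (c : nat) <> a by move=> /val_inj E; rewrite E eqxx in nca.
have n2 : (c : nat) <> rv a by move=> /val_inj E; rewrite E eqxx in nca'.
case: (ltngtP c (rv c)) => [k|k|k]; last 1 first.
  have k' := val_inj k; rewrite -!k' in xz *.
  case: (ltngtP j c) => h3; case: (ltngtP a c) => h1; try (exfalso; ordlia);
  subst_index j; try rewrite (xy (erefl _)); try rewrite -(xz (erefl _)) (xy (erefl _));
    decide_tests; rewrite -?k' ?eqxx; field_w.
all: case: (ltngtP j c) => h3; case: (ltngtP j (rv c)) => h4; try (exfalso; ordlia);
  subst_index j; try rewrite (xy (erefl _)); try rewrite (xz (erefl _));
  case: (ltngtP a c) => h1; case: (ltngtP a (rv c)) => h2; try (exfalso; ordlia); decide_tests; field_w.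
Qed.

(** [flip3] takes the right-hand side at (a, c, a') to the left-hand side at
    (a, c', a'), so that a single expansion is enough. *)
Lemma braid_conj13 phi a c : c != a -> c != rv a ->
  actR12 (actR23 (actR12 phi)) a c (rv a) = actR23 (actR12 (actR23 phi)) a c (rv a).
Proof.
move=> nca nca'; have -> : actR23 (actR12 (actR23 phi)) a c (rv a) =
    actR12 (actR23 (actR12 (flip3 phi))) a (rv c) (rv a).
  by rewrite !(actR12_flip, actR23_flip) /flip3 !rev_ordK.
rewrite !braid_conj13_left //; last by rewrite (can_eq (@rev_ordK N)).
  apply: eq_bigr => i _; rewrite /flip3 !rev_ordK.
  by apply: braid_conj13_coef => // ->; rewrite ?rev_ordK.
by rewrite eq_sym eq_rev_ordC.
Qed.

Lemma braid_nconj phi a b c : b != rv a -> c != rv b -> c != rv a ->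
  actR12 (actR23 (actR12 phi)) a b c = actR23 (actR12 (actR23 phi)) a b c.
Proof.
move=> nab nbc nac.
have nba : a != rv b by rewrite eq_rev_ordC.
have ncb : b != rv c by rewrite eq_rev_ordC.
have nca : a != rv c by rewrite eq_rev_ordC.
rewrite /actR12 /actR23 !actR_nconj // !flipc_nconj //.
case: (ltngtP a b) => h1; case: (ltngtP a c) => h2; case: (ltngtP b c) => h3;
  try (exfalso; ordlia); subst_index a; try subst_index b; rewrite ?eqxx; decide_tests; field_w.
Qed.

Lemma braidE phi a b c :
  actR12 (actR23 (actR12 phi)) a b c = actR23 (actR12 (actR23 phi)) a b c.
Proof.
have [->|nab] := eqVneq b (rv a); first exact: braid_conj12.
have [->|nbc] := eqVneq c (rv b); first exact: braid_conj23.
have [E|nac] := eqVneq c (rv a); last exact: braid_nconj.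
subst c; apply: braid_conj13 => //.
by move: nbc; rewrite (can_eq (@rev_ordK N)) eq_sym.
Qed.

Lemma actR_conj_square phi a : actR (fun x y => actR phi x y) a (rv a) =
  phi a (rv a) + lam * actR phi a (rv a) - lam * mu * \sum_(i : I) (w i / w a) * phi (rv i) i.
Proof.
rewrite !actR_conj.
under eq_bigr => i _ do rewrite -{3}(rev_ordK i) actR_conj mulr_sumr.
rewrite exchange_big /=.
under eq_bigr => j _.
  have -> : \sum_(i : I) conjc a i * (conjc (rv i) j * phi (rv j) j) =
    (j == rv a)%:R * phi (rv j) j + lam * (conjc a j * phi (rv j) j)
    - lam * mu * (w j / w a * phi (rv j) j).
    by under eq_bigr do rewrite mulrA; rewrite -mulr_suml conjc_loop; ring.
  over.
by rewrite sumrB big_split /= sum_delta rev_ordK -!mulr_sumr.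
Qed.

(** K R = mu K, because w is an eigenvector: [cup_tailE] at the first index. *)
Lemma actR_cup phi : \sum_(i : I) w i * actR phi (rv i) i = mu * \sum_(i : I) w i * phi (rv i) i.
Proof.
under eq_bigr => i _ do rewrite -{3}(rev_ordK i) actR_conj mulr_sumr.
rewrite exchange_big mulr_sumr /=; apply: eq_bigr => j _.
have -> : \sum_(i : I) w i * (conjc (rv i) j * phi (rv j) j) = (\sum_(i : I) w i * conjc (rv i) j)
  * phi (rv j) j.
  by rewrite mulr_suml; apply: eq_bigr => i _; rewrite mulrA.
rewrite mulrA; congr (_ * _).
have N0 : (0 < N)%N by apply: leq_ltn_trans (ltn_ord j).
pose z : I := Ordinal N0.
have := cup_tailE z j; rewrite /cup_tail.
under eq_bigr do rewrite leq0n natr_true mul1r.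
move=> ->.
have hj := rev_ord_val j; have hz := rev_ord_val z.
have z0 : (z : nat) = 0%N by [].
have -> : (rv z < j)%N = false by lia.
by rewrite natr_false !mul0r addr0.
Qed.

(** Away from the pairs (a, a') the braiding satisfies the Hecke relation. *)
Lemma actR_nconj_square phi a b : b != rv a ->
  actR (fun x y => actR phi x y) a b = phi a b + lam * actR phi a b.
Proof.
move=> nab; have nba : a != rv b by rewrite eq_rev_ordC.
rewrite !actR_nconj // !flipc_nconj // (eq_sym b a).
case: (ltngtP a b) => [h|h|/val_inj h]; last subst b; rewrite ?eqxx.
- by decide_tests; field_w.
- by decide_tests; field_w.
- by rewrite ?ltnn ?natr_false; field_w.
Qed.

(** Multiply R^2 = 1 + lam R - lam mu K by R and use K R = mu K to eliminate K. *)
Lemma actR_cubic phi a b : let T (f : I -> I -> K) x y := actR f x y in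
  T (T (T phi)) a b = (lam + mu) * T (T phi) a b + (1 - lam * mu) * T phi a b - mu * phi a b.
Proof.
move=> T; have [->|nab] := eqVneq b (rv a); last first.
  have h f : T (T f) a b = f a b + lam * T f a b by apply: actR_nconj_square.
  by rewrite !h; ring.
have h f : T (T f) a (rv a) = f a (rv a) + lam * T f a (rv a)
    - lam * mu / w a * \sum_(i : I) w i * f (rv i) i.
  rewrite [LHS]actR_conj_square; congr (_ - _); rewrite !mulr_sumr.
  by apply: eq_bigr => i _; ring.
by rewrite !h actR_cup; ring.
Qed.

End OrthosymplecticBraiding.

(** * The spectral idempotents *)
Section Spectral.
Variables (K : fieldType) (N : nat) (X : coef4 K N) (q mu : K).
Hypothesis q0 : q != 0.

Lemma op2_lin : linear (op2 X).
Proof.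
move=> a u v; apply/matrixP => k l; rewrite !mxE mulr_sumr -big_split; apply: eq_bigr => i _ /=.
rewrite mulr_sumr -big_split; apply: eq_bigr => j _ /=.
by rewrite !mxE mulrDl mulrA.
Qed.

Lemma op2Z a u : op2 X (a *: u) = a *: op2 X u.
Proof. exact: (linZ op2_lin). Qed.
Lemma op2B u v : op2 X (u - v) = op2 X u - op2 X v.
Proof. by rewrite (linD op2_lin) -scaleN1r op2Z scaleN1r. Qed.

Hypothesis cubic : forall u, op2 X (op2 X (op2 X u)) =
  (q - q^-1 + mu) *: op2 X (op2 X u) + (1 - (q - q^-1) * mu) *: op2 X u - mu *: u.

(** The cubic relation is (R - q)(R + q^-1)(R - mu) = 0. *)
Lemma Pminus_eigen u : op2 X (Pminus q mu X u) = - q^-1 *: Pminus q mu X u.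
Proof.
rewrite /Pminus op2Z scalerA [- q^-1 * _]mulrC -[RHS]scalerA; congr (_ *: _); rewrite /shift_op.
rewrite !(op2B, op2Z) cubic.
move: (op2 X (op2 X u)) (op2 X u) => v2 v1; apply/matrixP => i j; rewrite !mxE; by field.
Qed.

Lemma Pplus_eigen u : op2 X (Pplus q mu X u) = q *: Pplus q mu X u.
Proof.
rewrite /Pplus op2Z scalerA [q * _]mulrC -[RHS]scalerA; congr (_ *: _); rewrite /shift_op.
rewrite !(op2B, op2Z) cubic.
move: (op2 X (op2 X u)) (op2 X u) => v2 v1; apply/matrixP => i j; rewrite !mxE; by field.
Qed.

(** On eigenvectors for -q^-1 the polynomial (R - q)(R - mu) is the normalizing
    constant. *)
Lemma Pminus_id u : (q + q^-1) * (q^-1 + mu) != 0 -> op2 X u = - q^-1 *: u -> Pminus q mu X u = u.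
Proof.
move=> C0 E; rewrite /Pminus /shift_op !(op2B, op2Z) !E !op2Z !E.
rewrite (_ : _ - q *: _ = ((q + q^-1) * (q^-1 + mu)) *: u) ?scalerA ?mulVf ?scale1r //.
by apply/matrixP => i j; rewrite !mxE; ring.
Qed.

Lemma Pplus_id u : (q + q^-1) * (q - mu) != 0 -> op2 X u = q *: u -> Pplus q mu X u = u.
Proof.
move=> C0 E; rewrite /Pplus /shift_op !(op2B, op2Z) !E !op2Z !E.
rewrite (_ : _ - (- q^-1) *: _ = ((q + q^-1) * (q - mu)) *: u) ?scalerA ?mulVf ?scale1r //.
by apply/matrixP => i j; rewrite !mxE; ring.
Qed.

End Spectral.

Section FRT.
Variables (K : fieldType) (g : bcd_series) (n : nat) (q s : K).
Hypothesis n0 : (0 < n)%N.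
Hypothesis s2 : s ^+ 2 = q.
Hypothesis q0 : q != 0.
Local Notation N := (dimV g n).
Local Notation I := 'I_N.
Local Notation rv := (@rev_ord N).
Local Notation lam := (q - q^-1).
Local Notation mu := (bmw_mu g n q).

(** The sign of the symmetry of the invariant bilinear form. *)
Definition form_sign : K := if orthogonal_series g then 1 else -1.
(** q^rho_i eps_i. *)
Definition wt (i : I) : K := s ^ rho2 g n i * veps K g n i.

Lemma s_neq0 : s != 0.
Proof. by apply: contraNneq q0 => h; rewrite -s2 h expr0n. Qed.

Lemma veps2 (i : nat) : veps K g n i * veps K g n i = 1.
Proof. by rewrite /veps; case: g => //; rewrite ?mulr1 //; case: ifP;
  rewrite ?mulr1 // mulrNN mulr1. Qed.

Lemma wt_neq0 i : wt i != 0.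
Proof.
rewrite mulf_neq0 ?expfz_neq0 ?s_neq0 //.
by apply/eqP => h; have := veps2 i; rewrite h mul0r => /eqP; rewrite eq_sym oner_eq0.
Qed.

Lemma form_sign2 : form_sign * form_sign = 1.
Proof. by rewrite /form_sign; case: ifP; rewrite ?mulr1 // mulrNN mulr1. Qed.

Lemma rho2_rev (i : I) : rho2 g n (rv i) = - rho2 g n i.
Proof.
have := ltn_ord i; rewrite /rho2 /dimV /=; case: g i => i /= hi.
- case: (ltngtP i n) => h; case: (ltngtP (n.*2.+1 - i.+1)%N n) => h'; lia.
- case: (ltnP i n) => h; case: (ltnP (n.*2 - i.+1)%N n) => h'; lia.
- case: (ltnP i n) => h; case: (ltnP (n.*2 - i.+1)%N n) => h'; lia.
Qed.

Lemma wt_rev i : wt i * wt (rv i) = form_sign.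
Proof.
rewrite /wt rho2_rev mulrACA -expfzDr ?s_neq0 // subrr expr0z mul1r.
have := ltn_ord i; rewrite /veps /form_sign /dimV /=; case: g i => i /= hi; rewrite ?mulr1 //.
case: (ltnP i n) => h; case: (ltnP (n.*2 - i.+1)%N n) => h'; rewrite ?mulr1 ?mul1r //; exfalso; lia.
Qed.

Lemma wt2 i : wt i ^+ 2 = q ^ rho2 g n i.
Proof.
rewrite exprMn [veps _ _ _ _ ^+ 2]expr2 veps2 mulr1 -s2.
by rewrite !exprnP !exprz_exp mulrC.
Qed.

Lemma sum_supp (P : pred I) (F : I -> K) x :
  (forall i, i != x -> F i = 0) -> \sum_(i | P i) F i = (P x)%:R * F x.
Proof.
move=> h; rewrite big_mkcond (bigD1 x) //= big1 => [|i ni]; last by rewrite h //; case: ifP.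
by rewrite addr0; case: ifP; rewrite ?mul1r ?mul0r.
Qed.

Lemma ee0 (i j p r a b k l : I) :
  ~~ [&& k == i, a == j, l == p & b == r] -> ee i j p r a b k l = 0 :> K.
Proof. by rewrite /ee => /negPf ->. Qed.

(** For fixed a, b, k, l each of the sums in the definition of R has at most one
    nonzero term. *)
Lemma bmwR_coef a b k l : bmwR q s a b k l =
  flipc q a b * ((k == b) && (l == a))%:R + lam * (a < b)%:R * ((k == a) && (l == b))%:R
  - lam * (b == rv a)%:R * (k == rv l)%:R * (a < l)%:R * (wt l / wt a).
Proof.
rewrite /bmwR /frtR.
rewrite (@sum_supp _ _ a) => [|i ni]; last by apply: ee0; rewrite (eq_sym a) (negPf ni) andbF.
rewrite (@sum_supp _ _ a) => [|i ni]; last by apply: ee0; rewrite (eq_sym a) (negPf ni) andbF.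
rewrite (_ : \sum_i \sum_(j | _) _ =
    ((a != b) && (a != rv b))%:R * ee a a b b a b l k); last first.
  rewrite (@sum_supp _ _ a) ?mul1r => [|i ni].
    rewrite (@sum_supp _ _ b) // => j nj.
    by apply: ee0; rewrite (eq_sym b) (negPf nj) !andbF.
  by apply: big1 => j _; apply: ee0; rewrite (eq_sym a) (negPf ni) andbF.
rewrite (@sum_supp _ _ b) => [|i ni]; last by apply: ee0; rewrite (eq_sym b) (negPf ni) !andbF.
rewrite (_ : \sum_i \sum_(j | _) _ = (a < b)%:R * ee b a a b a b l k); last first.
  rewrite (@sum_supp _ _ b) ?mul1r => [|i ni].
    rewrite (@sum_supp _ _ a) // => j nj.
    by apply: ee0; rewrite (eq_sym a) (negPf nj) andbF.
  by apply: big1 => j _; apply: ee0; rewrite (eq_sym b) (negPf ni) !andbF.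
rewrite (_ : \sum_i \sum_(j | _) _ =
  (a < l)%:R * (s ^ (rho2 g n l - rho2 g n a) * veps K g n l * veps K g n a *
     ee l a (rv l) (rv a) a b l k)); last first.
  rewrite (@sum_supp _ _ l) ?mul1r => [|i ni].
    rewrite (@sum_supp _ _ a) // => j nj.
    by rewrite ee0 ?mulr0 // (eq_sym a) (negPf nj) andbF.
  by apply: big1 => j _; rewrite ee0 ?mulr0 // (eq_sym l) (negPf ni).
have -> : s ^ (rho2 g n l - rho2 g n a) * veps K g n l * veps K g n a = wt l / wt a.
  rewrite /wt expfzDr ?s_neq0 // -invr_expz invfM.
  have -> : (veps K g n a)^-1 = veps K g n a.
    have h := veps2 a; apply: (mulfI (_ : veps K g n a != 0)); rewrite ?h ?mulfV //;
    by apply/eqP => h0; move: h; rewrite h0 mul0r => /eqP; rewrite eq_sym oner_eq0.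
  by ring.
rewrite /ee /flipc !eqxx /=.
have -> : (b == rv a) = (a == rv b) by rewrite eq_rev_ordC.
have [->|nab] := eqVneq a b.
  rewrite ltnn; case: (k == b); case: (l == b) => /=; case: (b == rv b) => /=;
  rewrite ?andbT ?andbF /=; case: (k == rv l); case: (b < l)%N => /=; ring.
have [E|nab'] := eqVneq a (rv b).
  have -> : (b == rv b) = false.
    by apply/negbTE; apply: contra nab => /eqP h; rewrite E -h.
  rewrite -E; case: (l == a); case: (k == b); case: (k == a); case: (l == b) => /=;
  rewrite ?andbT ?andbF /=; case: (k == rv l); case: (a < l)%N; case: (a < b)%N => /=; ring.
case: (l == a); case: (k == b); case: (k == a); case: (l == b) => /=;
  rewrite ?andbT ?andbF /=; case: (k == rv l); case: (a < l)%N; case: (a < b)%N => /=; ring.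
Qed.

Lemma bmwR_actR (phi : I -> I -> K) a b :
  \sum_k \sum_l bmwR q s a b k l * phi k l = actR q wt phi a b.
Proof.
have d2 (x y : I) (a0 : K) : \sum_k \sum_l a0 * ((k == x) && (l == y))%:R * phi k l = a0 * phi x y.
  rewrite (bigD1 x) //= (bigD1 y) //= !eqxx mulr1 !big1 ?addr0 // => [k nk|l nl].
    by apply: big1 => l _; rewrite (negPf nk) mulr0 mul0r.
  by rewrite (negPf nl) andbF mulr0 mul0r.
under eq_bigr => k _ do under eq_bigr => l _ do rewrite bmwR_coef mulrBl mulrDl.
under eq_bigr => k _ do rewrite sumrB big_split /=.
rewrite sumrB big_split /= !d2 /actR; congr (_ - _).
rewrite exchange_big mulr_sumr; apply: eq_bigr => l _.
rewrite (bigD1 (rv l)) //= eqxx big1 ?addr0 => [|k nk]; first by rewrite /=; ring.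
by rewrite (negPf nk) mulr0 !mul0r.
Qed.

(** For the cup term this amounts to w_l w_l' = w_b w_b'. *)
Lemma bmwR_sym (a b k l : I) : bmwR q s a b k l = bmwR q s k l a b.
Proof.
rewrite !bmwR_coef; congr (_ + _ - _).
- rewrite (eq_sym a l) (eq_sym b k).
  have [->|] := eqVneq k b; have [->|] := eqVneq l a; rewrite ?mulr0 ?mulr1 //=.
  by rewrite flipcC.
- rewrite (eq_sym a k) (eq_sym b l).
  by have [->|] := eqVneq k a; have [->|] := eqVneq l b; rewrite ?mulr0 ?mulr1.
have -> : (l == rv k) = (k == rv l) by rewrite eq_rev_ordC.
have -> : (b == rv a) = (a == rv b) by rewrite eq_rev_ordC.
have [Ea|_] := eqVneq a (rv b); have [Ek|_] := eqVneq k (rv l); rewrite ?mulr0 ?mul0r //.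
have -> : (a < l)%N = (k < b)%N.
  by rewrite Ea Ek /=; have := ltn_ord b; have := ltn_ord l; lia.
have := wt_rev b; have := wt_rev l; rewrite -Ea -Ek => h1 h2.
have w1 := wt_neq0 l; have w2 := wt_neq0 b; have w3 := wt_neq0 a; have w4 := wt_neq0 k.
have -> : wt l / wt a = wt b / wt k; last by ring.
apply: (mulIf w3); apply: (mulIf w4); rewrite mulfVK // h1 -h2.
by field.
Qed.

(** The right-hand side of [wt_tail] at a natural number, for an induction from the
    last index downwards. *)
Definition tail_rhs (m : nat) : K := (if m == (N - m.+1)%N then 1 else q^-1) * q ^ rho2 g n m
   - form_sign * (mu - lam * (m < N - m.+1)%:R).

(** This is where the value of mu comes from. *)
Lemma tail_last m : (m.+1 = N)%N -> tail_rhs m = 0.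
Proof.
move=> hm; rewrite /tail_rhs /bmw_mu /form_sign; have -> : (N - m.+1 = 0)%N by rewrite hm subnn.
rewrite ltn0 mulr0 subr0.
have -> : (m == 0)%N = false by move: hm n0; rewrite /dimV; case: g => /= hm n0'; lia.
have E : q^-1 = q ^ (-1 : int) by [].
move: hm; rewrite E -expfzDr // /rho2 /dimV; case: g => /= hm.
- have -> : (m < n)%N = false by lia.
  have -> : (m == n)%N = false by lia.
  by rewrite mul1r; apply/eqP; rewrite subr_eq0; apply/eqP; congr (_ ^ _); lia.
- have -> : (m < n)%N = false by lia.
  by rewrite mulNr mul1r opprK; apply/eqP; rewrite subr_eq0; apply/eqP; congr (_ ^ _); lia.
- have -> : (m < n)%N = false by lia.
  by rewrite mul1r; apply/eqP; rewrite subr_eq0; apply/eqP; congr (_ ^ _); lia.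
Qed.

(** Between consecutive indices rho drops by 1, except in the middle, where it drops by
    1/2 twice for B_n, by 2 for C_n and by 0 for D_n; the coefficient of q^(2 rho_m) and
    the term with lam change there as well. *)
Lemma tail_step m : (m.+1 < N)%N ->
  tail_rhs m = lam * q ^ rho2 g n m.+1 + tail_rhs m.+1.
Proof.
have d2 x : q ^ (x + 2) = q ^ x * q * q by rewrite expfzDr // -mulrA.
have q1 : q ^ (1 : int) = q by [].
have qm1 : q ^ (-1 : int) = q^-1 by [].
have qm2 : q ^ (-2 : int) = q^-1 * q^-1 by rewrite -qm1 -expfzDr.
rewrite /tail_rhs /form_sign; move: (bmw_mu g n q) => mu0; case: g => hm.
- change (dimV SeriesB n) with (n.*2.+1)%N in *; change (orthogonal_series SeriesB) with true.
  case: (ltngtP m.+1 n) => h.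
  + rewrite (_ : rho2 _ n m = rho2 SeriesB n m.+1 + 2); last first.
      by rewrite /rho2 h (ltnW h); lia.
    rewrite d2.
    have -> : (m == n.*2.+1 - m.+1)%N = false by lia.
    have -> : (m.+1 == n.*2.+1 - m.+2)%N = false by lia.
    have -> : (m < n.*2.+1 - m.+1)%N by lia.
    have -> : (m.+1 < n.*2.+1 - m.+2)%N by lia.
    by rewrite /=; field.
  + have [E|nE] := eqVneq m n.
      rewrite (_ : rho2 _ n m = 0); last by rewrite /rho2 E ltnn eqxx.
      rewrite (_ : rho2 _ n m.+1 = -1); last first.
        by rewrite /rho2 E ltnNge leqnSn /= (gtn_eqF (ltnSn n)); lia.
      rewrite expr0z qm1.
      have -> : (m == n.*2.+1 - m.+1)%N by lia.
      have -> : (m.+1 == n.*2.+1 - m.+2)%N = false by lia.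
      have -> : (m < n.*2.+1 - m.+1)%N = false by lia.
      have -> : (m.+1 < n.*2.+1 - m.+2)%N = false by lia.
      by rewrite /=; field.
    have hn : (n < m)%N by lia.
    rewrite (_ : rho2 _ n m = rho2 SeriesB n m.+1 + 2); last first.
      rewrite /rho2 !ltnNge (ltnW hn) (ltnW h) /= (gtn_eqF hn) (gtn_eqF h); lia.
    rewrite d2.
    have -> : (m == n.*2.+1 - m.+1)%N = false by lia.
    have -> : (m.+1 == n.*2.+1 - m.+2)%N = false by lia.
    have -> : (m < n.*2.+1 - m.+1)%N = false by lia.
    have -> : (m.+1 < n.*2.+1 - m.+2)%N = false by lia.
    by rewrite /=; field.
  + rewrite (_ : rho2 _ n m = 1); last by rewrite /rho2 -h ltnSn; lia.
    rewrite (_ : rho2 _ n m.+1 = 0); last by rewrite /rho2 h ltnn eqxx.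
    rewrite expr0z q1.
    have -> : (m == n.*2.+1 - m.+1)%N = false by lia.
    have -> : (m.+1 == n.*2.+1 - m.+2)%N by lia.
    have -> : (m < n.*2.+1 - m.+1)%N by lia.
    have -> : (m.+1 < n.*2.+1 - m.+2)%N = false by lia.
    by rewrite /=; field.
- change (dimV SeriesC n) with (n.*2)%N in *; change (orthogonal_series SeriesC) with false.
  have -> : (m == n.*2 - m.+1)%N = false by lia.
  have -> : (m.+1 == n.*2 - m.+2)%N = false by lia.
  have -> : (m < n.*2 - m.+1)%N = (m < n)%N by lia.
  have -> : (m.+1 < n.*2 - m.+2)%N = (m.+1 < n)%N by lia.
  case: (ltngtP m.+1 n) => h.
  + rewrite (_ : rho2 _ n m = rho2 SeriesC n m.+1 + 2); last first.
      by rewrite /rho2 h (ltnW h); lia.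
    by rewrite d2 /=; field.
  + have hn : (n <= m)%N by lia.
    rewrite (_ : rho2 _ n m = rho2 SeriesC n m.+1 + 2); last first.
      by rewrite /rho2 !ltnNge hn (ltnW h) /=; lia.
    by rewrite d2 /=; field.
  + rewrite (_ : rho2 _ n m = 0 + 2); last by rewrite /rho2 -h ltnSn; lia.
    rewrite (_ : rho2 _ n m.+1 = -2); last by rewrite /rho2 h ltnn; lia.
    by rewrite d2 expr0z qm2 /=; field.
- change (dimV SeriesD n) with (n.*2)%N in *; change (orthogonal_series SeriesD) with true.
  have -> : (m == n.*2 - m.+1)%N = false by lia.
  have -> : (m.+1 == n.*2 - m.+2)%N = false by lia.
  have -> : (m < n.*2 - m.+1)%N = (m < n)%N by lia.
  have -> : (m.+1 < n.*2 - m.+2)%N = (m.+1 < n)%N by lia.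
  case: (ltngtP m.+1 n) => h.
  + rewrite (_ : rho2 _ n m = rho2 SeriesD n m.+1 + 2); last first.
      by rewrite /rho2 h (ltnW h); lia.
    by rewrite d2 /=; field.
  + have hn : (n <= m)%N by lia.
    rewrite (_ : rho2 _ n m = rho2 SeriesD n m.+1 + 2); last first.
      by rewrite /rho2 !ltnNge hn (ltnW h) /=; lia.
    by rewrite d2 /=; field.
  + rewrite (_ : rho2 _ n m = 0); last by rewrite /rho2 -h ltnSn; lia.
    rewrite (_ : rho2 _ n m.+1 = 0); last by rewrite /rho2 h ltnn; lia.
    by rewrite expr0z /=; field.
Qed.

Lemma wt_tail (b : I) : lam * \sum_(i < N) (b < i)%:R * wt i ^+ 2
    = flipc q b (rv b) * wt b ^+ 2 - form_sign * (mu - lam * (b < rv b)%:R).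
Proof.
rewrite flipc_conj wt2 -[RHS]/(tail_rhs b).
have -> : \sum_(i < N) (b < i)%:R * wt i ^+ 2 = \sum_(b.+1 <= i < N) q ^ rho2 g n i.
  rewrite big_geq_mkord [RHS]big_mkcond /=; apply: eq_bigr => i _.
  by rewrite wt2; case: (b < i)%N; rewrite ?mul1r ?mul0r.
have [k] : {k | (b + k.+1 = N)%N} by exists (N - b.+1)%N; have := ltn_ord b; lia.
elim: k (nat_of_ord b) => [|k IH] m hm.
  by rewrite big_geq ?mulr0 ?tail_last // -hm addn1.
have hm1 : (m.+1 < N)%N by rewrite -hm; lia.
have hm2 : (m.+1 + k.+1)%N = N by rewrite -hm; lia.
by rewrite (big_ltn hm1) [LHS]mulrDr (IH _ hm2) (tail_step hm1).
Qed.

End FRT.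

(** * Compatibility *)
Section BMWCompatibility.
Variables (K : fieldType) (g : bcd_series) (n : nat) (q s : K).
Hypothesis n0 : (0 < n)%N.
Hypothesis s2 : s ^+ 2 = q.
Hypothesis q0 : q != 0.
Local Notation N := (dimV g n).
Local Notation I := 'I_N.
Local Notation R := (@bmwR K g n q s).
Local Notation mu := (bmw_mu g n q).
Local Notation wt := (@wt K g n s).

Let wt0 (i : I) : wt i != 0 := wt_neq0 s2 q0 i.
Let wrev (i : I) : wt i * wt (rev_ord i) = form_sign K g := wt_rev n0 s2 q0 i.
Let e2 : form_sign K g * form_sign K g = 1 := form_sign2 K g.
Let tl := @wt_tail K g n q s n0 s2 q0.

(** [braidE] for the indicator function of the triple (k, l, m). *)
Lemma bmwR_braided : braided R.
Proof.
move=> a b c k l m.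
pose phi (x y z : I) : K := (z == m)%:R * ((x == k)%:R * (y == l)%:R).
have d2 (F : I -> I -> K) : \sum_x \sum_y F x y * ((x == k)%:R * (y == l)%:R) = F k l.
  rewrite -(sum_delta k (fun x => F x l)); apply: eq_bigr => x _.
  rewrite -(sum_delta l (F x)) mulr_sumr; apply: eq_bigr => y _; ring.
have E12 (f : I -> I -> I -> K) x y z :
    actR12 q wt f x y z = \sum_i \sum_j R x y i j * f i j z.
  by rewrite /actR12 -(bmwR_actR s2 q0).
have E23 (f : I -> I -> I -> K) x y z :
    actR23 q wt f x y z = \sum_i \sum_j R y z i j * f x i j.
  by rewrite /actR23 -(bmwR_actR s2 q0).
have P12 x y z : actR12 q wt phi x y z = (z == m)%:R * R x y k l.
  rewrite E12 -(d2 (R x y)) mulr_sumr; apply: eq_bigr => i _; rewrite mulr_sumr.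
  by apply: eq_bigr => j _; rewrite /phi; ring.
have P23 x y z : actR23 q wt phi x y z = (x == k)%:R * R y z l m.
  rewrite E23 -(sum_delta l (fun i => R y z i m)) mulr_sumr; apply: eq_bigr => i _.
  rewrite -(sum_delta m (fun j => R y z i j)) !mulr_sumr; apply: eq_bigr => j _.
  by rewrite /phi; ring.
transitivity (actR12 q wt (actR23 q wt (actR12 q wt phi)) a b c).
  rewrite E12; apply: eq_bigr => i _; apply: eq_bigr => j _.
  rewrite E23 mulr_sumr; apply: eq_bigr => p _.
  rewrite -(sum_delta m (fun m' => R j c p m')) mulr_sumr mulr_suml mulr_sumr.
  by apply: eq_bigr => m' _; rewrite P12; ring.
rewrite (braidE q0 wt0 wrev e2 tl).
rewrite E23; apply: eq_bigr => i _; apply: eq_bigr => j _.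
rewrite E12 exchange_big mulr_sumr; apply: eq_bigr => p _.
rewrite -(sum_delta k (fun x => R a i x p)) [LHS]mulr_sumr [X in _ = X * _]mulr_sumr mulr_suml;
  apply: eq_bigr => x _.
by rewrite P23; ring.
Qed.

Lemma op2_actR (u : 'M[K]_N) k l : op2 R u k l = actR q wt u k l.
Proof.
rewrite mxE -(bmwR_actR s2 q0); apply: eq_bigr => i _; apply: eq_bigr => j _.
by rewrite mulrC (bmwR_sym n0 s2 q0).
Qed.

Lemma dual_actR (u : 'M[K]_N) i j :
  op2 (dual_coef R) u i j = actR q wt (fun x y => u y x) j i.
Proof.
rewrite mxE -(bmwR_actR s2 q0) exchange_big; apply: eq_bigr => l _; apply: eq_bigr => k _.
by rewrite mulrC.
Qed.

Lemma op2_cubic u : op2 R (op2 R (op2 R u)) =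
  (q - q^-1 + mu) *: op2 R (op2 R u) + (1 - (q - q^-1) * mu) *: op2 R u - mu *: u.
Proof.
have E v : (op2 R v : I -> I -> K) = actR q wt v.
  by apply/funext => a; apply/funext => b; rewrite op2_actR.
apply/matrixP => a b; have /= := actR_cubic q0 wt0 wrev e2 tl u a b; rewrite -!E.
move: (op2 R (op2 R (op2 R u))) (op2 R (op2 R u)) (op2 R u) => v3 v2 v1 ->.
by rewrite !mxE.
Qed.

Lemma dual_cubic u : op2 (dual_coef R) (op2 (dual_coef R) (op2 (dual_coef R) u)) =
  (q - q^-1 + mu) *: op2 (dual_coef R) (op2 (dual_coef R) u)
  + (1 - (q - q^-1) * mu) *: op2 (dual_coef R) u - mu *: u.
Proof.
have E v : (fun x y => op2 (dual_coef R) v y x) = actR q wt (fun x y => v y x).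
  by apply/funext => a; apply/funext => b; rewrite dual_actR.
apply/matrixP => a b.
have /= := actR_cubic q0 wt0 wrev e2 tl (fun x y => u y x) b a; rewrite -!E.
set D := op2 _; move: (D (D (D u))) (D (D u)) (D u) => v3 v2 v1 ->.
by rewrite !mxE.
Qed.

Section Compatible.
Variables (Psi : coef4 K N) (c : K) (P : coef4 K N -> 'M[K]_N -> 'M[K]_N).
Hypothesis skew : skew_inverse R Psi.
Hypothesis P_eigen : forall X, X = R \/ X = dual_coef R -> forall u, op2 X (P X u) = - c *: P X u.
Hypothesis P_id : forall X u, op2 X u = - c *: u -> P X u = u.

(** The image of P X is the eigenspace of X for -c, which the slices preserve. *)
Lemma bmw_compatible : compatible Psi c (P (dual_coef R)) (P R).
Proof.
have hB u l := eigenB skew bmwR_braided l (P_eigen (or_introl erefl) u).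
have hA u m := eigenA skew bmwR_braided m (P_eigen (or_intror erefl) u).
apply: compatible_of_stable.
- by move=> u l k; exists (sliceB Psi l k (P R u)); rewrite [RHS]P_id //; exact: (proj1 (hB u l)).
- by move=> u l i; have [] := hB u l.
- by move=> u m k; exists (sliceA Psi m k (P (dual_coef R) u)); rewrite [RHS]P_id //;
  exact: (proj1 (hA u m)).
- by move=> u m j; have [] := hA u m.
Qed.

End Compatible.
End BMWCompatibility.

Local Open Scope complex_scope.

Theorem proposition7 (Re : realType) (g : bcd_series) (n : nat) (q s : Re[i])
    (Psi : coef4 Re[i] (dimV g n)) :
  let R := bmwR q s in
  let mu := bmw_mu g n q in
  (0 < n)%N ->
  s ^+ 2 = q ->
  generic q mu ->
  skew_inverse R Psi ->
  (orthogonal_series g ->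
     perm_rel_equiv R Psi q^-1
     /\ compatible Psi q^-1
          (Pminus q mu (dual_coef R)) (Pminus q mu R))
  /\
  (~~ orthogonal_series g ->
     perm_rel_equiv R Psi (- q)
     /\ compatible Psi (- q)
          (Pplus q mu (dual_coef R)) (Pplus q mu R)).
Proof.
move=> R mu n0 s2 [q0 _ _] /and4P[]; rewrite !inE negb_or => /andP[nq nqmu] nmu _ _ skew.
have cub X : X = R \/ X = dual_coef R -> forall u, op2 X (op2 X (op2 X u)) =
   (q - q^-1 + mu) *: op2 X (op2 X u) + (1 - (q - q^-1) * mu) *: op2 X u - mu *: u.
  by case=> ->; [exact: op2_cubic|exact: dual_cubic].
have c1 : q + q^-1 != 0 by rewrite -[q^-1]opprK subr_eq0.
split=> _; split; try exact: perm_rel_equivP.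
- apply: (bmw_compatible n0 s2 q0 (P := Pminus q mu)) => // [X hX u|X u].
    by apply: (Pminus_eigen q0); apply: cub.
  apply: Pminus_id; rewrite mulf_neq0 //.
  by rewrite -[q^-1]opprK addrC subr_eq0 eq_sym.
- apply: (bmw_compatible n0 s2 q0 (P := Pplus q mu)) => // [X hX u|X u]; rewrite opprK.
    by apply: (Pplus_eigen q0); apply: cub.
  by apply: Pplus_id; rewrite mulf_neq0 // subr_eq0.
Qed.
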